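(* There is a (geometric) constant $\mathbf c>0$ such that the following holds. Let $F\in C^1_H(\mathbb H^1,\mathbb R^2)$ with $\det d_hF\ne0$ everywhere. Suppose that the level curves of $F$ are equi-strongly Ahlfors regular, i.e. for every $R>0$ the estimate $$\mathcal H^2_\infty([A,B])=d_\infty(A,B)^2+o\big(d_\infty(A,B)^2\big)$$ holds uniformly for $a\in\bar B(0,R)\subset\mathbb R^2$ and for all intervals (subarcs) $[A,B]\subset B_\infty(0,R)\cap F^{-1}(a)$ of the vertical curve $F^{-1}(a)$ (the $o$ being as $A\to B$). Then for every Borel set $E\subset\mathbb H^1$, $$\int_{\mathbb R^2}\mathcal H^2_\infty\big(F^{-1}(a)\cap E\big)\,d\mathcal L^2(a)=\mathbf c\int_E|\det d_hF(A)|\,d\mathcal H^4_\infty(A).$$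
   Context: The Heisenberg group $\mathbb H^1$ is $\mathbb R^3$ with the law $(x,y,z)(x',y',z')=(x+x',y+y',z+z'+2x'y-2xy')$ and dilations $\delta_t(x,y,z)=(tx,ty,t^2z)$. Put $\rho_\infty(x,y,z)=\max\{\sqrt{x^2+y^2},|z|^{1/2}\}$ and $d_\infty(A,B)=\rho_\infty(B^{-1}A)$ (a left-invariant metric); $B_\infty(A,r)$ is the open ball. A map $F:\mathbb H^1\to\mathbb R^2$ is horizontally differentiable at $A$ if there is a continuous group homomorphism $L:\mathbb H^1\to\mathbb R^2$ with $L(\delta_tB)=tL(B)$ ($t>0$) and $\|F(AB)-F(A)-L(B)\|=o(\rho_\infty(B))$ as $B\to0$; then $D_hF(A):=L$. $F\in C^1_H$ if this holds at every $A$ and $A\mapsto D_hF(A)$ is continuous. $d_hF(A):\mathbb R^2\to\mathbb R^2$ is the linear map $d_hF(A)(x,y)=D_hF(A)(x,y,0)$. When $\det d_hF\ne 0$ everywhere, each level set $F^{-1}(a)$ is locally a simple arc; $[A,B]$ denotes a subarc of $F^{-1}(a)$ with endpoints $A,B$. $\mathcal H^k_\infty(E)=\lim_{\varepsilon\to0}\inf\{\sum_i(\operatorname{diam}E_i)^k: E\subset\bigcup_iE_i,\ \operatorname{diam}E_i\le\varepsilon\}$, with diameters for $d_\infty$ (no normalizing constant); $\mathcal L^2$ is Lebesgue measure. ''Geometric constant'' means that $\mathbf c$ does not depend on $F$ or $E$. *)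

(* Defs.v *)
From HB Require Import structures.
From mathcomp Require Import all_boot all_order all_algebra.
From mathcomp Require Import all_classical all_reals all_analysis.
From mathcomp Require Import measurable_realfun.

Set Implicit Arguments.
Unset Strict Implicit.
Unset Printing Implicit Defensive.

Import Order.TTheory GRing.Theory Num.Theory.
Import numFieldNormedType.Exports.

Local Open Scope classical_set_scope.
Local Open Scope ring_scope.

Section Hausdorff.
Context {R : realType} {T : Type}.
Implicit Types (d : T -> T -> R) (E : set T).
Local Open Scope ereal_scope.

(* The added 0 only matters for the empty set, whose diameter is 0. *)
Definition ediam d E : \bar R :=
  ereal_sup (0 |` [set (d x y)%:E | x in E & y in E]).

Definition hausdorff_pre d (k : nat) (e : R) E : \bar R :=
  ereal_inf [set \sum_(0 <= i <oo) ediam d (C i) ^+ k |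
    C in [set C : (set T)^nat |
      E `<=` \bigcup_i C i /\ forall i, ediam d (C i) <= e%:E]].

(* No normalizing constant. [hausdorff_pre] is nonincreasing in [e], so the
   limit exists in [\bar R]. The exponents of interest are positive, so finite
   covers may be padded with empty sets. The result is an outer measure on all
   subsets of [T]; an integral against it only sees its values on measurable
   sets. *)
Definition hausdorff d (k : nat) E : \bar R :=
  lim (hausdorff_pre d k e E @[e --> 0^'+]).

End Hausdorff.

(* The product topology is that of R^3, hence also that of [hdist] below. The
   product sigma-algebra is the Borel one, see [heis_measurableE]. *)
Notation heis R := (R * R * R)%type.

Section Heisenberg.
Context {R : realType}.
Implicit Types (A B : heis R) (p : R * R) (F : heis R -> R * R).

Definition hmul A B : heis R :=
  (A.1.1 + B.1.1, A.1.2 + B.1.2,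
   A.2 + B.2 + 2 * B.1.1 * A.1.2 - 2 * A.1.1 * B.1.2).

Definition hinv A : heis R := (- A.1.1, - A.1.2, - A.2).

Definition hdil (t : R) A : heis R := (t * A.1.1, t * A.1.2, t ^+ 2 * A.2).

(* The norm of [R * R] as a product is the maximum norm. *)
Definition enorm2 p : R := Num.sqrt (p.1 ^+ 2 + p.2 ^+ 2).

Definition hrho A : R := Num.max (enorm2 A.1) (Num.sqrt `|A.2|).

Definition hdist A B : R := hrho (hmul (hinv B) A).

Definition hball A (r : R) : set (heis R) := [set B | hdist B A < r].

Definition hhom (L : heis R -> R * R) : Prop :=
  [/\ continuous L,
      forall A B, L (hmul A B) = L A + L B &
      forall (t : R) B, 0 < t -> L (hdil t B) = t *: L B].

Definition is_hdiff F A (L : heis R -> R * R) : Prop :=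
  hhom L /\
  forall e : R, 0 < e ->
    \forall B \near (0 : heis R),
      enorm2 (F (hmul A B) - F A - L B) <= e * hrho B.

Definition hdifferentiable F A : Prop := exists L, is_hdiff F A L.

(* Junk value where [F] is not horizontally differentiable; elsewhere the
   differential is unique. *)
Definition Dh F A : heis R -> R * R := xget (fun=> 0) [set L | is_hdiff F A L].

(* Continuity of [A |-> Dh F A] is for the operator norm
   [sup_{hrho B <= 1} |L B|] on homogeneous homomorphisms. *)
Definition C1H F : Prop :=
  (forall A, hdifferentiable F A) /\
  forall A (e : R), 0 < e ->
    \forall A' \near A, forall B,
      enorm2 (Dh F A' B - Dh F A B) <= e * hrho B.

Definition dh F A : R * R -> R * R := fun p => Dh F A (p.1, p.2, 0).

Definition det2 (f : R * R -> R * R) : R :=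
  \det (\matrix_(i < 2, j < 2)
    let v := f (if j == 0 then (1, 0) else (0, 1)) in
    if i == 0 then v.1 else v.2).

Lemma det2E (f : R * R -> R * R) :
  det2 f = (f (1, 0)).1 * (f (0, 1)).2 - (f (0, 1)).1 * (f (1, 0)).2.
Proof.
rewrite /det2 (expand_det_row _ ord0) !big_ord_recl big_ord0 addr0.
rewrite /cofactor !det_mx11 !mxE/= expr0 expr1 mul1r mulN1r.
by rewrite mulrN.
Qed.

(* [S] is a (nondegenerate) simple arc with endpoints [A] and [B]. *)
Definition simple_arc A B (S : set (heis R)) : Prop :=
  exists g : R -> heis R,
    [/\ {within `[0, 1], continuous g}, set_inj `[0, 1] g,
        g 0 = A, g 1 = B & S = g @` `[0, 1]].

(* The bound on [hdist A B] is what "o as A -> B, uniformly" means: [dlt] may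
   depend on [r] and [e], but not on the level [a] nor on the arc. *)
Definition equi_strongly_Ahlfors_regular F : Prop :=
  forall r : R, 0 < r ->
  forall e : R, 0 < e ->
  exists2 dlt : R, 0 < dlt &
    forall (a : R * R) A B (S : set (heis R)),
      enorm2 a <= r ->
      simple_arc A B S ->
      S `<=` hball 0 r `&` F @^-1` [set a] ->
      hdist A B < dlt ->
      (`| hausdorff hdist 2 S - (hdist A B ^+ 2)%:E |
         <= (e * hdist A B ^+ 2)%:E)%E.

End Heisenberg.

Section Borel.
Context {R : realType}.

Let ball_measurable (a e : R) : measurable (ball a e).
Proof. by apply: open_measurable; exact: ball_open. Qed.

Lemma heis_open_measurable (U : set (heis R)) : open U -> measurable U.
Proof.
move=> oU.
pose c (q : rat * rat * rat) : heis R :=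
  (ratr q.1.1 : R, ratr q.1.2 : R, ratr q.2 : R).
pose bx (i : (rat * rat * rat) * nat) := ball (c i.1) (i.2.+1%:R^-1 : R).
have mbx i : measurable (bx i).
  have -> : bx i = ball ((c i.1).1.1) i.2.+1%:R^-1 `*`
     ball ((c i.1).1.2) i.2.+1%:R^-1 `*` ball ((c i.1).2) i.2.+1%:R^-1 by [].
  by apply: measurableX; [apply: measurableX|]; exact: ball_measurable.
have -> : U = \bigcup_(i in [set i | bx i `<=` U]) bx i.
  apply/seteqP; split=> [x Ux|x [i iU]]; last exact: iU.
  have /nbhs_ballP[e /= e0 eU] := open_nbhs_nbhs (conj oU Ux).
  have e20 : 0 < e / 2 by rewrite divr_gt0.
  have [n] := ltr_add_invr e20; rewrite add0r => /ltW ne2.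
  have n0 : (0 : R) < n.+1%:R^-1 by rewrite invr_gt0.
  have ne : n.+1%:R^-1 + n.+1%:R^-1 <= e :> R by rewrite (splitr e) lerD.
  have pk (u : R) : {q : rat | ball (ratr q : R) n.+1%:R^-1 u}.
    have /rat_in_itvoo/cid[q] : u - n.+1%:R^-1 < u + n.+1%:R^-1.
      by rewrite ltrD2l (lt_trans _ n0)// oppr_lt0.
    by rewrite in_itv/= => qu; exists q; apply: ball_sym; rewrite /ball/= ltr_distlC.
  have [q1 h1] := pk x.1.1; have [q2 h2] := pk x.1.2; have [q3 h3] := pk x.2.
  have xb : bx ((q1, q2, q3), n) x by split; [split|].
  exists ((q1, q2, q3), n) => //= y yb.
  apply: eU; apply: (@le_ball _ _ _ (n.+1%:R^-1 + n.+1%:R^-1)) => //.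
  by apply: (@ball_triangle _ _ (c (q1, q2, q3))) => //; exact: ball_sym.
rewrite bigcup_mkcond; apply: countable_bigcupT_measurable => [|i].
  exact: countableP.
by case: ifPn.
Qed.

Let preimage_g_sigma (T U : Type) (f : T -> U) (S : set (set T))
    (C : set (set U)) : (forall A, C A -> <<s S >> (f @^-1` A)) ->
  forall A, <<s C >> A -> <<s S >> (f @^-1` A).
Proof.
move=> CS; suff : <<s C >> `<=` [set A | <<s S >> (f @^-1` A)] by [].
apply: smallest_sub => //; split => /= [|A|F].
- by rewrite preimage_set0; exact: sigma_algebra0.
- by move=> SA; rewrite setTD -preimage_setC -setTD; exact: sigma_algebraCD.
- by move=> SF; rewrite preimage_bigcup; exact: sigma_algebra_bigcup.
Qed.

Let preimage_continuous (f : heis R -> R) : continuous f ->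
  forall A, measurable A -> <<s (@open (heis R)) >> (f @^-1` A).
Proof.
move=> /continuousP cf A mA.
have {mA} : <<s @RGenOpens.G R >> A.
  exact: (eq_ind _ (fun M : set (set R) => M A) mA _ (RGenOpens.measurableE R)).
move: A; apply: (@preimage_g_sigma _ _ f _ (@RGenOpens.G R)) => _ [x [y ->]].
by apply: sub_sigma_algebra; apply: cf; exact: interval_open.
Qed.

Lemma heis_measurableE : @measurable _ (heis R) = <<s (@open (heis R)) >>.
Proof.
apply/seteqP; split; last first.
  apply: smallest_sub; first exact: sigma_algebra_measurable.
  exact: heis_open_measurable.
have c1 : continuous (@fst (R * R) R) by move=> x; exact: cvg_fst.
have c2 : continuous (@snd (R * R) R) by move=> x; exact: cvg_snd.
apply: smallest_sub; first exact: smallest_sigma_algebra.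
rewrite subUset; split=> _ [A mA <-]; rewrite setTI; last first.
  exact: preimage_continuous.
move: A mA; apply: preimage_g_sigma => _ [] [A mA <-]; rewrite setTI.
- apply: (@preimage_continuous (fun x => x.1.1)) => // x.
  by apply: continuous_comp; [exact: cvg_fst|exact: cvg_fst].
- apply: (@preimage_continuous (fun x => x.1.2)) => // x.
  by apply: continuous_comp; [exact: cvg_fst|exact: cvg_snd].
Qed.

End Borel.

(* Main.v *)
Require Import Defs.
From HB Require Import structures.
From mathcomp Require Import all_boot all_order all_algebra.
From mathcomp Require Import all_classical all_reals all_analysis.
From mathcomp Require Import measurable_realfun ring lra zify.

Set Implicit Arguments.
Unset Strict Implicit.
Unset Printing Implicit Defensive.

Import Order.TTheory GRing.Theory Num.Theory.
Import numFieldNormedType.Exports.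

Local Open Scope classical_set_scope.
Local Open Scope ring_scope.

(* A Borel measure on the group that is finite on balls is determined by its values,
   known up to o(s^4), on the small tiles [htile A s], the left translates of the dilated
   unit cube, since such tiles partition the group at every scale. In particular Lebesgue
   measure is a multiple of the 4-dimensional Hausdorff measure, and it suffices to show
   that a tile of side s near A0 has
     \int H^2 (F^-1 a & htile A s) da = |det (dh F A0)| s^4 + o(s^4).
   After composing F with the inverse of dh F A0, the map f satisfies
     |f B - f A - pi (A^-1 B)| <= eta d(A, B)
   near A0, where pi is the horizontal projection. Hence on a level set of f the distance
   is governed by the vertical coordinate, d(C, D)^2 = |zeta (C, D)|, and zeta is additive
   up to a factor 1 + eta. A Newton-type argument gives level points near any prescribed
   height; repeated bisection then shows that the level points between two given ones
   form a simple arc. So the level set of b meets the tile, up to O(eta), in one arc with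
   d(P, P')^2 = s^2 if b - f A lies in the square [0, s]^2, and not at all otherwise.
   Ahlfors regularity turns this into H^2 = s^2, and integrating over b gives s^4, which
   the linear change of variables multiplies by |det (dh F A0)|. *)

(** * Hausdorff measures on a metric space *)

(** Ahlfors regularity speaks only of simple arcs, and a map in [C1H] may fail to be differentiable
    in the Euclidean sense, so the arcs cannot be read off the classical implicit function theorem
    and are produced from the metric alone. In place of a parametrization there is an order by
    height on each level set, almost additive, with the distance equal to the square root of the
    height difference. For each tile and level two arcs are made: one ends slightly outside the tile
    and covers its level points, one ends slightly inside and stays in it. They confine H^2 from
    both sides. The comparison on tiles plays the part of a differentiation theorem: the errors
    o(s^4) are summed over disjoint tiles of one mesh, where they add up to o(1) times the volume.
    The constant [c] comes from the group alone: against Lebesgue measure the area formula has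
    constant 1, and [c] is the ratio of Lebesgue measure to H^4, fixed before [F]. Numbers such as
    200 or 500 below are rough bounds that leave slack; [eta <= 1 / 1000] absorbs them. *)

Lemma lee_expe {R : realType} (x y : \bar R) n :
  (0 <= x -> x <= y -> x ^+ n <= y ^+ n)%E.
Proof.
move=> x0 xy; elim: n => [|n IH]; first by rewrite !expe0.
by rewrite !expeS; apply: lee_pmul => //; exact: expe_ge0.
Qed.

Section HausdorffOuterMeasure.
Context {R : realType} {T : pointedType} (d : T -> T -> R) (k : nat).
Local Open Scope ereal_scope.
Implicit Types (E X Y : set T).

Lemma ediam_ge0 E : 0 <= ediam d E.
Proof. by apply: ereal_sup_ubound; left. Qed.

Lemma ediam_le E (r : R) : (0 <= r)%R ->
  (forall x y, E x -> E y -> (d x y <= r)%R) -> ediam d E <= r%:E.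
Proof.
move=> r0 Er; apply: ge_ereal_sup => _ [->|[x Ex [y Ey <-]]].
  by rewrite lee_fin.
by rewrite lee_fin Er.
Qed.

Lemma dist_le_ediam E x y : E x -> E y -> (d x y)%:E <= ediam d E.
Proof.
by move=> Ex Ey; apply: ereal_sup_ubound; right; exists x => //; exists y.
Qed.

Lemma ediam0 : ediam d set0 = 0.
Proof. by apply/eqP; rewrite eq_le ediam_ge0 andbT; apply: ediam_le. Qed.

(** The value +oo on sets of large diameter replaces the mesh condition on covers by a condition on
    the set function. The exponent is [k.+1] because 0 ^ 0 = 1 would charge the empty sets that pad
    a cover. *)
Definition gauge (e : R) E : \bar R :=
  if ediam d E <= e%:E then ediam d E ^+ k.+1 else +oo.

Lemma gauge_ge0 e E : 0 <= gauge e E.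
Proof. by rewrite /gauge; case: ifPn => // _; rewrite expe_ge0// ediam_ge0. Qed.

Lemma gauge0 e : (0 <= e)%R -> gauge e set0 = 0.
Proof. by move=> e0; rewrite /gauge ediam0 lee_fin e0 expeS mul0e. Qed.

(** Makes the general theory of outer measures generated by a set function available. In the
    sigma-algebra generated by all sets every cover is a measurable one, so the two infima run over
    the same covers of finite cost. *)
Lemma hausdorff_preE e : hausdorff_pre d k.+1 e =
  @mu_ext _ (g_sigma_algebraType [set: set T]) R (gauge e).
Proof.
apply/funext => E; apply/eqP; rewrite eq_le; apply/andP; split.
  apply: le_ereal_inf_tmp => _ [C [mC EC] <-].
  have [Ce|/existsNP[i /negP Ci]] :=
      pselect (forall i, ediam d (C i) <= e%:E).
    apply: ereal_inf_lbound; exists C => //.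
    by apply: eq_eseriesr => i _; rewrite /gauge Ce.
  rewrite (@eseries_pinfty _ _ predT i)//; first exact: leey.
    by move=> n _; rewrite -ltNye (lt_le_trans _ (gauge_ge0 _ _)).
  by rewrite /gauge (negbTE Ci).
apply: le_ereal_inf_tmp => _ [C [EC Ce] <-].
apply: ereal_inf_lbound; exists C => //.
  by split => // n; exact: sub_sigma_algebra.
by apply: eq_eseriesr => i _; rewrite /gauge Ce.
Qed.

Local Notation pre := (hausdorff_pre d k.+1).
Local Notation H := (hausdorff d k.+1).

Lemma hausdorff_pre_ge0 e E : 0 <= pre e E.
Proof. by rewrite hausdorff_preE; apply: mu_ext_ge0; exact: gauge_ge0. Qed.

Lemma hausdorff_pre0 e : (0 <= e)%R -> pre e set0 = 0.
Proof.
move=> e0; rewrite hausdorff_preE; apply: mu_ext0; last exact: gauge_ge0.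
exact: gauge0.
Qed.

Lemma le_hausdorff_pre e E X : E `<=` X -> pre e E <= pre e X.
Proof. by move=> EX; rewrite hausdorff_preE; exact: le_mu_ext. Qed.

Lemma hausdorff_pre_sigma_subadditive e (C : (set T)^nat) :
  pre e (\bigcup_i C i) <= \sum_(i <oo) pre e (C i).
Proof.
by rewrite hausdorff_preE; apply: mu_ext_sigma_subadditive; exact: gauge_ge0.
Qed.

Lemma hausdorff_pre_antitone e e' E : (e <= e')%R -> pre e' E <= pre e E.
Proof.
move=> ee'; apply: ereal_inf_le_tmp => _ [C [EC Ce] <-]; exists C => //.
by split=> // i; rewrite (le_trans (Ce i))// lee_fin.
Qed.

Lemma hausdorffE E : H E = ereal_sup [set pre e E | e in [set e | (0 < e)%R]].
Proof.
apply: cvg_lim => //.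
have -> : [set e : R | (0 < e)%R] = [set` Interval (BRight 0%R) (BInfty R false)].
  by apply/seteqP; split => x /=; rewrite in_itv/= ?andbT.
apply: nonincreasing_at_right_cvge => // x y _ _ xy.
exact: hausdorff_pre_antitone.
Qed.

Lemma hausdorff_pre_le e E : (0 < e)%R -> pre e E <= H E.
Proof. by move=> e0; rewrite hausdorffE; apply: ereal_sup_ubound; exists e. Qed.

Lemma hausdorff_le E M :
  (forall e, (0 < e)%R -> pre e E <= M) -> H E <= M.
Proof.
by move=> EM; rewrite hausdorffE; apply: ge_ereal_sup => _ [e e0 <-]; exact: EM.
Qed.

Lemma hausdorff_ge0 E : 0 <= H E.
Proof. by rewrite (le_trans _ (@hausdorff_pre_le 1%R E _))// hausdorff_pre_ge0. Qed.

Lemma hausdorff0 : H set0 = 0.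
Proof.
apply/eqP; rewrite eq_le hausdorff_ge0 andbT; apply: hausdorff_le => e e0.
by rewrite hausdorff_pre0// ltW.
Qed.

Lemma le_hausdorff : {homo H : E X / E `<=` X >-> E <= X}.
Proof.
move=> E X EX; apply: hausdorff_le => e e0.
exact: le_trans (le_hausdorff_pre _ EX) (hausdorff_pre_le _ e0).
Qed.

Lemma hausdorff_sigma_subadditive : sigma_subadditive H.
Proof.
move=> C; apply: hausdorff_le => e e0.
apply: le_trans (hausdorff_pre_sigma_subadditive _ _) _.
by apply: lee_nneseries => *; [exact: hausdorff_pre_ge0|exact: hausdorff_pre_le].
Qed.

HB.instance Definition _ := isOuterMeasure.Build R T H
  hausdorff0 hausdorff_ge0 le_hausdorff hausdorff_sigma_subadditive.

(** At a mesh below [r] no piece of a cover meets both [X] and [Y], so each cover splits into a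
    cover of [X] and a cover of [Y]. *)
Lemma hausdorff_metric (r : R) X Y : (0 < r)%R ->
    (forall x y, X x -> Y y -> (r <= d x y)%R) ->
  H X + H Y <= H (X `|` Y).
Proof.
move=> r0 rXY.
suff preXY e : (0 < e < r)%R -> pre e X + pre e Y <= H (X `|` Y).
  have [->|HXY] := eqVneq (H (X `|` Y)) +oo; first exact: leey.
  have fXY : H (X `|` Y) \is a fin_num.
    by rewrite ge0_fin_numE ?hausdorff_ge0// ltey.
  have pfin (Z : set T) e : Z `<=` X `|` Y -> (0 < e)%R -> pre e Z \is a fin_num.
    move=> ZXY e0; rewrite ge0_fin_numE ?hausdorff_pre_ge0//.
    rewrite (le_lt_trans (hausdorff_pre_le _ e0))//.
    by rewrite (le_lt_trans (le_hausdorff ZXY))// ltey.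
  have HYf : H Y \is a fin_num.
    rewrite ge0_fin_numE ?hausdorff_ge0//.
    by rewrite (le_lt_trans (le_hausdorff (@subsetUr _ X Y)))// ltey.
  rewrite -leeBrDr//.
  apply: hausdorff_le => e e0; rewrite leeBrDr// addeC -leeBrDr; last first.
    exact: pfin.
  apply: hausdorff_le => e' e'0; rewrite leeBrDr; last exact: pfin.
  (* One mesh that serves both suprema and is strictly below [r]. *)
  pose m : R := Num.min (Num.min e e') (r / 2)%R.
  have m0 : (0 < m)%R by rewrite !lt_min e0 e'0/= divr_gt0.
  apply: le_trans (preXY m _).
    rewrite addeC; apply: leeD; apply: hausdorff_pre_antitone;
      by rewrite /m !ge_min lexx ?orbT.
  by rewrite m0/= /m gt_min [X in _ || X]ltr_pdivrMr// ltr_pMr// ltr1n orbT.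
move=> /andP[e0 er]; apply: le_trans (hausdorff_pre_le _ e0).
apply: le_ereal_inf_tmp => _ [C [XYC Ce] <-].
(* Each piece goes to [X] if it meets [X] and to [Y] otherwise; the empty set takes its place in the
   other cover. *)
pose CX i := if `[< C i `&` X !=set0 >] then C i else set0.
pose CY i := if `[< C i `&` X !=set0 >] then set0 else C i.
have CXY i : ediam d (CX i) ^+ k.+1 + ediam d (CY i) ^+ k.+1 = ediam d (C i) ^+ k.+1.
  have z0 : (0 : \bar R) ^+ k.+1 = 0 by rewrite expeS mul0e.
  by rewrite /CX /CY; case: asboolP => _; rewrite ediam0 z0 ?adde0 ?add0e.
rewrite -(eq_eseriesr (fun i _ => CXY i)) nneseriesD; [|by move=> *; rewrite expe_ge0 ?ediam_ge0..].
apply: leeD; apply: ereal_inf_lbound.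
  exists CX => //; split.
    move=> x Xx; have [|i _ Cix] := XYC x; first by left.
    by exists i => //; rewrite /CX asboolT//; exists x.
  by move=> i; rewrite /CX; case: ifP => _ //; rewrite ediam0 lee_fin ltW.
exists CY => //; split.
  move=> y Yy; have [|i _ Ciy] := XYC y; first by right.
  exists i => //; rewrite /CY asboolF// => -[x [Cix Xx]].
  have := le_trans (dist_le_ediam Cix Ciy) (Ce i).
  by rewrite lee_fin leNgt (lt_le_trans er)// rXY.
by move=> i; rewrite /CY; case: ifP => _ //; rewrite ediam0 lee_fin ltW.
Qed.

Lemma hausdorff_similar (s : R) (f : T -> T) E : (0 < s)%R ->
    (forall x y, d (f x) (f y) = (s * d x y)%R) ->
  H (f @` E) <= (s ^+ k.+1)%:E * H E.
Proof.
move=> s0 fs; apply: hausdorff_le => e e0.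
have sk0 : (0 < s ^+ k.+1)%R by rewrite exprn_gt0.
have es0 : (0 < e / s)%R by rewrite divr_gt0.
apply: (@le_trans _ _ ((s ^+ k.+1)%:E * pre (e / s)%R E)); last first.
  by rewrite lee_pmul2l// ?lte_fin//; exact: hausdorff_pre_le.
rewrite -lee_pdivrMl//; apply: le_ereal_inf_tmp => _ [C [EC Ce] <-].
rewrite lee_pdivrMl// -nneseriesZl; last by move=> *; rewrite expe_ge0// ediam_ge0.
have fC (X : set T) : ediam d (f @` X) <= s%:E * ediam d X.
  apply: ge_ereal_sup => _ [->|[_ [x Xx <-] [_ [y Xy <-] <-]]].
    by rewrite mule_ge0 ?ediam_ge0// lee_fin ltW.
  by rewrite fs EFinM lee_pmul2l// ?lte_fin//; exact: dist_le_ediam.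
apply: (@le_trans _ _ (\sum_(0 <= i <oo) ediam d (f @` C i) ^+ k.+1)).
  apply: ereal_inf_lbound; exists (fun i => f @` C i) => //; split.
    by rewrite -image_bigcup; exact: image_subset.
  move=> i; apply: le_trans (fC _) _.
  by rewrite -lee_pdivlMl//= -EFinM mulrC Ce.
apply: lee_nneseries => [i _ _|i _]; first by rewrite expe_ge0// ediam_ge0.
apply: le_trans (lee_expe k.+1 (ediam_ge0 _) (fC _)) _.
move: (ediam_ge0 (C i)) (Ce i); case: (ediam d (C i)) => // r r0 _.
by rewrite -EFinM -!EFin_expe -EFinM exprMn.
Qed.

(** Caratheodory's criterion for metric outer measures. [W n], the part of [X] at distance at least
    1/(n+1) from [C], is positively separated from [C], so additivity holds for it. The rest of the
    complement of [C] is covered by the layers [D i] with i >= n. Layers of equal parity are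
    positively separated, hence the series of their measures converges and its tail tends to 0. *)
Lemma hausdorff_caratheodory_closed C :
    (forall x, d x x = 0%R) -> (forall x y, d x y = d y x) ->
    (forall x y z, (d x z <= d x y + d y z)%R) ->
    (forall x, ~ C x -> exists n, forall c, C c -> (n.+1%:R^-1 <= d x c)%R) ->
  H.-caratheodory C.
Proof.
move=> dxx dC dT clC; apply: le_caratheodory_measurable => X.
change (H (X `&` C) + H (X `&` ~` C) <= H X).
have [->|HX] := eqVneq (H X) +oo; first exact: leey.
pose W n := X `&` [set x | forall c, C c -> (n.+1%:R^-1 <= d x c)%R].
have invS n m : (n <= m)%N -> (m.+1%:R^-1 <= n.+1%:R^-1 :> R)%R.
  by move=> nm; rewrite lef_pV2 ?posrE// ler_nat.
have WS n m : (n <= m)%N -> W n `<=` W m.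
  by move=> nm x [Xx xC]; split => // c /xC; apply: le_trans; exact: invS.
have WX n : W n `<=` X by move=> x [].
pose D n := W n.+1 `\` W n.
(* A point of [X] outside [W n.+2] is within 1/(n+3) of [C], a point of [W n.+1] is at least 1/(n+2)
   away from it; the triangle inequality separates the two by the difference. *)
have sepW n Y : Y `<=` X -> Y `&` W n.+2 = set0 -> H (W n.+1) + H Y <= H (W n.+1 `|` Y).
  move=> YX YW; apply: (@hausdorff_metric (n.+2%:R^-1 - n.+3%:R^-1)).
    by rewrite subr_gt0 ltf_pV2 ?posrE// ltr_nat.
  move=> x y [Xx xC] Yy; have Wy : ~ W n.+2 y.
    by move=> Wy; rewrite -[False]/(set0 y) -YW.
  have {Wy}[c [Cc dyc]] : exists c, C c /\ (d y c < n.+3%:R^-1)%R.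
    apply: contrapT => nc; apply: Wy; split; first exact: YX.
    by move=> c Cc; rewrite leNgt; apply/negP => dyc; apply: nc; exists c.
  have h1 : (n.+2%:R^-1 <= d x c)%R := xC _ Cc.
  rewrite lerBlDr; apply: le_trans h1 _; apply: le_trans (dT x y c) _.
  by rewrite lerD2l ltW.
have sumD j m : \sum_(i < m.+1) H (D (i.*2 + j)%N) <= H (W (m.*2 + j).+1).
  elim: m => [|m IH].
    by rewrite big_ord_recr/= big_ord0 add0e; apply: le_hausdorff; exact: subDsetl.
  rewrite big_ord_recr/=; apply: le_trans (leeD IH (lexx _)) _.
  apply: le_trans (sepW _ _ _ _) _.
  - by apply: subset_trans (@subDsetl _ _ _) _; exact: WX.
  - rewrite doubleS !addSn; apply/seteqP; split => // x [[_ nW] Wx]; exact: nW.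
  - apply: le_hausdorff; rewrite doubleS !addSn subUset; split.
      by apply: WS; rewrite !ltnS; lia.
    exact: subDsetl.
(* The even and the odd layers each contribute at most [H X]. *)
have sum_fin : \sum_(0 <= i <oo) H (D i) < +oo.
  apply: (@le_lt_trans _ _ (H X + H X)); last first.
    by rewrite lte_add_pinfty// ltey.
  apply: lime_le; first by apply: is_cvg_nneseries => *; exact: hausdorff_ge0.
  apply: nearW => n; apply: (@le_trans _ _ (\sum_(0 <= i < n.+1.*2) H (D i))).
    rewrite [leRHS](big_cat_nat (n:=n))//=; last by lia.
    by rewrite leeDl// sume_ge0// => *; exact: hausdorff_ge0.
  have -> : \sum_(0 <= i < n.+1.*2) H (D i) =
     \sum_(i < n.+1) H (D (i.*2 + 0)%N) + \sum_(i < n.+1) H (D (i.*2 + 1)%N).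
    rewrite -big_split/=; elim: n.+1 => [|m IH]; first by rewrite big_geq// big_ord0.
    by rewrite doubleS !big_nat_recr//= IH big_ord_recr/= addn0 addn1 addeA.
  by apply: leeD; (apply: le_trans (sumD _ _) _; apply: le_hausdorff; exact: WX).
have tail : \sum_(n <= i <oo) H (D i) @[n --> \oo] --> 0.
  by apply: nneseries_tail_cvg => // *; exact: hausdorff_ge0.
suff bnd n : H (X `&` C) + H (X `&` ~` C) <= H X + \sum_(n <= i <oo) H (D i).
  have : H X + \sum_(n <= i <oo) H (D i) @[n --> \oo] --> H X + 0.
    apply: cvgeD => //; last exact: cvg_cst.
    by rewrite fin_num_adde_defl.
  rewrite adde0 => /cvg_lim <-//; apply: lime_ge; last exact: nearW.
  by apply/cvg_ex; exists (H X + 0); apply: cvgeD => //; [rewrite fin_num_adde_defl|exact: cvg_cst].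
have XCW : X `&` ~` C `<=` W n `|` \bigcup_(i in ~` `I_n) D i.
  move=> x [Xx /clC[m xm]].
  have exW : exists m, `[< W m x >] by exists m; apply/asboolP; split.
  case: (ex_minnP exW) => p /asboolP Wp pmin.
  have [pn|np] := leqP p n; first by left; exact: WS Wp.
  right; case: p Wp pmin np => // p Wp pmin np; exists p => //=.
    by apply/negP; rewrite -leqNgt.
  by split => // /asboolP/pmin; rewrite ltnn.
apply: (@le_trans _ _ (H (X `&` C) + (H (W n) + \sum_(n <= i <oo) H (D i)))).
  apply: leeD => //; apply: le_trans (le_hausdorff XCW) _.
  apply: le_trans (outer_measureU2 _ _ _) _; apply: leeD => //.
  exact: outer_measure_sigma_subadditive_tail.
rewrite addeA; apply: leeD => //; rewrite addeC.
apply: (@le_trans _ _ (H (W n `|` X `&` C))); last first.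
  by apply: le_hausdorff; rewrite subUset; split; [exact: WX|exact: subIsetl].
apply: (@hausdorff_metric n.+1%:R^-1); first by rewrite invr_gt0.
by move=> x y [Xx xC] [_ Cy]; exact: xC.
Qed.

End HausdorffOuterMeasure.

(** * Geometry of the Heisenberg group *)

Section HeisenbergGeometry.
Context {R : realType}.
Implicit Types (A B C : heis R) (p q : R * R) (r s t : R).

Lemma heis_eqP A B : A.1.1 = B.1.1 -> A.1.2 = B.1.2 -> A.2 = B.2 -> A = B.
Proof. by case: A B => [[? ?] ?] [[? ?] ?] /= -> -> ->. Qed.

Lemma hmulA A B C : hmul A (hmul B C) = hmul (hmul A B) C.
Proof. by apply: heis_eqP => /=; ring. Qed.

Lemma hmul0h A : hmul 0 A = A.
Proof. by apply: heis_eqP => /=; ring. Qed.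

Lemma hmulh0 A : hmul A 0 = A.
Proof. by apply: heis_eqP => /=; ring. Qed.

Lemma hmulVh A : hmul (hinv A) A = 0.
Proof. by apply: heis_eqP => /=; ring. Qed.

Lemma hmulhV A : hmul A (hinv A) = 0.
Proof. by apply: heis_eqP => /=; ring. Qed.

Lemma hmulKh A B : hmul (hinv A) (hmul A B) = B.
Proof. by rewrite hmulA hmulVh hmul0h. Qed.

Lemma hmulVKh A B : hmul A (hmul (hinv A) B) = B.
Proof. by rewrite hmulA hmulhV hmul0h. Qed.

Lemma hinvM A B : hinv (hmul A B) = hmul (hinv B) (hinv A).
Proof. by apply: heis_eqP => /=; ring. Qed.

Lemma hinvK A : hinv (hinv A) = A.
Proof. by apply: heis_eqP => /=; ring. Qed.

Lemma hdilM t A B : hdil t (hmul A B) = hmul (hdil t A) (hdil t B).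
Proof. by apply: heis_eqP => /=; ring. Qed.

Lemma hdilV t A : hdil t (hinv A) = hinv (hdil t A).
Proof. by apply: heis_eqP => /=; ring. Qed.

Lemma enorm2_ge0 p : 0 <= enorm2 p.
Proof. exact: sqrtr_ge0. Qed.

Lemma enorm2_sqr p : enorm2 p ^+ 2 = p.1 ^+ 2 + p.2 ^+ 2.
Proof. by rewrite sqr_sqrtr// addr_ge0// sqr_ge0. Qed.

Lemma enorm2_0 : enorm2 (0 : R * R) = 0.
Proof. by rewrite /enorm2/= expr0n/= addr0 sqrtr0. Qed.

Lemma enorm2_lt r p : 0 < r -> (enorm2 p < r) = (p.1 ^+ 2 + p.2 ^+ 2 < r ^+ 2).
Proof.
by move=> r0; rewrite -enorm2_sqr ltr_pXn2r// ?nnegrE ?enorm2_ge0// ltW.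
Qed.

Lemma enorm2_le r p : 0 <= r -> (enorm2 p <= r) = (p.1 ^+ 2 + p.2 ^+ 2 <= r ^+ 2).
Proof. by move=> r0; rewrite -enorm2_sqr ler_pXn2r// ?nnegrE ?enorm2_ge0. Qed.

Lemma normr_fst_le p : `|p.1| <= enorm2 p.
Proof.
rewrite -(@ler_pXn2r _ 2)// ?nnegrE ?enorm2_ge0// enorm2_sqr real_normK ?num_real//.
by rewrite lerDl sqr_ge0.
Qed.

Lemma normr_snd_le p : `|p.2| <= enorm2 p.
Proof.
rewrite -(@ler_pXn2r _ 2)// ?nnegrE ?enorm2_ge0// enorm2_sqr real_normK ?num_real//.
by rewrite lerDr sqr_ge0.
Qed.

Lemma enorm2_le_sum p : enorm2 p <= `|p.1| + `|p.2|.
Proof.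
rewrite enorm2_le ?addr_ge0//.
rewrite -(real_normK (num_real p.1)) -(real_normK (num_real p.2)).
have := normr_ge0 p.1; have := normr_ge0 p.2; nra.
Qed.

Lemma enorm2N p : enorm2 (- p) = enorm2 p.
Proof. by rewrite /enorm2/= !sqrrN. Qed.

Lemma enorm2_eq0 p : enorm2 p = 0 -> p = 0.
Proof.
move=> p0; have := normr_fst_le p; have := normr_snd_le p.
by rewrite p0 !normr_le0 => /eqP p2 /eqP p1; case: p p1 p2 {p0} => ? ? /= -> ->.
Qed.

Lemma enorm2Z t p : enorm2 (t *: p) = `|t| * enorm2 p.
Proof.
rewrite /enorm2/= -[`|t|]sqrtr_sqr -sqrtrM ?sqr_ge0//; congr Num.sqrt.
by rewrite /GRing.scale/=; ring.
Qed.

(** Lagrange's identity: the difference of the squares of the two sides is the square of the inner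
    product. *)
Lemma symplectic_le p q : `|q.1 * p.2 - p.1 * q.2| <= enorm2 p * enorm2 q.
Proof.
rewrite -(@ler_pXn2r _ 2)// ?nnegrE ?mulr_ge0 ?enorm2_ge0//.
rewrite real_normK ?num_real// exprMn !enorm2_sqr.
have := sqr_ge0 (q.1 * p.1 + p.2 * q.2); nra.
Qed.

Lemma enorm2D p q : enorm2 (p + q) <= enorm2 p + enorm2 q.
Proof.
rewrite enorm2_le ?addr_ge0 ?enorm2_ge0//=.
have := enorm2_sqr p; have := enorm2_sqr q.
have : p.1 * q.1 + p.2 * q.2 <= enorm2 p * enorm2 q.
  apply: le_trans (ler_norm _) _.
  rewrite -(@ler_pXn2r _ 2)// ?nnegrE ?mulr_ge0 ?enorm2_ge0//.
  rewrite real_normK ?num_real// exprMn !enorm2_sqr.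
  have := sqr_ge0 (q.1 * p.2 - p.1 * q.2); nra.
nra.
Qed.

Lemma hrho_ge0 A : 0 <= hrho A.
Proof. by rewrite le_max enorm2_ge0. Qed.

Lemma hrho_lt r A : 0 < r -> (hrho A < r) = (enorm2 A.1 < r) && (`|A.2| < r ^+ 2).
Proof.
move=> r0; rewrite /hrho gt_max; congr (_ && _).
rewrite -(@ltr_pXn2r _ 2)// ?nnegrE ?sqrtr_ge0//; last exact: ltW.
by rewrite sqr_sqrtr.
Qed.

Lemma hrho_le r A : 0 <= r -> (hrho A <= r) = (enorm2 A.1 <= r) && (`|A.2| <= r ^+ 2).
Proof.
move=> r0; rewrite /hrho ge_max; congr (_ && _).
by rewrite -(@ler_pXn2r _ 2)// ?nnegrE ?sqrtr_ge0// sqr_sqrtr.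
Qed.

Lemma enorm2_hrho A : enorm2 A.1 <= hrho A.
Proof. by rewrite le_max lexx. Qed.

Lemma normr_hrho A : `|A.2| <= hrho A ^+ 2.
Proof. by have := lexx (hrho A); rewrite {1}hrho_le ?hrho_ge0// => /andP[]. Qed.

Lemma hrhoV A : hrho (hinv A) = hrho A.
Proof. by rewrite /hrho /enorm2/= !sqrrN normrN. Qed.

Lemma hrho0 : hrho (0 : heis R) = 0.
Proof. by rewrite /hrho/= enorm2_0 normr0 sqrtr0 maxxx. Qed.

Lemma hrho_eq0 A : hrho A = 0 -> A = 0.
Proof.
move=> A0; have := lexx (hrho A); rewrite {1}hrho_le ?hrho_ge0// A0 expr0n/=.
rewrite normr_le0 => /andP[A1 /eqP A2].
have /enorm2_eq0 : enorm2 A.1 = 0 by apply/le_anti; rewrite A1 enorm2_ge0.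
by case: A A2 {A0 A1} => ? ? /= -> ->.
Qed.

(** The coefficient 2 of the group law fits the maximum gauge: with gauges u and v the height of the
    product is at most u^2 + v^2 + 2uv = (u + v)^2. *)
Lemma hrhoD A B : hrho (hmul A B) <= hrho A + hrho B.
Proof.
rewrite hrho_le ?addr_ge0 ?hrho_ge0//; apply/andP; split.
  by apply: le_trans (enorm2D _ _) _; rewrite lerD// enorm2_hrho.
have -> : (hmul A B).2 = A.2 + B.2 + 2 * (B.1.1 * A.1.2 - A.1.1 * B.1.2) by rewrite /=; ring.
apply: le_trans (ler_normD _ _) _; rewrite normrM ger0_norm//.
have h1 := symplectic_le A.1 B.1.
have h2 : enorm2 A.1 * enorm2 B.1 <= hrho A * hrho B.
  by rewrite ler_pM ?enorm2_ge0 ?enorm2_hrho.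
have := ler_normD A.2 B.2; have := normr_hrho A; have := normr_hrho B; nra.
Qed.

Lemma hrho_dil t A : 0 <= t -> hrho (hdil t A) = t * hrho A.
Proof.
move=> t0; rewrite /hrho [RHS]maxr_pMr//; congr Num.max.
  by rewrite -[(hdil t A).1]/(t *: A.1) enorm2Z ger0_norm.
rewrite /= normrM (ger0_norm (sqr_ge0 t)) sqrtrM ?sqr_ge0// sqrtr_sqr.
by rewrite (ger0_norm t0).
Qed.

Lemma hdistxx A : hdist A A = 0.
Proof. by rewrite /hdist hmulVh hrho0. Qed.

Lemma hdist_ge0 A B : 0 <= hdist A B.
Proof. exact: hrho_ge0. Qed.

Lemma hdistC A B : hdist A B = hdist B A.
Proof. by rewrite /hdist -hrhoV hinvM hinvK. Qed.

Lemma hdistD A B C : hdist A C <= hdist A B + hdist B C.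
Proof.
rewrite addrC /hdist; apply: le_trans (hrhoD _ _).
by rewrite -hmulA hmulVKh.
Qed.

Lemma hdist_eq0 A B : hdist A B = 0 -> A = B.
Proof. by move=> /hrho_eq0 BA; rewrite -[LHS](hmulVKh B) BA hmulh0. Qed.

Lemma hdist_mul A B C : hdist (hmul A B) (hmul A C) = hdist B C.
Proof. by rewrite /hdist hinvM -hmulA hmulKh. Qed.

Lemma hdist_mulr A B : hdist (hmul A B) A = hrho B.
Proof. by rewrite /hdist hmulKh. Qed.

Lemma hdist_dil t A B : 0 <= t -> hdist (hdil t A) (hdil t B) = t * hdist A B.
Proof. by move=> t0; rewrite /hdist -hdilV -hdilM hrho_dil. Qed.

Lemma hdist_diff_le A B C : `|hdist A C - hdist B C| <= hdist A B.
Proof.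
have := hdistD A B C; have := hdistD B A C; rewrite (hdistC B A) => h1 h2.
by rewrite ler_norml; apply/andP; split; lra.
Qed.

(** The metric topology is the product topology. The heights of [A^-1 B] and of [B - A] differ by a
    shear with coefficients depending on [A], which [M] bounds. *)
Lemma nbhs_hballP A (U : set (heis R)) :
  nbhs A U <-> exists2 r, 0 < r & hball A r `<=` U.
Proof.
pose M := 1 + 2 * `|A.1.1| + 2 * `|A.1.2|.
have M1 : 1 <= M by rewrite /M; have := normr_ge0 A.1.1; have := normr_ge0 A.1.2; lra.
have M0 : 0 < M by lra.
have zE B : (hmul (hinv A) B).2 = (B.2 - A.2) - 2 * ((B.1.1 - A.1.1) * A.1.2)
    + 2 * (A.1.1 * (B.1.2 - A.1.2)) by rewrite /=; ring.
split=> [/nbhs_ballP[e /= e0 eU]|[r r0 rU]].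
  exists (Num.min 1 (e / M)); first by rewrite lt_min ltr01/= divr_gt0.
  set r := Num.min _ _.
  have r0 : 0 < r by rewrite lt_min ltr01/= divr_gt0.
  have r1 : r <= 1 by rewrite ge_min lexx.
  have rM : r * M <= e by rewrite -ler_pdivlMr// ge_min lexx orbT.
  move=> B /=; rewrite /hball/= /hdist hrho_lt// zE => /andP[B1 B2]; apply: eU.
  have /= h1 := le_lt_trans (normr_fst_le _) B1.
  have /= h2 := le_lt_trans (normr_snd_le _) B1.
  have h1' : `|B.1.1 - A.1.1| < r by rewrite addrC.
  have h2' : `|B.1.2 - A.1.2| < r by rewrite addrC.
  have re : r <= e by rewrite (le_trans _ rM)// ler_peMr// ltW.
  have k1 : `|(B.1.1 - A.1.1) * A.1.2| <= r * `|A.1.2| by rewrite normrM ler_wpM2r// ltW.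
  have k2 : `|A.1.1 * (B.1.2 - A.1.2)| <= r * `|A.1.1| by rewrite normrM mulrC ler_wpM2r// ltW.
  have h3 : `|B.2 - A.2| < e.
    apply: lt_le_trans rM.
    have r2 : r ^+ 2 <= r by rewrite expr2 ler_piMr// ltW.
    move: B2 k1 k2; rewrite /M !ltr_norml !ler_norml => /andP[? ?] /andP[? ?] /andP[? ?].
    by apply/andP; split; lra.
  by split; [split|]; rewrite /ball/= distrC// (lt_le_trans _ re).
apply/nbhs_ballP; pose e := Num.min (r / 2) (r ^+ 2 / M).
have r20 : 0 < r ^+ 2 by rewrite exprn_gt0.
have e0 : 0 < e by rewrite lt_min !divr_gt0.
exists e => //= B [[B1 B2] B3]; apply: rU; rewrite /hball/= /hdist hrho_lt// zE.
move: B1 B2 B3; rewrite /ball/= => B1 B2 B3.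
have er : e <= r / 2 by rewrite ge_min lexx.
have eM : e * M <= r ^+ 2 by rewrite -ler_pdivlMr// ge_min lexx orbT.
apply/andP; split.
  apply: le_lt_trans (enorm2_le_sum _) _ => /=.
  by rewrite ![- _ + _]addrC distrC (distrC B.1.2); lra.
have k1 : `|(B.1.1 - A.1.1) * A.1.2| <= e * `|A.1.2|.
  by rewrite normrM ler_wpM2r// distrC ltW.
have k2 : `|A.1.1 * (B.1.2 - A.1.2)| <= e * `|A.1.1|.
  by rewrite normrM mulrC ler_wpM2r// distrC ltW.
apply: lt_le_trans eM; rewrite distrC in B3.
move: B3 k1 k2; rewrite /M !ltr_norml !ler_norml => /andP[? ?] /andP[? ?] /andP[? ?].
by apply/andP; split; lra.
Qed.

Lemma nbhs_hball A r : 0 < r -> nbhs A (hball A r).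
Proof. by move=> r0; apply/nbhs_hballP; exists r. Qed.

Lemma hdist_continuous A : continuous (hdist ^~ A).
Proof.
move=> B; apply/cvgrPdist_lt => e e0; near=> C.
apply: le_lt_trans (hdist_diff_le _ _ _) _; rewrite hdistC.
by near: C; exact: nbhs_hball.
Unshelve. all: by end_near. Qed.

Lemma hmul_continuous A : continuous (hmul A).
Proof.
move=> B U /= /nbhs_hballP[r r0 rU]; apply/nbhs_hballP; exists r => // C /=.
by rewrite /hball/= => CB; apply: rU; rewrite /hball/= hdist_mul.
Qed.

Lemma closed_hdist_le A r : closed [set B | hdist B A <= r].
Proof.
rewrite (_ : [set _ | _] = (hdist ^~ A) @^-1` [set x | x <= r])//.
by apply: closed_comp (@closed_le _ _) => x _; exact: hdist_continuous.
Qed.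

Definition hbox r : set (heis R) := (`[- r, r] `*` `[- r, r]) `*` `[- r, r].

Lemma hbox_compact r : compact (hbox r).
Proof.
by apply: compact_setX; [apply: compact_setX|]; exact: segment_compact.
Qed.

Lemma compact_hdist_le A r : compact [set B | hdist B A <= r].
Proof.
have [r0|r0] := ltP r 0.
  rewrite (_ : [set _ | _] = set0); first exact: compact0.
  by apply/seteqP; split => // B /= BA; have := le_lt_trans (le_trans (hdist_ge0 _ _) BA) r0; rewrite ltxx.
pose s := (r + hrho A) + (r + hrho A) ^+ 2.
apply: (subclosed_compact (@closed_hdist_le A r) (@hbox_compact s)) => B /= BA.
have : hrho B <= r + hrho A.
  by have := hrhoD A (hmul (hinv A) B); rewrite hmulVKh addrC => /le_trans; apply; rewrite lerD2r.
have t0 : 0 <= r + hrho A by rewrite addr_ge0// hrho_ge0.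
rewrite hrho_le// => /andP[B1 B2].
have B11 := le_trans (normr_fst_le _) B1; have B12 := le_trans (normr_snd_le _) B1.
have s2 := sqr_ge0 (r + hrho A).
by rewrite /hbox/= !in_itv/= -!ler_norml /s; split; [split|]; lra.
Qed.

End HeisenbergGeometry.

(** * Measures on the group and linear changes of variables in the plane *)

Section HausdorffBorel.
Context {R : realType} (k : nat).
Local Open Scope ereal_scope.
Local Notation H := (hausdorff (@hdist R) k.+1).

Lemma hausdorff_caratheodory (E : set (heis R)) :
  measurable E -> H.-caratheodory E.
Proof.
move=> mE.
have : <<s @open (heis R) >> E by rewrite -heis_measurableE.
apply: smallest_sub; first split=> [|A|F].
- exact: caratheodory_measurable_set0.
- by rewrite setTD; exact: caratheodory_measurable_setC.
- exact: caratheodory_measurable_bigcup.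
move=> U oU; rewrite -(setCK U); apply: caratheodory_measurable_setC.
apply: hausdorff_caratheodory_closed.
- exact: hdistxx.
- exact: hdistC.
- exact: hdistD.
- move=> x /contrapT Ux.
  have /nbhs_hballP[r r0 rU] := open_nbhs_nbhs (conj oU Ux).
  have [n] := ltr_add_invr r0; rewrite add0r => /ltW ne2.
  exists n => c Uc; apply: le_trans ne2 _; rewrite leNgt; apply/negP => cx.
  by apply: Uc; apply: rU; rewrite /hball/= hdistC.
Qed.

Lemma hausdorff_semi_sigma_additive : semi_sigma_additive H.
Proof.
move=> F mF tF mUF.
have := @caratheodory_measure_sigma_additive R (heis R) H F _ tF _.
apply.
- by move=> n; exact: hausdorff_caratheodory.
- exact: hausdorff_caratheodory.
Qed.

HB.instance Definition _ := isMeasure.Build _ (heis R) R H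
  (hausdorff0 hdist k) (hausdorff_ge0 hdist k) hausdorff_semi_sigma_additive.

End HausdorffBorel.

Section MeasurePacking.
Context {R : realType} d (T : measurableType d).
Local Open Scope ereal_scope.

(** Turns a set function into a measure inside a proof, where its additivity may rest on local
    hypotheses such as those on [F]. *)
Lemma measure_exists (mu : set T -> \bar R) :
    mu set0 = 0 -> (forall A, 0 <= mu A) -> semi_sigma_additive mu ->
  exists m : {measure set T -> \bar R}, forall A, m A = mu A.
Proof.
move=> mu0 mu_ge0 mu_add.
pose m : {measure set T -> \bar R} :=
  HB.pack mu (isMeasure.Build _ _ _ mu mu0 mu_ge0 mu_add).
by exists m.
Qed.

Lemma pushforward_exists d' (T' : measurableType d')
    (m : {measure set T' -> \bar R}) (f : T' -> T) : measurable_fun setT f ->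
  exists mu : {measure set T -> \bar R}, forall A, mu A = m (f @^-1` A).
Proof.
move=> mf; apply: measure_exists => [|A|F mF tF mUF]; rewrite ?preimage_set0//.
rewrite preimage_bigcup; apply: measure_semi_sigma_additive.
- by move=> n; rewrite -[X in measurable X]setTI; exact: mf.
- apply/trivIsetP => /= i j _ _ ij; rewrite -preimage_setI.
  by move/trivIsetP : tF => /(_ _ _ _ _ ij) ->//; rewrite preimage_set0.
- by rewrite -preimage_bigcup -[X in measurable X]setTI; exact: mf.
Qed.

End MeasurePacking.

(** * Linear changes of variables in the plane *)

Section PlaneLebesgue.
Context {R : realType}.
Local Open Scope ereal_scope.

Notation leb := (@lebesgue_measure R).
Notation leb2 := (lebesgue_measure \x lebesgue_measure : set (R * R) -> \bar R).

Lemma measurable_affine (a b : R) : measurable_fun setT (fun x : R => (a * x + b)%R).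
Proof. by apply: measurable_funD => //; exact: measurable_funM. Qed.

(** Uniqueness of Lebesgue measure: the right-hand side is a measure with the right value on
    half-open intervals. A negative [a] moves the closed end to the other side, without effect on
    the length. *)
Lemma lebesgue_affine (a b : R) (S : set R) : a != 0%R -> measurable S ->
  leb S = `|a|%:E * leb ((fun x => (a * x + b)%R) @^-1` S).
Proof.
move=> a0 mS.
have na0 : (0 <= `|a|)%R by [].
have mf : measurable_fun setT (fun x : measurableTypeR R => (a * x + b)%R : measurableTypeR R).
  exact: measurable_affine.
have [mu muE] : exists mu : {measure set (measurableTypeR R) -> \bar R},
    forall A, mu A = `|a|%:E * leb ((fun x => (a * x + b)%R) @^-1` A).
  have [mu muE] := pushforward_exists leb mf.
  by exists (mscale (NngNum na0) mu) => A; rewrite -muE.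
rewrite -muE; apply: lebesgue_measure_unique => //.
move=> _ [[u v] _ <-]; rewrite muE.
have [a_gt0|a_lt0|a00] := ltrgt0P a; last by rewrite a00 eqxx in a0.
- rewrite (_ : _ @^-1` _ = `](u - b) / a, (v - b) / a]%classic)%R; last first.
    apply/seteqP; split => x /=; rewrite !in_itv/= ltr_pdivrMr// ler_pdivlMr// (mulrC x);
      by rewrite ltrBlDr lerBrDr.
  rewrite !lebesgue_measure_itv/= !lte_fin ltr_pM2r ?invr_gt0// ltrD2r.
  case: ifPn => _; last by rewrite mule0.
  by rewrite -!EFinD -EFinM; congr EFin; field.
- rewrite (_ : _ @^-1` _ = `[(v - b) / a, (u - b) / a[%classic)%R; last first.
    apply/seteqP; split => x /=; rewrite !in_itv/= ltr_ndivlMr// ler_ndivrMr// (mulrC x);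
      by rewrite ltrBlDr lerBrDr andbC.
  rewrite !lebesgue_measure_itv/= !lte_fin ltr_nM2r ?invr_lt0// ltrD2r.
  case: ifPn => _; last by rewrite mule0.
  by rewrite -!EFinD -EFinM; congr EFin; field.
Qed.

Lemma measurable_shear (a t : R) :
  measurable_fun setT (fun p : R * R => (p.1, a * p.2 + t * p.1)%R).
Proof.
apply: measurable_fun_pair => //; apply: measurable_funD; apply: measurable_funM => //.
Qed.

(** On each vertical section the shear is an affine map of the line, so the formula integrates the
    one-dimensional one. *)
Lemma lebesgue2_shear (a t : R) (S : set (R * R)) : a != 0%R -> measurable S ->
  leb2 S = `|a|%:E * leb2 ((fun p => (p.1, a * p.2 + t * p.1)%R) @^-1` S).
Proof.
move=> a0 mS; rewrite /product_measure1 -ge0_integralZl//; last first.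
  apply: measurable_fun_xsection.
  by rewrite -[X in measurable X]setTI; exact: measurable_shear.
apply: eq_integral => x _ /=.
rewrite (@lebesgue_affine a (t * x)%R)//; last exact: measurable_xsection.
Qed.

Definition swap2 (p : R * R) : R * R := (p.2, p.1).

Lemma measurable_swap2 : measurable_fun setT swap2.
Proof. exact: measurable_fun_pair. Qed.

Lemma lebesgue2_swap (S : set (R * R)) : measurable S ->
  leb2 (swap2 @^-1` S) = leb2 S.
Proof.
move=> mS.
have msw : measurable_fun [set: measurableTypeR R * measurableTypeR R]
  (swap2 : measurableTypeR R * measurableTypeR R -> measurableTypeR R * measurableTypeR R).
  exact: measurable_swap2.
have [mu muE] : exists mu : {measure set (measurableTypeR R * measurableTypeR R) -> \bar R},
    forall A, mu A = leb2 (swap2 @^-1` A).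
  exact: (@pushforward_exists _ _ _ _ _ (leb \x leb) _ msw).
rewrite -muE; apply/esym; apply: (@product_measure_unique _ _ _ _ R leb leb mu) => // A B mA mB.
rewrite muE (_ : swap2 @^-1` _ = B `*` A).
  by rewrite product_measure1E// muleC.
by apply/seteqP; split => -[x y] /= [].
Qed.

(** The map is a composition of shears and coordinate swaps; the cases [b = 0] and [b != 0] need
    different factorizations. *)
Lemma lebesgue2_linear (a b c e : R) (S : set (R * R)) :
    (a * e - b * c)%R != 0%R -> measurable S ->
  leb2 S = `|a * e - b * c|%:E *
    leb2 ((fun p => (a * p.1 + b * p.2, c * p.1 + e * p.2)%R) @^-1` S).
Proof.
move=> D0 mS.
have msw (X : set (R * R)) : measurable X -> measurable (swap2 @^-1` X).
  by move=> mX; rewrite -[X in measurable X]setTI; exact: measurable_swap2.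
have msh u v (X : set (R * R)) : measurable X ->
    measurable ((fun p => (p.1, u * p.2 + v * p.1)%R) @^-1` X).
  by move=> mX; rewrite -[X in measurable X]setTI; exact: measurable_shear.
have [b0|b0] := eqVneq b 0%R.
  rewrite b0 mul0r subr0 in D0 *.
  have /andP[a0 e0] : (a != 0%R) && (e != 0%R) by rewrite -negb_or -mulf_eq0.
  rewrite -lebesgue2_swap// (@lebesgue2_shear a 0%R)//; last exact: msw.
  rewrite -lebesgue2_swap; last by apply: (msh); exact: msw.
  rewrite (@lebesgue2_shear e c)//; last by apply: (msw); apply: (msh); exact: msw.
  rewrite muleA -EFinM -normrM; congr (_ * leb2 _).
  by apply/funext => p /=; congr (S (_, _)) => /=; ring.
(* Once the first output a p1 + b p2 is known, the second one is e/b times it plus u p1. *)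
pose u := ((c * b - e * a) / b)%R.
have u0 : u != 0%R by rewrite mulf_neq0 ?invr_eq0// -opprB oppr_eq0 mulrC (mulrC c).
rewrite (@lebesgue2_shear u (e / b)%R)//.
rewrite -lebesgue2_swap; last exact: msh.
rewrite (@lebesgue2_shear b a)//; last by apply: (msw); exact: msh.
rewrite muleA -EFinM -normrM; congr (_%:E * leb2 _).
  by rewrite -normrN; congr (`|_|)%R; rewrite /u; field.
by apply/funext => p /=; congr (S (_, _)) => /=; rewrite /u; field.
Qed.

End PlaneLebesgue.

(** * Lebesgue measure on the group *)

Section HeisenbergLebesgue.
Context {R : realType}.
Local Open Scope ereal_scope.
Notation leb := (@lebesgue_measure R).
Implicit Types A B : heis R.

Lemma heis_continuous_measurable (f : heis R -> heis R) :
  continuous f -> measurable_fun setT f.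
Proof.
move=> /continuousP cf; apply: (measurability (@open (heis R))).
  exact: heis_measurableE.
by move=> _ [U oU <-]; rewrite setTI; apply: heis_open_measurable; exact: cf.
Qed.

(* [lebesgue_measure] lives on an alias of [R]; this is the same set function,
   on the measurable structure of [heis R]. *)
Definition leb3 : set (heis R) -> \bar R :=
  ((lebesgue_measure \x lebesgue_measure) \x lebesgue_measure).

Lemma leb3_semi_sigma_additive : semi_sigma_additive leb3.
Proof. exact: (@measure_semi_sigma_additive _ _ _ ((leb \x leb) \x leb)). Qed.

HB.instance Definition _ := isMeasure.Build _ (heis R) R leb3
  (measure0 ((leb \x leb) \x leb)) (measure_ge0 ((leb \x leb) \x leb))
  leb3_semi_sigma_additive.

Definition hcell A (I J K : set R) : set (heis R) :=
  hmul (hinv A) @^-1` ((I `*` J) `*` K).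

Lemma measurable_hcell A (I J K : set R) :
  measurable I -> measurable J -> measurable K -> measurable (hcell A I J K).
Proof.
move=> mI mJ mK; rewrite -[X in measurable X]setTI.
apply: (heis_continuous_measurable (@hmul_continuous _ _)) => //.
by apply: measurableX => //; exact: measurableX.
Qed.

Lemma lebesgue_translate (a : R) (S : set R) : measurable S ->
  leb ((fun x => (x + a)%R) @^-1` S) = leb S.
Proof.
move=> mS; rewrite [RHS](@lebesgue_affine _ 1%R a)// ?oner_neq0//.
rewrite normr1 mul1e; congr (leb _); apply/funext => x /=; by rewrite mul1r.
Qed.

(** Left translation is a shear over the plane: the section over a point of the translated base is a
    translate of [K], by an amount depending on the point, and the other sections are empty. *)
Lemma leb3_hcell A (I J K : set R) :
  measurable I -> measurable J -> measurable K ->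
  leb3 (hcell A I J K) = leb I * leb J * leb K.
Proof.
move=> mI mJ mK.
pose I' := (fun x => (x - A.1.1)%R) @^-1` I.
pose J' := (fun x => (x - A.1.2)%R) @^-1` J.
have mt (a : R) (S : set R) : measurable S -> measurable ((fun x => (x + a)%R) @^-1` S).
  move=> mS; rewrite -[X in measurable X]setTI.
  by apply: measurable_funD.
have mI' : measurable I' by exact: mt.
have mJ' : measurable J' by exact: mt.
rewrite /leb3 [LHS]/product_measure1.
rewrite (eq_integral (fun p : measurableTypeR R * measurableTypeR R =>
  (\1_(I' `*` J') p)%:E * leb K)); last first.
  move=> p _; rewrite indicE /=.
  have [/set_mem/= [Ip Jp]|nIJ] := boolP (p \in _).
    rewrite mul1e -(@lebesgue_translate (- A.2 - 2 * p.1 * A.1.2 + 2 * A.1.1 * p.2)%R K)//.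
    congr (leb _); apply/funext => z; rewrite /xsection/hcell/= inE/=; apply/propext.
    rewrite (_ : z + _ = - A.2 + z + 2 * p.1 * - A.1.2 - 2 * - A.1.1 * p.2)%R; last by ring.
    by split=> [[]//|Kz]; rewrite ![(- _ + p.1)%R]addrC ![(- _ + p.2)%R]addrC.
  rewrite mul0e (_ : xsection _ _ = set0) ?measure0//.
  apply/seteqP; split => // z; rewrite /xsection/hcell/= inE/= => -[[Ip Jp] _].
  by move/negP: nIJ; apply; rewrite inE/= /I'/J'/= ![(p.1 - _)%R]addrC ![(p.2 - _)%R]addrC.
have mIJ : measurable (I' `*` J') by exact: measurableX.
have mf : measurable_fun setT (fun p : R * R => (\1_(I' `*` J') p)%:E : \bar R).
  by apply/measurable_EFinP; exact: measurable_indic.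
rewrite ge0_integralZr//.
rewrite integral_indic//.
rewrite setIT; transitivity (leb I' * leb J' * leb K).
  by congr (_ * _); exact: product_measure1E.
by rewrite !lebesgue_translate.
Qed.

Definition htile A (s : R) : set (heis R) := 
  hcell A [set` `[0%R, s[%R] [set` `[0%R, s[%R] [set` `[0%R, (s ^+ 2)%R[%R].

Lemma measurable_htile A s : measurable (htile A s).
Proof. exact: measurable_hcell. Qed.

Lemma leb3_htile A (s : R) : (0 < s)%R -> leb3 (htile A s) = (s ^+ 4)%:E.
Proof.
move=> s0; rewrite leb3_hcell// !lebesgue_measure_itv/= !lte_fin s0 exprn_gt0//.
by rewrite -!EFinD -!EFinM; congr EFin; ring.
Qed.

End HeisenbergLebesgue.

(** * Tiles *)

Section Tiles.
Context {R : realType}.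
Implicit Types (A B : heis R) (s r : R).

Lemma htile_near A B s : 0 < s -> htile A s B -> hdist B A <= 2 * s.
Proof.
move=> s0; rewrite /htile/hcell/= !in_itv/= => -[[/andP[x0 x1] /andP[y0 y1]] /andP[z0 z1]].
rewrite /hdist hrho_le; last by rewrite mulr_ge0// ltW.
apply/andP; split; last by rewrite /= ger0_norm//; nra.
by apply: le_trans (enorm2_le_sum _) _; rewrite /= !ger0_norm//; lra.
Qed.

Lemma htile_diam A B C s : 0 < s -> htile A s B -> htile A s C -> hdist B C <= 4 * s.
Proof.
move=> s0 /(htile_near s0) AB /(htile_near s0) AC.
by apply: le_trans (hdistD _ A _) _; rewrite (hdistC A); lra.
Qed.

(* The structure constants are integral, so the dilated integer points form a lattice
   and the tiles at these points partition the group. *)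
Definition hlat s (i : int * int * int) : heis R :=
  hdil s (i.1.1%:~R, i.1.2%:~R, i.2%:~R).

Lemma htile_hlatE s i B : 0 < s -> htile (hlat s i) s B <->
  [/\ Num.floor (B.1.1 / s) = i.1.1, Num.floor (B.1.2 / s) = i.1.2 &
   Num.floor ((B.2 - 2 * B.1.1 * (s * i.1.2%:~R) + 2 * (s * i.1.1%:~R) * B.1.2) / s ^+ 2) = i.2].
Proof.
move=> s0; rewrite /htile/hcell/=/hlat !in_itv/=.
have fE (t x : R) (k : int) : 0 < t ->
    (0 <= - (t * k%:~R) + x < t) <-> Num.floor (x / t) = k.
  move=> t0; split=> [/andP[h1 h2]|<-].
    apply: floor_def; rewrite ler_pdivlMr// ltr_pdivrMr// intrD mulrDl mul1r !(mulrC _ t).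
    by apply/andP; split; lra.
  have := ge_floor (x / t); have := floorD1_gt (x / t).
  rewrite ltr_pdivrMr// ler_pdivlMr// intrD mulrDl mul1r !(mulrC _ t) => h1 h2.
  by apply/andP; split; lra.
have s20 : 0 < s ^+ 2 by rewrite exprn_gt0.
rewrite !fE//.
set z := (X in Num.floor (X / s ^+ 2)).
rewrite (_ : - (s ^+ 2 * _) + _ + _ - _ = - (s ^+ 2 * i.2%:~R) + z); last by rewrite /z; ring.
rewrite fE//; split=> [[[]]|[]]//.
Qed.

(** The lattice is enumerated by [pickle]; a number that codes no lattice point gets the empty
    tile. *)
Definition ltile s (m : nat) : set (heis R) :=
  if pickle_inv m is Some i then htile (hlat s i) s else set0.

Lemma measurable_ltile s m : measurable (ltile s m).
Proof. by rewrite /ltile; case: pickle_inv => // i; exact: measurable_htile. Qed.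

Lemma ltile_cover s B : 0 < s -> exists m, ltile s m B.
Proof.
move=> s0; set i := Num.floor (B.1.1 / s); set j := Num.floor (B.1.2 / s).
set k := Num.floor ((B.2 - 2 * B.1.1 * (s * j%:~R) + 2 * (s * i%:~R) * B.1.2) / s ^+ 2).
by exists (pickle (i, j, k)); rewrite /ltile pickleK_inv; apply/htile_hlatE.
Qed.

Lemma trivIset_ltile s : 0 < s -> trivIset setT (ltile s).
Proof.
move=> s0 m n _ _ [B []]; rewrite /ltile.
case um : (pickle_inv m) => [i|//]; case un : (pickle_inv n) => [j|//].
move=> /(htile_hlatE _ _ s0)[i1 i2 i3] /(htile_hlatE _ _ s0)[j1 j2 j3].
have ij : i = j.
  case: i j {um un} i1 i2 i3 j1 j2 j3 => [[a b] c] [[a' b'] c'] /= -> -> <- -> -> <-.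
  by [].
have := @pickle_invK (int * int * int)%type m; have := @pickle_invK (int * int * int)%type n.
by rewrite um un/= ij => -> ->.
Qed.

(** * Comparison of two measures on small tiles *)

Section TileComparison.
Local Open Scope ereal_scope.
Variables lam mu : {measure set (heis R) -> \bar R}.

Definition tile_le := forall (M e : R), (0 < e)%R -> exists2 dlt : R, (0 < dlt)%R &
  forall s A, (0 < s < dlt)%R -> (hdist A 0%R <= M)%R ->
    lam (htile A s) <= mu (htile A s) + (e * s ^+ 4)%:E.

(** The hypothesis is summed over the tiles of one mesh that lie in [V]. A tile has volume s^4 and
    the tiles are disjoint, so the errors add up to at most e times the volume of [V], with e
    arbitrary. *)
Lemma tile_le_open (V : set (heis R)) (M : R) : tile_le -> open V ->
  V `<=` hball 0%R M -> leb3 V < +oo -> lam V <= mu V.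
Proof.
move=> lm oV VM V_fin.
have mV : measurable V by exact: heis_open_measurable.
pose s (n : nat) : R := n.+1%:R^-1%R.
have s0 n : (0 < s n)%R by rewrite /s invr_gt0.
have s1 n : (s n <= 1)%R by rewrite /s invf_le1// ler1n.
pose U n m := if `[< ltile (s n) m `<=` V >] then ltile (s n) m else set0.
have mU n m : measurable (U n m) by rewrite /U; case: ifP => // _; exact: measurable_ltile.
have tU n : trivIset setT (U n).
  move=> i j _ _ [B []]; rewrite /U; do 2 case: ifP => // _.
  by move=> Bi Bj; apply: (trivIset_ltile (s0 n)) => //; exists B.
pose Vn n := \bigcup_m U n m.
have mVn n : measurable (Vn n) by exact: bigcupT_measurable.
have VnV n : Vn n `<=` V by move=> B [m _]; rewrite /U; case: asboolP => // mV' mB; exact: mV'.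
(* The unions [Vn] for different meshes are not nested. The intersections of all later ones are
   increasing, and they exhaust [V] because [V] is open. *)
pose W m := \bigcap_(n in [set n | (m <= n)%N]) Vn n.
have mW m : measurable (W m) by apply: bigcap_measurable => //; exists m => /=.
have sN (e : R) : (0 < e)%R -> exists N, forall n, (N <= n)%N -> (s n < e)%R.
  move=> e0; have [N] := ltr_add_invr e0; rewrite add0r => Ne.
  exists N => n Nn; apply: le_lt_trans Ne.
  by rewrite /s lef_pV2 ?posrE// ler_nat.
have VW : V = \bigcup_m W m.
  apply/seteqP; split => [B VB|B [m _ WB]]; last first.
    by apply: (VnV m); apply: WB => /=.
  have /nbhs_hballP[r r0 rV] := open_nbhs_nbhs (conj oV VB).
  have [|N NP] := sN (r / 4)%R; first by rewrite divr_gt0.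
  exists N => // n /= Nn; have [m Bm] := ltile_cover B (s0 n).
  exists m => //; rewrite /U asboolT// => C Cm; apply: rV.
  rewrite /hball/=; apply: (@le_lt_trans _ _ (4 * s n)%R); last first.
    by rewrite mulrC -ltr_pdivlMr// NP.
  move: Bm Cm; rewrite /ltile; case: pickle_inv => // i Bi Ci.
  exact: htile_diam Bi.
suff bnd e : (0 < e)%R -> lam V <= mu V + e%:E * leb3 V.
  have V0 : 0 <= leb3 V by exact: measure_ge0.
  have Vf : leb3 V \is a fin_num by rewrite ge0_fin_numE.
  apply/lee_addgt0Pr => e e0.
  have v0 : (0 < fine (leb3 V) + 1)%R by rewrite ltr_wpDl// fine_ge0.
  have e'0 : (0 < e / (fine (leb3 V) + 1))%R by rewrite divr_gt0.
  apply: le_trans (bnd _ e'0) _; rewrite leeD2l// -(fineK Vf) -EFinM lee_fin.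
  by rewrite mulrAC ler_pdivrMr// ler_wpM2l ?lerDl// ltW.
move=> e0; have [dlt dlt0 dP] := lm (M + 2)%R e e0.
have [N NP] := sN _ dlt0.
have WN n : (N <= n)%N -> lam (W n) <= mu V + e%:E * leb3 V.
  move=> Nn; apply: (@le_trans _ _ (lam (Vn n))).
    by apply: le_measure; rewrite ?inE//; apply: bigcap_inf => /=.
  apply: (@le_trans _ _ (mu (Vn n) + e%:E * leb3 (Vn n))); last first.
    apply: leeD; first by apply: le_measure; rewrite ?inE.
    rewrite lee_pmul2l ?lte_fin//; apply: le_measure; rewrite ?inE//.
  rewrite /Vn !measure_bigcup// -nneseriesZl// -nneseriesD//; last first.
    by move=> *; rewrite mule_ge0// lee_fin ltW.
  apply: lee_nneseries => // m _.
  rewrite /U; case: asboolP => [mV'|_]; last by rewrite !measure0 mule0 adde0.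
  rewrite /ltile; move: mV'; rewrite /ltile; case: pickle_inv => [i iV|_]; last first.
    by rewrite !measure0 mule0 adde0.
  rewrite [X in e%:E * X](_ : _ = (s n ^+ 4)%:E); last exact: leb3_htile.
  rewrite -EFinM; apply: dP; first by rewrite s0 NP.
  have cB : htile (hlat (s n) i) (s n) (hlat (s n) i).
    rewrite /htile/hcell/= !in_itv/=.
    have [-> -> ->] : [/\ - (hlat (s n) i).1.1 + (hlat (s n) i).1.1 = 0,
      - (hlat (s n) i).1.2 + (hlat (s n) i).1.2 = 0 &
      - (hlat (s n) i).2 + (hlat (s n) i).2 = 0]%R by rewrite !addNr.
    split; first by split; rewrite lexx s0.
    by rewrite (_ : _ - _ = 0)%R; [rewrite lexx exprn_gt0|ring].
  have := VM _ (iV _ cB); rewrite /hball/= => /ltW/le_trans; apply.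
  by rewrite lerDl.
have cW : lam (W n) @[n --> \oo] --> lam V.
  rewrite VW; apply: nondecreasing_cvg_mu => //; first by rewrite -VW.
  by move=> m n mn; apply/subsetPset => B WB k /= nk; apply: WB => /=; exact: leq_trans nk.
rewrite -(cvg_lim _ cW)//; apply: lime_le; first by apply/cvg_ex; exists (lam V).
by exists N.
Qed.

End TileComparison.

Local Open Scope ereal_scope.

Lemma open_hball A r : open (hball A r).
Proof.
rewrite (_ : hball A r = (hdist ^~ A) @^-1` [set x | (x < r)%R])//.
by apply: open_comp (@open_lt _ _) => x _; exact: hdist_continuous.
Qed.

(** A box of explicit volume around the closed ball of radius [r]; it bounds the volume of a set by
    its diameter. *)
Definition hcbox A r : set (heis R) := hcell A
  [set` `[(- r)%R, r]%R] [set` `[(- r)%R, r]%R] [set` `[(- r ^+ 2)%R, (r ^+ 2)%R]%R].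

Lemma measurable_hcbox A r : measurable (hcbox A r).
Proof. exact: measurable_hcell. Qed.

Lemma hcbox_hdist A B r : (hdist B A <= r)%R -> hcbox A r B.
Proof.
move=> BA; have r0 : (0 <= r)%R := le_trans (hdist_ge0 _ _) BA.
move: BA; rewrite /hdist hrho_le// => /andP[B1 B2].
have := le_trans (normr_fst_le _) B1; have := le_trans (normr_snd_le _) B1.
by rewrite /hcbox/hcell/= !in_itv/= -!ler_norml.
Qed.

Lemma leb3_hcbox A r : (0 <= r)%R -> leb3 (hcbox A r) = (8 * r ^+ 4)%:E.
Proof.
move=> r0; rewrite leb3_hcell// !lebesgue_measure_itv/= !lte_fin.
have [->|r1] := eqVneq r 0%R.
  by rewrite !oppr0 !expr0n/= oppr0 ltxx !mule0 mulr0.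
have {r1}r0 : (0 < r)%R by rewrite lt_neqAle eq_sym r1.
have r20 : (0 < r ^+ 2)%R by rewrite exprn_gt0.
rewrite ifT; last by lra.
rewrite ifT; last by lra.
by rewrite -!EFinD -!EFinM; congr EFin; ring.
Qed.

Lemma leb3_bounded_fin (V : set (heis R)) r : measurable V -> V `<=` hball 0%R r ->
  leb3 V < +oo.
Proof.
move=> mV Vr; have [r0|r0] := leP 0%R r.
  apply: (@le_lt_trans _ _ (leb3 (hcbox 0%R r))).
    apply: le_measure; rewrite ?inE//; first exact: measurable_hcbox.
    by move=> B /Vr /ltW; exact: hcbox_hdist.
  by rewrite leb3_hcbox// ltry.
rewrite (_ : V = set0) ?measure0//; apply/seteqP; split => // B /Vr.
by rewrite /hball/= => /lt_trans /(_ r0); rewrite ltNge hdist_ge0.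
Qed.

(** Bounded open sets are stable under intersection and generate the Borel sets; on each of them the
    two comparisons give equality. *)
Lemma tile_measure_unique (lam mu : {measure set (heis R) -> \bar R}) :
    tile_le lam mu -> tile_le mu lam ->
    (forall r, lam (hball 0%R r) < +oo) ->
  forall E, measurable E -> lam E = mu E.
Proof.
move=> lm ml lam_fin E mE.
pose G := [set V : set (heis R) | open V /\ exists k : nat, V `<=` hball 0%R k%:R].
have kB (B : heis R) : exists k : nat, hball 0%R k%:R B.
  exists (Num.bound (hdist B 0%R)); rewrite /hball/=.
  by apply: archi_boundP; exact: hdist_ge0.
apply: (measure_unique G (fun k => hball 0%R k%:R)) => //.
- apply/seteqP; split.
    rewrite heis_measurableE; apply: smallest_sub; first exact: smallest_sigma_algebra.
    move=> U oU; rewrite (_ : U = \bigcup_k (U `&` hball 0%R k%:R)).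
      apply: sigma_algebra_bigcup => k; apply: sub_sigma_algebra; split.
        by apply: openI => //; exact: open_hball.
      by exists k => B [].
    by apply/seteqP; split => [B UB|B [k _ []]//]; have [k kB'] := kB B; exists k.
  apply: smallest_sub; first exact: sigma_algebra_measurable.
  by move=> U [oU _]; exact: heis_open_measurable.
- move=> V W [oV [k Vk]] [oW _]; split; first exact: openI.
  by exists k => B [/Vk].
- by move=> k; split; [exact: open_hball|exists k].
- by apply/seteqP; split => // B _; have [k kB'] := kB B; exists k.
- move=> V [oV [k Vk]]; have mV := heis_open_measurable oV.
  have Vf := leb3_bounded_fin mV Vk.
  by apply/eqP; rewrite eq_le !(tile_le_open (M := k%:R)).
Qed.

End Tiles.

(** * Lebesgue measure as a multiple of 4-dimensional Hausdorff measure *)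

Section HausdorffLebesgue.
Context {R : realType}.
Implicit Types (A B : heis R) (s r : R).
Local Open Scope ereal_scope.
Notation H4 := (hausdorff (@hdist R) 4).

Lemma hausdorff_hmul_hdil k A s (E : set (heis R)) : (0 < s)%R ->
  hausdorff hdist k.+1 ((hmul A \o hdil s) @` E) = (s ^+ k.+1)%:E * hausdorff hdist k.+1 E.
Proof.
move=> s0; apply/eqP; rewrite eq_le; apply/andP; split.
  apply: hausdorff_similar => // x y; by rewrite /= hdist_mul hdist_dil// ltW.
rewrite -lee_pdivlMl ?exprn_gt0//.
pose g := hdil s^-1 \o hmul (hinv A).
have gK B : g ((hmul A \o hdil s) B) = B.
  rewrite /g/= hmulKh; apply: heis_eqP => /=; by field; rewrite gt_eqF.
have gE : E = g @` ((hmul A \o hdil s) @` E).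
  apply/seteqP; split => [B EB|_ [_ [B EB <-] <-]]; last by rewrite gK.
  by exists ((hmul A \o hdil s) B); rewrite ?gK//; exists B.
rewrite {1}gE -exprVn; apply: hausdorff_similar; first by rewrite invr_gt0.
by move=> x y; rewrite /g/= hdist_dil ?invr_ge0 ?hdist_mul// ltW.
Qed.

Lemma htile_image A s : (0 < s)%R -> htile A s = (hmul A \o hdil s) @` htile 0%R 1%R.
Proof.
move=> s0.
have sn0 : s != 0%R by rewrite gt_eqF.
have aux (t x : R) : (0 < t)%R -> (0 <= x < t)%R = (0 <= t^-1 * x < 1)%R.
  by move=> t0; rewrite mulrC ler_pdivlMr// ltr_pdivrMr// mul0r mul1r.
have key B : htile A s (hmul A (hdil s B)) <-> htile 0%R 1%R B.
  rewrite {1}/htile {1}/hcell /preimage /mkset hmulKh /htile/hcell/= !in_itv/= (aux s)// (aux s (s * _)%R)// (aux (s ^+ 2)%R) ?exprn_gt0//.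
  by rewrite !mulKf ?expf_neq0// !oppr0 !add0r !mulr0 !mul0r !subr0 addr0 expr1n.
apply/seteqP; split => [B AB|_ [B AB <-]]; last by apply/key.
exists (hdil s^-1 (hmul (hinv A) B)); last first.
  rewrite /= -[RHS](hmulVKh A); congr hmul.
  by apply: heis_eqP => /=; field.
apply/key; rewrite (_ : hmul A _ = B)//.
rewrite /= -[RHS](hmulVKh A); congr hmul.
by apply: heis_eqP => /=; field.
Qed.

Lemma hausdorff4_htile A s : (0 < s)%R ->
  H4 (htile A s) = (s ^+ 4)%:E * H4 (htile 0%R 1%R).
Proof. by move=> s0; rewrite htile_image// hausdorff_hmul_hdil. Qed.

(** Small lattice tiles give the cover. A tile of side s has diameter at most 4s, and 256 = 4^4. The
    box has size 6 = 2 + 4: the unit tile lies within 2 of the origin, and a tile meeting it has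
    diameter at most 4. *)
Lemma hausdorff4_unit_lt : H4 (htile 0%R 1%R) < +oo.
Proof.
apply: (@le_lt_trans _ _ (256%:E * leb3 (hcbox (0%R : heis R) 6%R))); last first.
  by rewrite leb3_hcbox// -EFinM ltry.
apply: hausdorff_le => e e0.
pose s := Num.min 1%R (e / 4)%R.
have s0 : (0 < s)%R by rewrite lt_min ltr01 divr_gt0.
have s1 : (s <= 1)%R by rewrite ge_min lexx.
have se : (4 * s <= e)%R by rewrite mulrC -ler_pdivlMr// ge_min lexx orbT.
pose U m := if `[< ltile s m `<=` hcbox 0%R 6%R >] then ltile s m else set0.
have mU m : measurable (U m) by rewrite /U; case: ifP => // _; exact: measurable_ltile.
have tU : trivIset setT U.
  move=> i j _ _ [B []]; rewrite /U; do 2 case: ifP => // _.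
  by move=> Bi Bj; apply: (trivIset_ltile s0) => //; exists B.
have dU m B C : U m B -> U m C -> (hdist B C <= 4 * s)%R.
  rewrite /U; case: ifP => // _; rewrite /ltile; case: pickle_inv => // i.
  exact: htile_diam.
have s40 : (0 <= 4 * s)%R by rewrite mulr_ge0// ltW.
apply: (@le_trans _ _ (\sum_(0 <= m <oo) ediam hdist (U m) ^+ 4)).
  apply: ereal_inf_lbound; exists U => //; split; last first.
    by move=> m; apply: (@le_trans _ _ (4 * s)%:E); [apply: ediam_le => // x y; exact: dU|rewrite lee_fin].
  move=> B B0; have [m Bm] := ltile_cover B s0; exists m => //.
  rewrite /U asboolT// => C Cm; apply: hcbox_hdist.
  have BC : (hdist C B <= 4 * s)%R.
    by move: Bm Cm; rewrite /ltile; case: pickle_inv => // i Bi Ci; exact: htile_diam Bi.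
  have := htile_near ltr01 B0; have := hdistD C B 0%R; lra.
apply: (@le_trans _ _ (\sum_(0 <= m <oo) 256%:E * leb3 (U m))).
  apply: lee_nneseries => [m _ _|m _]; first by rewrite expe_ge0// ediam_ge0.
  rewrite {2}/U; case: (asboolP (ltile s m `<=` hcbox 0%R 6%R)) => mV.
    rewrite /ltile; case um : (pickle_inv m) => [i|]; last first.
      rewrite measure0 mule0 /U (_ : (if _ then _ else _) = set0); last first.
        by case: ifP => // _; rewrite /ltile um.
      by rewrite ediam0 expeS mul0e.
    rewrite [X in 256%:E * X](_ : _ = (s ^+ 4)%:E); last exact: leb3_htile.
    rewrite -EFinM (_ : 256 * s ^+ 4 = (4 * s) ^+ 4)%R; last by ring.
    rewrite EFin_expe; apply: lee_expe; first exact: ediam_ge0.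
    by apply: ediam_le => // x y; exact: dU.
  by rewrite measure0 mule0 /U asboolF// ediam0 expeS mul0e.
rewrite nneseriesZl// lee_pmul2l ?lte_fin//.
have /cvg_lim -> // := measure_sigma_additive (mu := leb3) mU tU.
apply: le_measure; rewrite ?inE.
- exact: bigcupT_measurable.
- exact: measurable_hcbox.
- by move=> B [m _]; rewrite /U; case: asboolP => // mV mB; exact: mV.
Qed.

(** A piece of diameter r lies in a box of volume 8 r^4, while the unit tile has volume 1; hence
    every cover costs at least 1/8. *)
Lemma hausdorff4_unit_gt0 : 0 < H4 (htile 0%R 1%R).
Proof.
apply: (@lt_le_trans _ _ (8^-1)%:E); first by rewrite lte_fin invr_gt0.
apply: le_trans (hausdorff_pre_le _ _ _ ltr01).
apply: le_ereal_inf_tmp => _ [C [TC Ce] <-].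
have Cf i : ediam hdist (C i) \is a fin_num.
  by rewrite ge0_fin_numE ?ediam_ge0// (le_lt_trans (Ce i))// ltry.
pose r i := fine (ediam hdist (C i)).
have r0 i : (0 <= r i)%R by rewrite fine_ge0// ediam_ge0.
have /choice[A AP] : forall i, exists A, C i `<=` hcbox A (r i).
  move=> i; have [->|/set0P[A CA]] := eqVneq (C i) set0; first by exists 0%R.
  exists A => B CB; apply: hcbox_hdist; rewrite -lee_fin /r fineK//.
  exact: dist_le_ediam.
rewrite -(@lee_pmul2l _ 8%:E)// -EFinM divff//.
rewrite -nneseriesZl; last by move=> *; rewrite expe_ge0// ediam_ge0.
have -> : 1%:E = leb3 (htile 0%R 1%R : set (heis R)) by rewrite leb3_htile ?expr1n.
apply: (@le_trans _ _ (\sum_(0 <= i <oo) leb3 (hcbox (A i) (r i)))); last first.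
  apply: lee_nneseries => // i _.
  by rewrite leb3_hcbox// EFinM EFin_expe /r fineK.
apply: measure_sigma_subadditive.
- by move=> i; exact: measurable_hcbox.
- exact: measurable_htile.
- by move=> B /TC[i _ CB]; exists i => //; exact: AP.
Qed.

(** Both measures are left invariant and scale by s^4, so after normalization on the unit tile they
    agree exactly on all tiles. This [c] is the geometric constant of the theorem. *)
Lemma leb3_hausdorff4 : exists2 c : R, (0 < c)%R &
  forall E, measurable E -> leb3 E = c%:E * H4 E.
Proof.
have hf : H4 (htile 0%R 1%R) \is a fin_num.
  by rewrite ge0_fin_numE ?hausdorff4_unit_lt// ltW// hausdorff4_unit_gt0.
pose h := fine (H4 (htile 0%R 1%R)).
have h0 : (0 < h)%R by rewrite fine_gt0// hausdorff4_unit_gt0 hausdorff4_unit_lt.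
have c0 : (0 < h^-1)%R by rewrite invr_gt0.
exists h^-1%R => // E mE.
pose mu : {measure set (heis R) -> \bar R} := mscale (NngNum (ltW c0)) H4.
suff -> : leb3 E = mu E by [].
have tE A s : (0 < s)%R -> leb3 (htile A s) = mu (htile A s).
  move=> s0; rewrite leb3_htile//= /mscale/= hausdorff4_htile// muleCA.
  have -> : H4 (htile 0%R 1%R) = h%:E by rewrite /h fineK.
  by rewrite -!EFinM mulVf ?gt_eqF// mulr1.
apply: tile_measure_unique => //.
- move=> M e e0; exists 1%R => // s A /andP[s0 _] _.
  by rewrite -tE// leeDl// lee_fin mulr_ge0 ?exprn_ge0// ltW.
- move=> M e e0; exists 1%R => // s A /andP[s0 _] _.
  by rewrite -tE// leeDl// lee_fin mulr_ge0 ?exprn_ge0// ltW.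
- by move=> r; exact: (@leb3_bounded_fin _ _ r (heis_open_measurable (@open_hball R 0%R r))).
Qed.

End HausdorffLebesgue.

(** * Horizontal differentials *)

Lemma chain_diff (V : zmodType) (x y z a b : V) :
  z - x - (a + b) = (y - x - a) + (z - y - b).
Proof.
by rewrite [RHS]addrACA -opprD; congr (_ + _); rewrite [RHS]addrC addrA subrK.
Qed.

Section HorizontalDifferential.
Context {R : realType}.
Implicit Types (A B : heis R) (p q : R * R) (r s t e : R).

Lemma hdistB0 B : hdist B 0 = hrho B.
Proof. by have := hdist_mulr 0 B; rewrite hmul0h. Qed.

Definition hor p : heis R := (p, 0).

(** [L] vanishes on the centre: dilation by 2 sends the height z to 4z, so homogeneity gives the
    factor 2 where additivity gives 4. Hence [L] depends on the horizontal part only. *)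
Lemma hhom_lin (L : heis R -> R * R) B : hhom L ->
  L B = B.1.1 *: L (1, 0, 0) + B.1.2 *: L (0, 1, 0).
Proof.
move=> [_ LM LZ].
have L0 : L 0 = 0.
  by have := LM 0 0; rewrite hmul0h => /eqP; rewrite -subr_eq0 opprD addNKr oppr_eq0 => /eqP.
have LV A : L (hinv A) = - L A.
  by apply/eqP; rewrite -addr_eq0 -LM hmulVh L0.
have Lx x (v : heis R) : v = (1, 0, 0) \/ v = (0, 1, 0) -> L (hdil x v) = x *: L v.
  move=> hv; have [x0|x0|->] := ltrgt0P x; first exact: LZ.
    have -> : hdil x v = hinv (hdil (- x) v).
      by case: hv => ->; apply: heis_eqP => /=; ring.
    by rewrite LV LZ ?oppr_gt0// scaleNr opprK.
  rewrite scale0r -L0; congr L; apply: heis_eqP => /=; ring.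
have Lz z : L (0, 0, z) = 0.
  have h1 : L (0, 0, 4 * z) = 2 *: L (0, 0, z).
    by rewrite -LZ//; congr L; apply: heis_eqP => /=; ring.
  have h2 : L (0, 0, 4 * z) = 4 *: L (0, 0, z).
    rewrite (_ : (0, 0, 4 * z) = hmul (hmul (0, 0, z) (0, 0, z)) (hmul (0, 0, z) (0, 0, z))); last first.
      by apply: heis_eqP => /=; ring.
    by rewrite !LM -!mulr2n -mulrnA -scaler_nat.
  have : (4 - 2) *: L (0, 0, z) = 0 by rewrite scalerBl -h1 -h2 subrr.
  by move/eqP; rewrite scaler_eq0 => /orP[|/eqP//]; rewrite subr_eq0 eqr_nat.
rewrite -!Lx; [|by right|by left].
have -> : B = hmul (hmul (hdil B.1.1 (1, 0, 0)) (hdil B.1.2 (0, 1, 0)))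
    (0, 0, B.2 + 2 * B.1.1 * B.1.2).
  by apply: heis_eqP => /=; ring.
rewrite [in LHS]LM Lz addr0 LM; congr (L _ + L _); apply: heis_eqP => /=; ring.
Qed.

Variable F : heis R -> R * R.
Hypothesis CF : C1H F.

Lemma Dh_is_hdiff A : is_hdiff F A (Dh F A).
Proof. by apply: (@xgetPex _ _ [set L | is_hdiff F A L]); exact: (CF.1 A). Qed.

Lemma Dh_hhom A : hhom (Dh F A).
Proof. by have [] := Dh_is_hdiff A. Qed.

Lemma dh_lin A p : dh F A p = p.1 *: dh F A (1, 0) + p.2 *: dh F A (0, 1).
Proof. by rewrite /dh (hhom_lin (p.1, p.2, 0) (Dh_hhom A)). Qed.

Lemma Dh_dh A B : Dh F A B = dh F A B.1.
Proof. by rewrite dh_lin (hhom_lin B (Dh_hhom A)). Qed.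

Lemma dhD A p q : dh F A (p + q) = dh F A p + dh F A q.
Proof. by rewrite dh_lin (dh_lin A p) (dh_lin A q)/= !scalerDl addrACA. Qed.

Lemma dhZ A t p : dh F A (t *: p) = t *: dh F A p.
Proof. by rewrite dh_lin (dh_lin A p)/= scalerDr !scalerA. Qed.

(** The points [hor (t *: p)] form a one-parameter subgroup, so a further step along a horizontal
    line is again a right translation by a horizontal vector, as horizontal differentiability
    requires. *)
Lemma hor_lin A s t p :
  hmul A (hor ((s + t) *: p)) = hmul (hmul A (hor (s *: p))) (hor (t *: p)).
Proof. by apply: heis_eqP => /=; rewrite /GRing.scale/=; ring. Qed.

Lemma hrho_hor p : hrho (hor p) = enorm2 p.
Proof. by rewrite /hrho/= normr0 sqrtr0 max_l// enorm2_ge0. Qed.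

(* Both coordinates of [R * R] at once: [f] is [fst] or [snd]. *)
Lemma is_derive_hor (f : R * R -> R) A p s :
    (forall u v, f (u + v) = f u + f v) -> (forall t v, f (t *: v) = t * f v) ->
    (forall v, `|f v| <= enorm2 v) ->
  is_derive s 1 (fun t => f (F (hmul A (hor (t *: p)))))
    (f (dh F (hmul A (hor (s *: p))) p)).
Proof.
move=> fD fZ fn.
set G := fun t => _; set A' := hmul A (hor (s *: p)); set l := f _.
have fB u v : f (u - v) = f u - f v.
  by rewrite -scaleN1r fD fZ mulN1r.
suff cG : (fun h => h^-1 *: (G (h *: 1 + s) - G s)) @ 0^' --> l.
  by apply: DeriveDef; [apply/cvg_ex; exists l|apply: cvg_lim].
apply/cvgrPdist_le => e e0.
have [_ /(_ (e / (enorm2 p + 1)))] := Dh_is_hdiff A'.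
have p1 : 0 < enorm2 p + 1 by rewrite ltr_wpDl// enorm2_ge0.
rewrite divr_gt0// => /(_ isT) /nbhs_hballP[r r0 rP].
near=> h.
have h0 : h != 0 by near: h; exact: nbhs_dnbhs_neq.
have hr : `|h| * (enorm2 p + 1) < r.
  rewrite -ltr_pdivlMr//; near: h; apply: dnbhs0_lt; exact: divr_gt0.
have := rP (hor (h *: p)); rewrite /hball/= hdistB0 hrho_hor enorm2Z.
have hpr : `|h| * enorm2 p < r by apply: le_lt_trans hr; rewrite ler_wpM2l// lerDl.
move=> /(_ hpr); rewrite -hor_lin Dh_dh/= dhZ => key.
have -> : l - h^-1 *: (G (h *: 1 + s) - G s) =
    - (h^-1 * f (F (hmul A (hor ((s + h) *: p))) - F A' - h *: dh F A' p)).
  rewrite !fB fZ /G /l /GRing.scale/= mulr1 (addrC h s) -/A'; field.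
  exact: h0.
rewrite normrN normrM normfV ler_pdivrMl ?normr_gt0//.
apply: le_trans (fn _) _; apply: le_trans key _.
rewrite mulrCA ler_wpM2l// mulrAC ler_pdivrMr// ler_wpM2l ?lerDl// ltW//.
Unshelve. all: by end_near. Qed.

(** The mean value theorem is applied to each coordinate separately, with its own intermediate
    point; this costs the factor 2. *)
Lemma hor_segment_le A0 A p e : 
    (forall c, 0 <= c <= 1 -> forall B,
      enorm2 (Dh F (hmul A (hor (c *: p))) B - Dh F A0 B) <= e * hrho B) ->
  enorm2 (F (hmul A (hor p)) - F A - dh F A0 p) <= 2 * e * enorm2 p.
Proof.
move=> dP.
suff aux (f : R * R -> R) : (forall u v, f (u + v) = f u + f v) ->
    (forall t v, f (t *: v) = t * f v) -> (forall v, `|f v| <= enorm2 v) ->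
  `|f (F (hmul A (hor p)) - F A - dh F A0 p)| <= e * enorm2 p.
  apply: le_trans (enorm2_le_sum _) _; rewrite -mulrA mulr_natl mulr2n; apply: lerD.
    by apply: (aux fst) => //; exact: normr_fst_le.
  by apply: (aux snd) => //; exact: normr_snd_le.
move=> fD fZ fn.
have fB u v : f (u - v) = f u - f v by rewrite -scaleN1r fD fZ mulN1r.
pose G t := f (F (hmul A (hor (t *: p)))).
pose dG t := f (dh F (hmul A (hor (t *: p))) p).
have dGP (x : R) : is_derive x (1 : R) G (dG x) by exact: is_derive_hor.
have [c|c cab GE] := @MVT_segment R G dG 0 1 ler01 (fun x _ => dGP x).
  apply: derivable_within_continuous => x _; exact: (@ex_derive _ _ _ _ _ _ _ (dGP x)).
rewrite !fB; have -> : f (F (hmul A (hor p))) - f (F A) = dG c.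
  move: GE; rewrite /G scale1r scale0r subr0 mulr1 => <-; congr (_ - f (F _)).
  by rewrite (_ : hor 0 = 0)// hmulh0.
rewrite -fB; apply: le_trans (fn _) _.
have := dP c; rewrite in_itv/= in cab; move=> /(_ cab (hor p)).
by rewrite !Dh_dh hrho_hor.
Qed.

(* [A^-1 B] is its horizontal part times a vertical element, and the latter is the endpoint
   of four horizontal segments that project to the sides of a square; the mean value
   theorem applies on each of the five segments. *)
Lemma C1H_local A0 e : 0 < e -> exists2 r, 0 < r &
  forall A B, hdist A A0 < r -> hdist B A0 < r ->
    enorm2 (F B - F A - dh F A0 (B.1 - A.1)) <= e * hdist A B.
Proof.
(* 6 = 2 * 3: the factor 2 of [hor_segment_le], and a total length of the five segments of at most
   three times the distance. *)
move=> e0; have e60 : 0 < e / 6 by rewrite divr_gt0.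
have /nbhs_hballP[r r0 rP] := CF.2 A0 _ e60.
(* [A] is within r/7 of [A0], the first segment is shorter than 2r/7 and each of the four sides
   shorter than r/7: the path stays in the ball of radius r. *)
exists (r / 7); first by rewrite divr_gt0.
move=> A B AA0 BA0.
pose est C D l := enorm2 (F D - F C - dh F A0 (D.1 - C.1)) <= e / 3 * l.
have est_trans C D E l m : est C D l -> est D E m -> est C E (l + m).
  rewrite /est => CD DE.
  have -> : E.1 - C.1 = (D.1 - C.1) + (E.1 - D.1) by rewrite [RHS]addrC addrA subrK.
  rewrite dhD (chain_diff _ (F D)).
  by apply: le_trans (enorm2D _ _) _; rewrite mulrDr lerD.
have seg C p : hdist C A0 + enorm2 p < r -> est C (hmul C (hor p)) (enorm2 p).
  move=> Cr; rewrite /est (_ : (hmul C (hor p)).1 - C.1 = p); last first.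
    by case: p C {Cr} => ? ? [[? ?] ?]; congr (_, _) => /=; ring.
  rewrite (_ : e / 3 = 2 * (e / 6)); last by field.
  apply: hor_segment_le => c /andP[c0 c1]; apply: rP; rewrite /hball/=.
  apply: le_lt_trans (hdistD _ C _) _; rewrite hdist_mulr hrho_hor enorm2Z ger0_norm//.
  apply: le_lt_trans Cr; by rewrite addrC lerD2l ler_piMl// enorm2_ge0.
pose D := hmul (hinv A) B; pose t := D.2.
(* A square of side u lifts to a height change of 4 u^2 in absolute value; the sign of v picks the
   orientation. *)
pose u := Num.sqrt `|t| / 2; pose v := - Num.sg t * u.
have u0 : 0 <= u by rewrite divr_ge0// sqrtr_ge0.
have uD : u <= hrho D / 2 by rewrite /u ler_pM2r// le_max lexx orbT.
have vu : `|v| <= u.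
  rewrite normrM normrN normr_sg (ger0_norm u0); case: (t == 0) => /=; rewrite ?mul0r//.
  by rewrite mul1r.
have uv : - 4 * (v * u) = t.
  rewrite /v /u (_ : - 4 * _ = Num.sg t * (Num.sqrt `|t|) ^+ 2); last by field.
  by rewrite sqr_sqrtr// -numEsg.
have BE : B = hmul (hmul (hmul (hmul (hmul A (hor D.1)) (hor (v, 0))) (hor (0, u)))
   (hor (- v, 0))) (hor (0, - u)).
  rewrite -!hmulA -[LHS](hmulVKh A); congr hmul; rewrite -/D.
  have DE : D = (D.1, - 4 * (v * u)) by rewrite uv /t; case: (D).
  by rewrite {1}DE; case: (D.1) => a b; apply: heis_eqP => /=; ring.
have dD : hdist A B = hrho D by rewrite hdistC.
have D2 : hrho D < 2 * (r / 7).
  rewrite -dD; apply: le_lt_trans (hdistD _ A0 _) _; rewrite (hdistC A0).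
  by rewrite mulr_natl mulr2n ltrD.
have n1 : enorm2 D.1 <= hrho D by exact: enorm2_hrho.
have nx x : enorm2 (x, 0 : R) = `|x|.
  by rewrite /enorm2/= expr0n/= addr0 sqrtr_sqr.
have ny x : enorm2 (0 : R, x) = `|x|.
  by rewrite /enorm2/= expr0n/= add0r sqrtr_sqr.
have step C p l m : hdist C A0 <= l -> enorm2 p <= m -> hdist (hmul C (hor p)) A0 <= l + m.
  move=> Cl pm; apply: le_trans (hdistD _ C _) _; rewrite hdist_mulr hrho_hor.
  by rewrite addrC lerD.
have nu : `|u| = u by rewrite ger0_norm.
pose C1 := hmul A (hor D.1); pose C2 := hmul C1 (hor (v, 0)).
pose C3 := hmul C2 (hor (0, u)); pose C4 := hmul C3 (hor (- v, 0)).
have h0 := ltW AA0.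
have h1 : hdist C1 A0 <= r / 7 + hrho D by exact: step.
have h2 : hdist C2 A0 <= r / 7 + hrho D + u by apply: step; rewrite ?nx.
have h3 : hdist C3 A0 <= r / 7 + hrho D + u + u by apply: step; rewrite ?ny ?nu.
have h4 : hdist C4 A0 <= r / 7 + hrho D + u + u + u by apply: step; rewrite ?nx ?normrN.
have s1 : est A C1 (enorm2 D.1) by apply: seg; lra.
have s2 : est C1 C2 `|v| by rewrite -nx; apply: seg; rewrite nx; lra.
have s3 : est C2 C3 u by rewrite -[u in est _ _ u]nu -ny; apply: seg; rewrite ny nu; lra.
have s4 : est C3 C4 `|v| by rewrite -normrN -nx; apply: seg; rewrite nx normrN; lra.
have s5 : est C4 B u.
  by rewrite -[u in est _ _ u]nu -normrN -ny BE; apply: seg; rewrite ny normrN nu; lra.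
have := est_trans _ _ _ _ _ (est_trans _ _ _ _ _ (est_trans _ _ _ _ _ (est_trans _ _ _ _ _ s1 s2) s3) s4) s5.
rewrite /est => /le_trans; apply; rewrite dD.
have : enorm2 D.1 + `|v| + u + `|v| + u <= 3 * hrho D by lra.
move: (enorm2 D.1 + _ + _ + _ + _) => w; nra.
Qed.

Lemma dh_bounded A : exists2 K : R, 0 < K & forall p, enorm2 (dh F A p) <= K * enorm2 p.
Proof.
exists (enorm2 (dh F A (1, 0)) + enorm2 (dh F A (0, 1)) + 1).
  by rewrite ltr_wpDl// addr_ge0 ?enorm2_ge0.
move=> p; rewrite dh_lin; apply: le_trans (enorm2D _ _) _; rewrite !enorm2Z.
have := normr_fst_le p; have := normr_snd_le p.
have := enorm2_ge0 (dh F A (1, 0)); have := enorm2_ge0 (dh F A (0, 1)).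
have := enorm2_ge0 p; nra.
Qed.

Lemma C1H_continuous : continuous F.
Proof.
move=> A; have [K K0 KP] := dh_bounded A; have [r r0 rP] := C1H_local A ltr01.
apply/cvgrPdist_lt => e e0; near=> B.
have BA : hdist B A < Num.min r (e / (K + 1)).
  by near: B; apply: nbhs_hball; rewrite lt_min r0 divr_gt0// addr_gt0.
move: BA; rewrite lt_min => /andP[Br Be].
have := rP A B; rewrite hdistxx => /(_ r0 Br); rewrite mul1r => h.
have FBA : enorm2 (F B - F A) < e.
  rewrite -[F B - F A](subrK (dh F A (B.1 - A.1))).
  apply: le_lt_trans (enorm2D _ _) _.
  apply: (@le_lt_trans _ _ (hdist B A * (K + 1))); last by rewrite -ltr_pdivlMr// addr_gt0.
  rewrite mulrDr mulr1 addrC; apply: lerD; last by rewrite hdistC.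
  apply: le_trans (KP _) _; rewrite (mulrC K) ler_pM2r//.
  have <- : (hmul (hinv A) B).1 = B.1 - A.1; last exact: enorm2_hrho.
  by case: (A) (B) => [[? ?] ?] [[? ?] ?]; congr (_, _); rewrite addrC.
rewrite -opprB normrN prod_normE gt_max.
by rewrite (le_lt_trans (normr_fst_le _) FBA) (le_lt_trans (normr_snd_le _) FBA).
Unshelve. all: by end_near. Qed.

Lemma det2_dh_continuous : continuous (fun A => det2 (dh F A)).
Proof.
have dc p (f : R * R -> R) : (forall v, `|f v| <= enorm2 v) ->
    (forall u v, f (u - v) = f u - f v) -> continuous (fun A => f (dh F A p)).
  move=> fn fB A; apply/cvgrPdist_lt => e e0.
  have e1 : 0 < e / (enorm2 p + 1) by rewrite divr_gt0// ltr_wpDl// enorm2_ge0.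
  have := CF.2 A _ e1; apply: filterS => B /(_ (hor p)).
  rewrite !Dh_dh hrho_hor/= => h.
  rewrite -normrN opprB -fB; apply: le_lt_trans (fn _) _; apply: le_lt_trans h _.
  by rewrite mulrAC ltr_pdivrMr ?ltr_wpDl ?enorm2_ge0// ltr_pM2l// ltrDl.
rewrite (_ : (fun A => _) = (fun A => (dh F A (1, 0)).1 * (dh F A (0, 1)).2 -
    (dh F A (0, 1)).1 * (dh F A (1, 0)).2)); last first.
  by apply/funext => A; rewrite det2E.
have c1 p : continuous (fun A => (dh F A p).1) by apply: dc => //; exact: normr_fst_le.
have c2 p : continuous (fun A => (dh F A p).2) by apply: dc => //; exact: normr_snd_le.
by move=> A; apply: cvgB; apply: cvgM; (exact: c1 || exact: c2).
Qed.

(** Cramer's rule: the inverse of [g] when [g] is linear with nonzero determinant. *)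
Definition linv (g : R * R -> R * R) p : R * R :=
  (((g (0, 1)).2 * p.1 - (g (0, 1)).1 * p.2) / det2 g,
   ((g (1, 0)).1 * p.2 - (g (1, 0)).2 * p.1) / det2 g).

Lemma linvB g p q : linv g (p - q) = linv g p - linv g q.
Proof. by congr (_, _) => /=; ring. Qed.

Lemma linv_bounded g : exists2 K : R, 0 < K & forall p, enorm2 (linv g p) <= K * enorm2 p.
Proof.
set a := (g (1, 0)).1; set b := (g (0, 1)).1; set c := (g (1, 0)).2; set d := (g (0, 1)).2.
exists ((`|a| + `|b| + `|c| + `|d|) * `|det2 g|^-1 + 1).
  by rewrite ltr_wpDl// mulr_ge0 ?invr_ge0// !addr_ge0.
move=> p; apply: le_trans (enorm2_le_sum _) _; rewrite /linv /= -/a -/b -/c -/d.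
rewrite 2!(normrM _ _^-1) normfV [leRHS]mulrDl mul1r -mulrDl -[leLHS]addr0.
apply: lerD; last exact: enorm2_ge0.
rewrite [leRHS]mulrAC ler_wpM2r ?invr_ge0//.
have h (x y : R) : `|x * p.1 - y * p.2| <= (`|x| + `|y|) * enorm2 p.
  apply: le_trans (ler_normB _ _) _; rewrite !normrM mulrDl; apply: lerD;
    rewrite ler_wpM2l//; [exact: normr_fst_le|exact: normr_snd_le].
have := h d b; have := h c a; rewrite (distrC (c * _)).
have := enorm2_ge0 p; lra.
Qed.

Lemma linv_continuous g : continuous (linv g).
Proof.
move=> p; have [K K0 KP] := linv_bounded g; apply/cvgrPdist_lt => e e0; near=> q.
rewrite -linvB prod_normE gt_max.
suff h : enorm2 (linv g (p - q)) < e.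
  by rewrite (le_lt_trans (normr_fst_le _) h) (le_lt_trans (normr_snd_le _) h).
apply: le_lt_trans (KP _) _; apply: (@le_lt_trans _ _ (K * (2 * `|p - q|))).
  rewrite ler_pM2l//; apply: le_trans (enorm2_le_sum _) _.
  by rewrite prod_normE mulr_natl mulr2n; apply: lerD; rewrite le_max lexx ?orbT.
rewrite mulrA mulrC -ltr_pdivlMr ?mulr_gt0//.
near: q; apply: cvgr_dist_lt; rewrite ?divr_gt0 ?mulr_gt0//.
Unshelve. all: by end_near. Qed.

Lemma linvK A p : det2 (dh F A) != 0 -> linv (dh F A) (dh F A p) = p.
Proof.
move=> D0; rewrite dh_lin /linv; move: D0; rewrite det2E; move: (dh F A (1, 0)) (dh F A (0, 1)).
by move=> [a c] [b d]; case: p => x y /= D0; congr (_, _); rewrite /GRing.scale/=; field.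
Qed.

Lemma linvKV A p : det2 (dh F A) != 0 -> dh F A (linv (dh F A) p) = p.
Proof.
move=> D0; rewrite dh_lin /linv; move: D0; rewrite det2E; move: (dh F A (1, 0)) (dh F A (0, 1)).
move=> [a c] [b d]; case: p => x y /= D0.
by rewrite [LHS]surjective_pairing; congr (_, _); rewrite /= /GRing.scale/=; field.
Qed.

Lemma C1H_normalized A0 e : det2 (dh F A0) != 0 -> 0 < e -> exists2 r, 0 < r &
  forall A B, hdist A A0 < r -> hdist B A0 < r ->
    enorm2 (linv (dh F A0) (F B) - linv (dh F A0) (F A) - (B.1 - A.1)) <= e * hdist A B.
Proof.
move=> D0 e0; have [K K0 KP] := linv_bounded (dh F A0).
have [r r0 rP] := C1H_local A0 (divr_gt0 e0 K0).
exists r => // A B Ar Br; rewrite -[B.1 - A.1](linvK _ D0) -!linvB.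
apply: le_trans (KP _) _; rewrite -ler_pdivlMl// mulrA (mulrC _ e).
exact: rP.
Qed.

End HorizontalDifferential.

(** * Arcs from bisection *)

Section VerticalOrder.
Context {R : realType}.
Implicit Types (A B C D : heis R).

Definition hzeta A B : R := (hmul (hinv A) B).2.

(* Not transitive in general: it is so on level sets, where [hzeta] is almost additive. *)
Definition hle A B : bool := 0 <= hzeta A B.

Lemma hzetaC A B : hzeta B A = - hzeta A B.
Proof. by rewrite /hzeta/=; ring. Qed.

Lemma hzetaxx A : hzeta A A = 0.
Proof. by rewrite /hzeta hmulVh. Qed.

Lemma hlexx A : hle A A.
Proof. by rewrite /hle hzetaxx. Qed.

Lemma hle_total C D : hle C D \/ 0 < hzeta D C.
Proof. by rewrite /hle (hzetaC C D) oppr_gt0; case: (leP 0 (hzeta C D)); [left|right]. Qed.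

Lemma hzeta_continuous A : continuous (hzeta A).
Proof.
move=> B; apply: (@continuous_comp _ _ _ (hmul (hinv A)) snd); last exact: cvg_snd.
exact: hmul_continuous.
Qed.

Lemma hzeta_continuousl A : continuous (hzeta ^~ A).
Proof.
rewrite (_ : hzeta ^~ A = (fun B => - hzeta A B)); last first.
  by apply/funext => B; rewrite hzetaC.
by move=> B; apply: cvgN; exact: hzeta_continuous.
Qed.

Lemma closed_hle A : closed [set B | hle A B].
Proof.
rewrite (_ : [set _ | _] = (hzeta A) @^-1` [set x | 0 <= x])//.
by apply: closed_comp (@closed_ge _ _) => x _; exact: hzeta_continuous.
Qed.

Lemma closed_hlel A : closed [set B | hle B A].
Proof.
rewrite (_ : [set _ | _] = (hzeta ^~ A) @^-1` [set x | 0 <= x])//.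
by apply: closed_comp (@closed_ge _ _) => x _; exact: hzeta_continuousl.
Qed.

End VerticalOrder.

Section DyadicArc.
Context {R : realType}.
Implicit Types (A B C D E : heis R).

Variables (T : set (heis R)) (P P' : heis R) (mid : heis R -> heis R -> heis R).
Hypothesis cT : compact T.
Hypothesis TP : T P.
Hypothesis TP' : T P'.
Hypothesis PP' : 0 < hzeta P P'.
Hypothesis dz : forall C D, T C -> T D -> hdist C D ^+ 2 = `|hzeta C D|.
(** Height is additive up to a factor. The 2 here and the 3/4 in [midP] leave slack for the values
    near 1 and 1/2 that hold on level sets. *)
Hypothesis tr : forall C D E, T C -> T D -> T E -> hle C D -> hle D E ->
  hzeta C D + hzeta D E <= 2 * hzeta C E /\ hzeta C E <= 2 * (hzeta C D + hzeta D E).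
Hypothesis bnd : forall C, T C -> hle P C /\ hle C P'.
Hypothesis midP : forall C D, T C -> T D -> 0 < hzeta C D ->
  [/\ T (mid C D), 0 < hzeta C (mid C D) <= 3 / 4 * hzeta C D &
    0 < hzeta (mid C D) D <= 3 / 4 * hzeta C D].

Let trans C D E : T C -> T D -> T E -> hle C D -> hle D E -> hle C E.
Proof. by move=> tC tD tE CD DE; have [] := tr tC tD tE CD DE; rewrite /hle in CD DE *; lra. Qed.

(** The point for the parameter k / 2^n: an even k repeats a point of the previous generation, an
    odd k inserts a midpoint. Values for k > 2^n are junk. *)
Fixpoint dyadic (n k : nat) : heis R :=
  if n is n'.+1 then
    if odd k then mid (dyadic n' k./2) (dyadic n' k./2.+1) else dyadic n' k./2
  else if k == 0%N then P else P'.

Let G := dyadic.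
Let z0 := hzeta P P'.
Let th : R := 3 / 4.
Let th0 : 0 <= th. Proof. by rewrite /th; lra. Qed.

Lemma dyadic_step n k : (k < 2 ^ n)%N -> [/\ T (G n k), T (G n k.+1) &
    0 < hzeta (G n k) (G n k.+1) <= th ^+ n * z0].
Proof.
elim: n k => [|n IH] k.
  by rewrite expn0 ltnS leqn0 => /eqP -> /=; rewrite PP' expr0 mul1r; split => //=.
rewrite expnS mul2n => kn.
have k2 : (k./2 < 2 ^ n)%N by lia.
have [tk tk1 /andP[z1 z2]] := IH _ k2.
have [tm /andP[m1 m2] /andP[m3 m4]] := midP tk tk1 z1.
have th4 : 3 / 4 * hzeta (G n k./2) (G n k./2.+1) <= th ^+ n.+1 * z0.
  by rewrite exprS -[leRHS]mulrA ler_wpM2l.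
rewrite /G /=; case: (boolP (odd k)) => ok /=.
  have -> : uphalf k = k./2.+1 by lia.
  by rewrite m3 (le_trans m4).
have -> : uphalf k = k./2 by lia.
by rewrite m1 (le_trans m2).
Qed.

Lemma dyadic_in n k : (k <= 2 ^ n)%N -> T (G n k).
Proof.
rewrite leq_eqVlt => /orP[/eqP->|/dyadic_step[]//].
have [m me] : exists m, (2 ^ n)%N = m.+1 by exists (2 ^ n).-1; rewrite prednK// expn_gt0.
by rewrite me; have [|//] := @dyadic_step n m; rewrite me.
Qed.

Lemma dyadic_mono n k l : (k <= l <= 2 ^ n)%N -> hle (G n k) (G n l).
Proof.
move=> /andP[kl ln]; elim: l kl ln => [|l IH]; first by rewrite leqn0 => /eqP -> _; exact: hlexx.
rewrite leq_eqVlt => /orP[/eqP->|]; first by move=> _; exact: hlexx.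
rewrite ltnS => kl ln; have [tl tl1 /andP[z1 _]] := dyadic_step ln.
apply: (trans (@dyadic_in n k _) tl tl1); [lia|by apply: IH => //; exact: ltnW|exact: ltW].
Qed.

Lemma dyadic_pow n m k : G (n + m)%N (k * 2 ^ m)%N = G n k.
Proof.
elim: m => [|m IH]; first by rewrite addn0 expn0 muln1.
by rewrite addnS expnS mulnCA mul2n -IH /G /= odd_double doubleK.
Qed.

(** Gaps shrink geometrically and height is the square of distance. Two adjacent gaps span a height
    of at most 4 times the bound on one, and two points inside differ by at most 4 times that,
    whence the 16. *)
Lemma dyadic_close (e : R) : 0 < e -> exists n, forall C D k l, T C -> T D ->
    (k <= l <= 2 ^ n)%N -> (l <= k.+2)%N ->
    hle (G n k) C -> hle C (G n l) -> hle (G n k) D -> hle D (G n l) -> hdist C D < e.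
Proof.
move=> e0.
have [n nP] : exists n, 16 * (th ^+ n * z0) < e ^+ 2.
  have z16 : 0 < 16 * z0 by rewrite mulr_gt0.
  have c0 : (fun n => th ^+ n) @ \oo --> (0 : R).
    by apply: cvg_expr; rewrite ger0_norm /th; lra.
  have e2 : 0 < e ^+ 2 / (16 * z0) by rewrite divr_gt0// exprn_gt0.
  have /cvgrPdist_lt /(_ _ e2)[n _ /(_ n (leqnn _))] := c0.
  rewrite sub0r normrN ger0_norm; last by rewrite exprn_ge0.
  by rewrite ltr_pdivlMr// => h; exists n; rewrite mulrCA.
exists n => C D k l tC tD /andP[kl ln] lk kC Cl kD Dl.
have tk : T (G n k) by apply: dyadic_in; exact: leq_trans ln.
have tl : T (G n l) by exact: dyadic_in.
have kl4 : hzeta (G n k) (G n l) <= 4 * (th ^+ n * z0).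
  have z00 : 0 <= th ^+ n * z0 by apply: mulr_ge0; [exact: exprn_ge0|exact: ltW].
  have [->|[lE|lE]] : l = k \/ (l = k.+1 \/ l = k.+2) by lia.
  - by rewrite hzetaxx mulr_ge0.
  - have := @dyadic_step n k; rewrite -lE => /(_ ln)[_ _ /andP[_]]; lra.
  - have [|_ tk1 /andP[a1 a2]] := @dyadic_step n k; first by apply: leq_trans ln; rewrite lE.
    have [|_ _ /andP[b1 b2]] := @dyadic_step n k.+1; first by rewrite -lE.
    rewrite -lE in b1 b2.
    have [_] := tr tk tk1 tl (ltW a1) (ltW b1); lra.
have e0' : 0 <= e by exact: ltW.
rewrite -(@ltr_pXn2r _ 2)// ?nnegrE ?hdist_ge0// (dz tC tD).
have aux X Y : T X -> T Y -> hle (G n k) X -> hle X Y -> hle Y (G n l) ->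
    hzeta X Y <= 4 * hzeta (G n k) (G n l).
  move=> tX tY kX XY Yl; have kY := trans tk tX tY kX XY.
  have [h1 _] := tr tk tX tY kX XY; have [h2 _] := tr tk tY tl kY Yl.
  rewrite /hle in kX XY Yl kY; lra.
apply: le_lt_trans nP.
have [CD|/ltW DC] := hle_total C D.
  by rewrite ger0_norm//; have := aux C D tC tD kC CD Dl; lra.
rewrite hzetaC normrN ger0_norm//; have := aux D C tD tC kD DC Cl; lra.
Qed.

Let dy n k : R := k%:R / 2 ^+ n.

Let p2 n : 0 < 2 ^+ n :> R. Proof. by rewrite exprn_gt0. Qed.

Let dyn n m k : dy (n + m)%N (k * 2 ^ m)%N = dy n k.
Proof.
rewrite /dy exprD natrM natrX invfM mulrACA divff ?mulr1//.
Qed.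

Let dy_le n k l : (dy n k <= dy n l) = (k <= l)%N.
Proof. by rewrite /dy ler_pM2r ?invr_gt0// ler_nat. Qed.

Let dy01 n k : (k <= 2 ^ n)%N -> 0 <= dy n k <= 1.
Proof.
move=> kn; rewrite /dy divr_ge0//=.
by rewrite ler_pdivrMr// mul1r -natrX ler_nat.
Qed.

Let dy1 n : dy n (2 ^ n)%N = 1.
Proof. by rewrite /dy natrX divff// gt_eqF. Qed.

Let dyS n k : dy n k.+1 = dy n k + (2 ^+ n)^-1.
Proof. by rewrite /dy -addn1 natrD mulrDl mul1r. Qed.

Let fl (t : R) n : 0 <= t <= 1 -> exists k : nat, [/\ (k <= 2 ^ n)%N, dy n k <= t & t < dy n k.+1].
Proof.
move=> /andP[t0 t1]; exists (Num.trunc (2 ^+ n * t)).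
have tt : 0 <= 2 ^+ n * t by rewrite mulr_ge0// ltW.
have /andP[h1 h2] := truncn_itv tt.
split.
- by rewrite -(ler_nat R) natrX (le_trans h1)// ler_piMr// ltW.
- by rewrite /dy ler_pdivrMr// (mulrC t).
- by rewrite /dy ltr_pdivlMr// (mulrC t).
Qed.

(* [C] sits at parameter [t] of the arc whose dyadic points are [dyadic]. *)
Definition at_param t C := forall n k, (k <= 2 ^ n)%N ->
  (t <= dy n k -> hle C (G n k)) /\ (dy n k <= t -> hle (G n k) C).

(** A cluster point of the dyadic points just below [t]. The order conditions are closed and hold
    from generation n on, so they pass to it. *)
Lemma at_param_ex t : 0 <= t <= 1 -> exists2 C, T C & at_param t C.
Proof.
move=> t01; have /choice[k kP] : forall n, exists k : nat,
  [/\ (k <= 2 ^ n)%N, dy n k <= t & t < dy n k.+1] by move=> n; exact: fl.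
pose u n := G n (k n).
have uT : (u @ \oo) T by exists 0%N => // n _; apply: dyadic_in; have [] := kP n.
have [C [TC clC]] := cT _ uT.
exists C => // n j jn.
have clos (S : set (heis R)) : closed S -> (forall m, (n <= m)%N -> S (u m)) -> S C.
  move=> cS uS; rewrite ((closure_id S).1 cS).
  move: clC; rewrite clusterE => /(_ S); apply.
  by exists n => // m /= nm; exact: uS.
split=> tj.
  apply: (clos [set D | hle D (G n j)]); first exact: closed_hlel.
  move=> m nm /=; have [km k1 k2] := kP m.
  have mE : m = (n + (m - n))%N by lia.
  rewrite /u -(dyadic_pow n (m - n) j) -mE; apply: dyadic_mono.
  rewrite -(dy_le m) [X in _ <= dy X _]mE dyn (le_trans k1 tj)/=.
  by rewrite [X in (_ <= 2 ^ X)%N]mE expnD leq_mul.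
apply: (clos [set D | hle (G n j) D]); first exact: closed_hle.
move=> m nm /=; have [km k1 k2] := kP m.
have mE : m = (n + (m - n))%N by lia.
rewrite /u -(dyadic_pow n (m - n) j) -mE; apply: dyadic_mono; rewrite km andbT.
rewrite -ltnS ltnNge; apply/negP => kj.
have : dy m (k m).+1 <= dy m (j * 2 ^ (m - n)) by rewrite dy_le.
by rewrite [X in _ <= dy X _]mE dyn leNgt (le_lt_trans tj k2).
Qed.

Lemma at_param_cont (e : R) : 0 < e -> exists2 dlt : R, 0 < dlt &
  forall t t' C D, 0 <= t <= 1 -> 0 <= t' <= 1 -> `|t - t'| < dlt ->
    T C -> T D -> at_param t C -> at_param t' D -> hdist C D < e.
Proof.
move=> e0; have [n nP] := dyadic_close e0; exists (2 ^+ n)^-1; first by rewrite invr_gt0.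
suff aux t t' C D : 0 <= t <= 1 -> 0 <= t' <= 1 -> t <= t' -> t' < t + (2 ^+ n)^-1 ->
    T C -> T D -> at_param t C -> at_param t' D -> hdist C D < e.
  move=> t t' C D t01 t01'; rewrite ltr_distl => /andP[h1 h2] tC tD Ct Dt.
  have [tt|/ltW tt] := leP t t'; first by apply: (aux t t') => //; lra.
  by rewrite hdistC; apply: (aux t' t).
move=> t01 t01' tt tn tC tD Ct Dt; have [k [kn k1 k2]] := fl n t01.
(* Parameters less than 2^-n apart fit into two adjacent dyadic intervals, truncated at the end of
   the arc. *)
pose l := minn k.+2 (2 ^ n).
have tl : t' <= dy n l.
  rewrite /l; case: (leqP k.+2 (2 ^ n)%N) => h.
    by apply/ltW/(lt_le_trans tn); rewrite dyS lerD2r ltW.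
  by rewrite dy1; case/andP: t01'.
have ln : (l <= 2 ^ n)%N by rewrite geq_minr.
have [_ gk] := Ct n k kn; have [gl _] := Ct n l ln.
have [_ gk'] := Dt n k kn; have [gl' _] := Dt n l ln.
apply: (nP _ _ k l) => //.
- by rewrite ln andbT leq_min kn andbT -addn2 leq_addr.
- by rewrite geq_minl.
- exact: gk.
- by apply: gl; exact: le_trans tl.
- by apply: gk'; exact: le_trans tt.
- exact: gl'.
Qed.

Lemma at_param_uniq t C D : 0 <= t <= 1 -> T C -> T D ->
  at_param t C -> at_param t D -> C = D.
Proof.
move=> t01 tC tD rC rD; apply: hdist_eq0; apply/eqP; rewrite eq_le hdist_ge0 andbT.
apply/ler_addgt0Pr => e e0; rewrite add0r; apply: ltW.
have [d d0 dP] := at_param_cont e0; apply: (dP t t) => //.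
by rewrite subrr normr0.
Qed.

Lemma at_param_dyadic n k : (k <= 2 ^ n)%N -> at_param (dy n k) (G n k).
Proof.
move=> kn m j jm.
have h1 : dy n k = dy (n + m)%N (k * 2 ^ m) by rewrite dyn.
have h2 : dy m j = dy (n + m)%N (j * 2 ^ n) by rewrite addnC dyn.
have e1 : G n k = G (n + m)%N (k * 2 ^ m) by rewrite dyadic_pow.
have e2 : G m j = G (n + m)%N (j * 2 ^ n) by rewrite addnC dyadic_pow.
have b1 : (k * 2 ^ m <= 2 ^ (n + m))%N by rewrite expnD leq_mul.
have b2 : (j * 2 ^ n <= 2 ^ (n + m))%N by rewrite addnC expnD leq_mul.
by rewrite h1 h2 e1 e2 !dy_le; split => kj; apply: dyadic_mono; rewrite kj.
Qed.

(** Between two distinct parameters there are two consecutive dyadic points. [C] would lie below the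
    first and above the second, against the positive gap between them. *)
Lemma at_param_inj t t' C : 0 <= t <= 1 -> 0 <= t' <= 1 -> T C ->
  at_param t C -> at_param t' C -> t = t'.
Proof.
suff aux s s' : 0 <= s <= 1 -> 0 <= s' <= 1 -> T C ->
    at_param s C -> at_param s' C -> s' <= s.
  by move=> h1 h2 h3 h4 h5; apply/eqP; rewrite eq_le (aux t' t)// (aux t t').
move=> s01 s01' tC sC sC'; rewrite leNgt; apply/negP => ss.
have [n nP] : exists n, 2 * (2 ^+ n)^-1 < s' - s.
  have c0 : (fun n => (2^-1 : R) ^+ n) @ \oo --> (0 : R).
    by apply: cvg_expr; rewrite ger0_norm; lra.
  have e2 : 0 < (s' - s) / 2 by rewrite divr_gt0// subr_gt0.
  have /cvgrPdist_lt /(_ _ e2)[n _ /(_ n (leqnn _))] := c0.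
  rewrite sub0r normrN ger0_norm ?exprn_ge0// exprVn => h.
  by exists n; rewrite mulrC -ltr_pdivlMr.
have [k [kn k1 k2]] := fl n s01.
have k2s : dy n k.+2 < s' by rewrite !dyS; lra.
have k2n : (k.+2 <= 2 ^ n)%N.
  by rewrite -(dy_le n) dy1; case/andP: s01' => _; lra.
have [_ tk /andP[tk' _]] := @dyadic_step n k.+1 k2n.
have [/(_ (ltW k2)) h1 _] := sC n k.+1 (ltnW k2n).
have [_ /(_ (ltW k2s)) h2] := sC' n k.+2 k2n.
have tk1 : T (G n k.+1) by apply: dyadic_in; exact: ltnW.
have [h3 _] := tr tk tC tk1 h2 h1.
by rewrite /hle in h1 h2; rewrite (hzetaC (G n k.+1) (G n k.+2)) in h3; lra.
Qed.

(** For surjectivity, the image of the interval is compact, hence closed, and every point of [T]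
    lies in some gap of each generation, hence close to a dyadic point. *)
Lemma dyadic_arc : simple_arc P P' T.
Proof.
have /choice[g gP] : forall t : R, exists C, 0 <= t <= 1 -> T C /\ at_param t C.
  move=> t; have [t01|nt] := boolP (0 <= t <= 1).
    by have [C TC CP] := at_param_ex t01; exists C.
  by exists P.
have gT t : 0 <= t <= 1 -> T (g t) by move=> /gP[].
have gR t : 0 <= t <= 1 -> at_param t (g t) by move=> /gP[].
have i01 (x : R) : `[0, 1]%classic x = (0 <= x <= 1) :> Prop.
  by rewrite /= in_itv.
have gw : {within `[0, 1], continuous g}.
  apply/subspace_continuousP => t; rewrite i01 => t01 U /= /nbhs_hballP[e e0 eU].
  have [d d0 dP] := at_param_cont e0.
  change (\forall s \near t, `[0, 1]%classic s -> U (g s)).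
  near=> s; rewrite i01 => s01; apply: eU; rewrite /hball/=.
  have st : `|s - t| < d by rewrite distrC; near: s; exact: nbhsx_ballx.
  exact: (dP s t (g s) (g t) s01 t01 st (gT _ s01) (gT _ t01) (gR _ s01) (gR _ t01)).
exists g; split => //.
- move=> s t; rewrite !inE !i01 => s01 t01 gst.
  apply: (at_param_inj s01 t01 (gT _ s01)); first exact: gR.
  by rewrite gst; exact: gR.
- have d0 : dy 0 0 = 0 by rewrite /dy mul0r.
  have z01 : 0 <= (0 : R) <= 1 by rewrite lexx ler01.
  apply: (at_param_uniq z01 (gT _ z01) TP (gR _ z01)).
  by rewrite -d0; exact: (@at_param_dyadic 0 0).
- have d1 : dy 0 1 = 1 by rewrite /dy expr0 divr1.
  have z01 : 0 <= (1 : R) <= 1 by rewrite ler01 lexx.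
  apply: (at_param_uniq z01 (gT _ z01) TP' (gR _ z01)).
  by rewrite -d1; exact: (@at_param_dyadic 0 1).
- apply/seteqP; split => [C TC|_ [t +] <-]; last by rewrite i01; exact: gT.
  have hT : hausdorff_space (heis R).
    exact: norm_hausdorff.
  have cI : closed (g @` `[0, 1]).
    apply: compact_closed => //; apply: continuous_compact => //.
    exact: segment_compact.
  rewrite ((closure_id _).1 cI) => U /nbhs_hballP[e e0 eU].
  have [n nP] := dyadic_close e0.
  (* The largest index whose dyadic point is below [C]; since [hle] is total, [C] is below the next
     one. *)
  have [k [kn kC Ck]] : exists k, [/\ (k <= 2 ^ n)%N, hle (G n k) C & hle C (G n (minn k.+1 (2 ^ n)))].
    have ex0 : exists k, (k <= 2 ^ n)%N && hle (G n k) C.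
      exists 0%N; rewrite leq0n/=; have [+ _] := bnd TC.
      by have -> : G n 0 = P := dyadic_pow 0 n 0.
    have ub k : (k <= 2 ^ n)%N && hle (G n k) C -> (k <= 2 ^ n)%N by case/andP.
    case: (ex_maxnP ex0 ub) => k /andP[kn kC] kmax; exists k; split => //.
    have [kn'|] := leqP k.+1 (2 ^ n)%N.
      have [//|/ltW kC'] := hle_total C (G n k.+1).
      by have := kmax k.+1; rewrite kn' ltnn => /(_ kC').
    rewrite ltnS => nk; have [_ +] := bnd TC.
    have G1 : G n (2 ^ n)%N = P' by have := dyadic_pow 0 n 1; rewrite mul1n.
    by rewrite G1.
  have k01 := dy01 kn; exists (g (dy n k)); split.
    by exists (dy n k) => //; rewrite i01.
  have gk : g (dy n k) = G n k.
    by apply: (at_param_uniq k01 (gT _ k01) (dyadic_in kn) (gR _ k01)); exact: at_param_dyadic.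
  apply: eU; rewrite /hball/= gk; apply: (nP _ _ k (minn k.+1 (2 ^ n))) => //.
  - exact: dyadic_in.
  - by rewrite geq_minr andbT leq_min leqnSn.
  - by apply: leq_trans (geq_minl _ _) _; exact: leqnSn.
  - exact: hlexx.
  - by apply: dyadic_mono; rewrite geq_minr andbT leq_min leqnSn.
Unshelve. all: by end_near. Qed.

End DyadicArc.

(** * Level sets of almost projections *)

Lemma subr_shift (V : zmodType) (x y a q : V) : x - y = (x - a - q) - (y - a - q).
Proof. by rewrite [- (y - a - q)]opprB addrA subrK opprB addrA subrK. Qed.

Section AlmostProjection.
Context {R : realType}.
Implicit Types (A B C D P Q : heis R) (p q b : R * R).

(** The defect is exactly twice the area form of the two horizontal increments; it vanishes when one
    of them is zero. *)
Lemma hzeta_cocycle A B C :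
  `|hzeta A C - hzeta A B - hzeta B C| <= 2 * (enorm2 (B.1 - A.1) * enorm2 (C.1 - B.1)).
Proof.
have -> : hzeta A C - hzeta A B - hzeta B C =
    2 * ((C.1 - B.1).1 * (B.1 - A.1).2 - (B.1 - A.1).1 * (C.1 - B.1).2).
  by rewrite /hzeta/=; ring.
rewrite normrM ger0_norm// ler_wpM2l//.
exact: symplectic_le.
Qed.

Lemma hdistE A B : hdist A B = Num.max (enorm2 (B.1 - A.1)) (Num.sqrt `|hzeta A B|).
Proof.
rewrite hdistC /hdist /hrho /hzeta; congr (Num.max (enorm2 _) _).
by case: A B => [[? ?] ?] [[? ?] ?]; congr (_, _) => /=; rewrite addrC.
Qed.

Lemma hdist_le A B t : 0 <= t ->
  (hdist A B <= t) = (enorm2 (B.1 - A.1) <= t) && (`|hzeta A B| <= t ^+ 2).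
Proof.
move=> t0; rewrite hdistE ge_max; congr (_ && _).
by rewrite -(@ler_pXn2r _ 2)// ?nnegrE ?sqrtr_ge0// sqr_sqrtr.
Qed.

Lemma enorm2_hdist A B : enorm2 (B.1 - A.1) <= hdist A B.
Proof. by rewrite hdistE le_max lexx. Qed.

Lemma hzeta_hdist A B : `|hzeta A B| <= hdist A B ^+ 2.
Proof. by have := lexx (hdist A B); rewrite {1}hdist_le ?hdist_ge0// => /andP[]. Qed.

Lemma enorm2_dist p q : enorm2 (p - q) = enorm2 (q - p).
Proof. by rewrite -enorm2N opprB. Qed.

Lemma enorm2_continuous : continuous (@enorm2 R).
Proof.
move=> p; apply: (@continuous_comp _ _ _ (fun p : R * R => p.1 ^+ 2 + p.2 ^+ 2) Num.sqrt).
  apply: cvgD; rewrite expr2; apply: cvgM; (exact: cvg_fst || exact: cvg_snd).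
exact: sqrt_continuous.
Qed.

Variables (f : heis R -> R * R) (A0 : heis R) (r eta : R).
Hypothesis cf : continuous f.
Hypothesis eta0 : 0 < eta.
Hypothesis eta1 : eta <= 1 / 1000.
Hypothesis fpi : forall A B, hdist A A0 < r -> hdist B A0 < r ->
  enorm2 (f B - f A - (B.1 - A.1)) <= eta * hdist A B.

Let etaM x : 0 <= x -> eta * x <= x / 1000.
Proof. by move=> x0; apply: le_trans (ler_wpM2r x0 eta1) _; rewrite mul1r mulrC. Qed.

Let eta_sqr : eta * eta <= eta / 1000.
Proof. by apply: etaM; exact: ltW. Qed.

(* A nonzero minimum of [|f - b|] over the compact set [K] could be improved by moving
   horizontally by [b - f Q]. *)
Lemma newton P b : hdist P A0 + 2 * enorm2 (f P - b) < r ->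
  exists2 Q, f Q = b & hdist P Q <= 2 * enorm2 (f P - b).
Proof.
move=> Pr; pose g Q := enorm2 (f Q - b).
have cg : continuous g.
  move=> Q; apply: (@continuous_comp _ _ _ (fun Q => f Q - b) (@enorm2 R)).
    by apply: cvgB; [exact: cf|exact: cvg_cst].
  exact: enorm2_continuous.
(* The first condition gives compactness. In the second, the distance travelled is paid for by the
   decrease of [g]; a step of length [g Q] that nearly annihilates [g] respects this budget. *)
pose K := [set Q | hdist Q P <= 2 * g P] `&` [set Q | hdist Q P + 2 * g Q <= 2 * g P].
have cK : compact K.
  apply: compact_closedI; first exact: compact_hdist_le.
  rewrite (_ : [set _ | _] = (fun Q => hdist Q P + 2 * g Q) @^-1` [set x | x <= 2 * g P])//.
  apply: closed_comp (@closed_le _ _) => Q _; apply: cvgD; first exact: hdist_continuous.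
  by apply: cvgM; [exact: cvg_cst|exact: cg].
have g0 Q : 0 <= g Q by exact: enorm2_ge0.
have KP : K P by split => /=; rewrite hdistxx ?add0r// mulr_ge0.
have [||Q /set_mem[KQ1 KQ2] Qmin] := @compact_EVT_min _ _ g K _ cK.
- by exists P.
- exact: continuous_subspaceT.
rewrite /= in KQ1 KQ2.
exists Q; last by rewrite hdistC.
have QA0 : hdist Q A0 < r.
  by apply: le_lt_trans Pr; apply: le_trans (hdistD _ P _) _; rewrite addrC lerD2l.
apply/eqP; rewrite -subr_eq0; apply/eqP/enorm2_eq0/eqP; rewrite eq_le g0 andbT leNgt.
apply/negP => gQ.
pose Q' := hmul Q (b - f Q, 0).
have dQ : hdist Q Q' = g Q.
  by rewrite hdistC hdist_mulr /hrho/= normr0 sqrtr0 max_l ?enorm2_ge0// enorm2_dist.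
have gP2 : hdist Q P + g Q <= 2 * g P by have := g0 Q; lra.
have Q'A0 : hdist Q' A0 < r.
  apply: le_lt_trans Pr; apply: le_trans (hdistD _ P _) _; rewrite addrC lerD2l.
  apply: le_trans gP2; apply: le_trans (hdistD _ Q _) _.
  by rewrite (hdistC Q') dQ addrC.
have gQ' : g Q' <= eta * g Q.
  have := fpi QA0 Q'A0; rewrite dQ; congr (enorm2 _ <= _).
  rewrite (_ : Q'.1 - Q.1 = b - f Q); first by rewrite opprB addrA subrK.
  by rewrite /Q'; case: (Q) (b - f Q) => [[? ?] ?] [? ?]; congr (_, _) => /=; ring.
have KQ' : K Q'.
  have h1 : hdist Q' P <= hdist Q P + g Q.
    by apply: le_trans (hdistD _ Q _) _; rewrite (hdistC Q') dQ addrC.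
  split => /=; first exact: le_trans gP2.
  by have := etaM (g0 Q); have := g0 Q; lra.
have := Qmin Q'; rewrite inE => /(_ KQ').
by have := etaM (g0 Q); rewrite /g in gQ' *; lra.
Qed.

Lemma level_pi A B : hdist A A0 < r -> hdist B A0 < r -> f A = f B ->
  enorm2 (B.1 - A.1) <= eta * hdist A B.
Proof. by move=> Ar Br AB; have := fpi Ar Br; rewrite AB subrr sub0r enorm2N. Qed.

(** The horizontal displacement is at most eta times the distance, so the maximum that defines the
    distance is attained by the height. *)
Lemma level_dist A B : hdist A A0 < r -> hdist B A0 < r -> f A = f B ->
  hdist A B ^+ 2 = `|hzeta A B|.
Proof.
move=> Ar Br AB; have h1 := level_pi Ar Br AB.
apply/le_anti; rewrite hzeta_hdist andbT.
have -> : `|hzeta A B| = Num.sqrt `|hzeta A B| ^+ 2 by rewrite sqr_sqrtr.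
rewrite ler_pXn2r// ?nnegrE ?hdist_ge0 ?sqrtr_ge0//.
rewrite [leLHS]hdistE ge_max lexx andbT; apply: le_trans h1 _.
have h0 := hdist_ge0 A B; have hs := sqrtr_ge0 `|hzeta A B|.
have : hdist A B <= Num.sqrt `|hzeta A B| \/ hdist A B = enorm2 (B.1 - A.1).
  by rewrite hdistE; case: (leP (enorm2 (B.1 - A.1)) (Num.sqrt `|hzeta A B|)) => h; [left|right].
have ed := etaM h0; have h := level_pi Ar Br AB; move=> [h2|h2]; first by lra.
have -> : hdist A B = 0 by apply/le_anti; rewrite h0 andbT; lra.
by rewrite mulr0.
Qed.

(** For distances u and v the cocycle defect is at most 2 eta^2 uv, and 2uv <= u^2 + v^2 turns it
    into heights. *)
Lemma level_add A B C : hdist A A0 < r -> hdist B A0 < r -> hdist C A0 < r ->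
    f A = f B -> f B = f C ->
  `|hzeta A C - hzeta A B - hzeta B C| <= eta * (`|hzeta A B| + `|hzeta B C|).
Proof.
move=> Ar Br Cr AB BC; apply: le_trans (hzeta_cocycle _ _ _) _.
rewrite -(level_dist Ar Br AB) -(level_dist Br Cr BC).
have h1 := level_pi Ar Br AB; have h2 := level_pi Br Cr BC.
have := hdist_ge0 A B; have := hdist_ge0 B C.
have n1 := enorm2_ge0 (B.1 - A.1); have n2 := enorm2_ge0 (C.1 - B.1).
move: (hdist A B) (hdist B C) h1 h2 => u v h1 h2 v0 u0.
have : enorm2 (B.1 - A.1) * enorm2 (C.1 - B.1) <= (eta * u) * (eta * v) by rewrite ler_pM.
have := sqr_ge0 (u - v).
have : 0 <= u * v by rewrite mulr_ge0.
have e2 : eta * eta <= eta by have := eta_sqr; have := eta0; lra.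
move=> uv s1 s2.
have : eta * eta * (u * v) <= eta * (u * v) by rewrite ler_wpM2r.
have : eta * (2 * (u * v)) <= eta * (u ^+ 2 + v ^+ 2) by rewrite ler_pM2l//; lra.
lra.
Qed.

(* The midpoint is the point of the level set given by [newton] near the point at half
   the height of [D] above [C]. *)
Lemma level_mid C D : hdist C A0 + 4 * hdist C D < r -> f C = f D -> 0 < hzeta C D ->
  exists M, [/\ f M = f C, hdist C M <= 2 * hdist C D,
    0 < hzeta C M <= 3 / 4 * hzeta C D & 0 < hzeta M D <= 3 / 4 * hzeta C D].
Proof.
move=> Cr CD z0; have d0 := hdist_ge0 C D.
have CA0 : hdist C A0 < r by lra.
have DA0 : hdist D A0 < r.
  by have := hdistD D C A0; rewrite (hdistC D C); lra.
have dz := level_dist CA0 DA0 CD; rewrite ger0_norm ?ltW// in dz.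
set z := hzeta C D in z0 dz *; set d := hdist C D in Cr d0 dz *.
have dp : 0 < d by rewrite lt_neqAle d0 andbT; apply/eqP => d00; move: z0; rewrite -dz -d00 expr0n/= ltxx.
pose X := hmul C (0, z / 2).
have CX : hdist C X <= d.
  rewrite hdistC hdist_mulr hrho_le// /= enorm2_0 d0/= ger0_norm ?divr_ge0 ?ltW//.
  by rewrite dz; lra.
have XC1 : X.1 - C.1 = 0.
  by rewrite /X; case: (C) => [[? ?] ?]; congr (_, _) => /=; ring.
have XA0 : hdist X A0 < r by have := hdistD X C A0; rewrite (hdistC X C); lra.
have fX : enorm2 (f X - f C) <= eta * d.
  have := fpi CA0 XA0; rewrite XC1 subr0 => /le_trans; apply.
  by rewrite ler_pM2l.
have [|M fM XM] := @newton X (f C).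
  have := hdistD X C A0; rewrite (hdistC X C); have := etaM d0; lra.
have XM' : hdist X M <= 2 * eta * d by lra.
have CM : hdist C M <= 2 * d by have := hdistD C X M; have := etaM d0; lra.
have MA0 : hdist M A0 < r by have := hdistD M C A0; rewrite (hdistC M C); lra.
(* [X] lies vertically over [C], so height is exactly additive there; the correction from [X] to [M]
   enters only through the square of its length. *)
have zM : `|hzeta C M - z / 2| <= z / 100.
  have := hzeta_cocycle C X M; rewrite XC1 enorm2_0 mul0r mulr0.
  have -> : hzeta C X = z / 2 by rewrite /hzeta hmulKh.
  rewrite normr_le0 subr_eq0 => /eqP ->.
  apply: le_trans (hzeta_hdist _ _) _.
  have XM2 : hdist X M <= d / 10 by have := etaM d0; lra.
  rewrite expr2; apply: (@le_trans _ _ (d / 10 * (d / 10))); first by rewrite ler_pM ?hdist_ge0.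
  by rewrite -dz; lra.
move: zM; rewrite ler_norml => /andP[zM1 zM2].
have add := level_add CA0 MA0 DA0 (esym fM) (etrans fM CD).
rewrite -/z in add.
have zCM : 0 < hzeta C M by lra.
exists M; split => //; first by apply/andP; split => //; lra.
move: add; rewrite (ger0_norm (ltW zCM)) => add.
have ez : eta * (hzeta C M + `|hzeta M D|) <= (hzeta C M + `|hzeta M D|) / 1000.
  by apply: etaM; rewrite addr_ge0// ltW.
have {}add := le_trans add ez.
move: add; rewrite ler_norml => /andP[a1 a2].
have : hzeta M D <= `|hzeta M D| by exact: ler_norm.
have : - hzeta M D <= `|hzeta M D| by rewrite -normrN; exact: ler_norm.
have : `|hzeta M D| = hzeta M D \/ `|hzeta M D| = - hzeta M D.
  by case: (ger0P (hzeta M D)); [left|right].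
by move=> [E|E] b1 b2; rewrite E in a1 a2 b1 b2; apply/andP; clear - z0 zM1 zM2 a1 a2 b1 b2 cf eta0 eta1 fpi; split; lra.
Qed.

Definition level_itv P P' : set (heis R) :=
  [set C | [/\ hdist C A0 < r, f C = f P, hle P C & hle C P']].

Lemma level_itv_dist P P' C : hdist P A0 < r -> hdist P' A0 < r -> f P = f P' ->
  level_itv P P' C -> hdist P C <= 2 * hdist P P'.
Proof.
move=> Pr P'r PP' [Cr fC PC CP'].
have add := level_add Pr Cr P'r (esym fC) (etrans fC PP').
rewrite -(@ler_pXn2r _ 2)// ?nnegrE ?mulr_ge0 ?hdist_ge0//.
rewrite exprMn (level_dist Pr Cr) // (level_dist Pr P'r PP').
rewrite /hle in PC CP'; rewrite (ger0_norm PC) in add *.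
rewrite (ger0_norm CP') in add.
have := ler_norm (hzeta P P').
move: add; rewrite ler_norml => /andP[a1 a2].
have : eta * (hzeta P C + hzeta C P') <= (hzeta P C + hzeta C P') / 1000.
  by apply: etaM; exact: addr_ge0.
lra.
Qed.

(** With d = [hdist P P'], points of the interval are within 2d of [P] and 4d of each other, so
    [level_mid] asks for room 18d. By almost additivity the midpoints stay between [P] and [P']. *)
Lemma level_arc P P' : hdist P A0 + 32 * hdist P P' < r -> f P = f P' ->
  0 < hzeta P P' -> simple_arc P P' (level_itv P P').
Proof.
move=> Pr PP' z0; set d := hdist P P' in Pr.
have d0 : 0 <= d by exact: hdist_ge0.
have PA0 : hdist P A0 < r by lra.
have P'A0 : hdist P' A0 < r by have := hdistD P' P A0; rewrite (hdistC P' P) -/d; lra.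
set T := level_itv P P'.
have Td C : T C -> hdist P C <= 2 * d by exact: level_itv_dist.
have TA C : T C -> hdist C A0 < r by case.
have TfE C D : T C -> T D -> f C = f D by move=> [_ -> _ _] [_ -> _ _].
have tr C D E : T C -> T D -> T E -> hle C D -> hle D E ->
  hzeta C D + hzeta D E <= 2 * hzeta C E /\ hzeta C E <= 2 * (hzeta C D + hzeta D E).
  move=> tC tD tE CD DE.
  have := level_add (TA _ tC) (TA _ tD) (TA _ tE) (TfE _ _ tC tD) (TfE _ _ tD tE).
  rewrite /hle in CD DE; rewrite (ger0_norm CD) (ger0_norm DE) ler_norml => /andP[a1 a2].
  have : eta * (hzeta C D + hzeta D E) <= (hzeta C D + hzeta D E) / 1000.
    by apply: etaM; exact: addr_ge0.
  lra.
have TP : T P by split => //; [exact: hlexx|rewrite /hle ltW].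
have TP' : T P' by split => //; [rewrite /hle ltW|exact: hlexx].
have mid_ex C D : T C -> T D -> 0 < hzeta C D -> exists M,
    [/\ T M, 0 < hzeta C M <= 3 / 4 * hzeta C D & 0 < hzeta M D <= 3 / 4 * hzeta C D].
  move=> tC tD CD.
  have CD4 : hdist C D <= 4 * d.
    apply: le_trans (hdistD _ P _) _; rewrite (hdistC C).
    by have := Td _ tC; have := Td _ tD; lra.
  have CA : hdist C A0 <= hdist P A0 + 2 * d.
    by have := hdistD C P A0; have := Td _ tC; rewrite (hdistC C P); lra.
  have [|M [fM CM /andP[M1 M2] /andP[M3 M4]]] := level_mid _ (TfE _ _ tC tD) CD.
    by lra.
  have MA : hdist M A0 < r.
    by have := hdistD M C A0; rewrite (hdistC M C); lra.
  have [fC fD] : f C = f P /\ f D = f P by case: tC => _ -> _ _; case: tD => _ ->.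
  have PM : hle P M.
    have [_ _ PC _] := tC; have CM' : hle C M by exact: ltW.
    have := level_add PA0 (TA _ tC) MA (esym fC) (esym fM).
    rewrite /hle in PC CM' *; rewrite (ger0_norm PC) (ger0_norm CM').
    rewrite ler_norml => /andP[a1 _].
    by have := etaM (addr_ge0 PC CM'); lra.
  have MP' : hle M P'.
    have [_ _ _ DP'] := tD; have MD' : hle M D by exact: ltW.
    have := level_add MA (TA _ tD) P'A0 (etrans fM (TfE _ _ tC tD)) (etrans fD PP').
    rewrite /hle in DP' MD' *; rewrite (ger0_norm DP') (ger0_norm MD').
    rewrite ler_norml => /andP[a1 _].
    by have := etaM (addr_ge0 MD' DP'); lra.
  exists M; split; [|by rewrite M1|by rewrite M3].
  by split => //; rewrite fM.
have /choice[m mP] : forall x : heis R * heis R, exists M, T x.1 -> T x.2 -> 0 < hzeta x.1 x.2 ->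
    [/\ T M, 0 < hzeta x.1 M <= 3 / 4 * hzeta x.1 x.2 & 0 < hzeta M x.2 <= 3 / 4 * hzeta x.1 x.2].
  move=> [C D] /=; have [[tC [tD CD]]|n] := pselect (T C /\ T D /\ 0 < hzeta C D).
    by have [M HM] := mid_ex C D tC tD CD; exists M.
  by exists P => tC tD CD; exfalso; apply: n.
(* The open condition [hdist C A0 < r] becomes a closed bound on the distance to [P], which makes
   [T] compact. *)
have TE : T = [set C | hdist C P <= 2 * d] `&`
    ((f @^-1` [set f P] `&` [set C | hle P C]) `&` [set C | hle C P']).
  apply/seteqP; split => [C tC|C [/= CP [[fC PC] CP']]].
    by have [_ ? ? ?] := tC; split => //=; rewrite hdistC Td.
  by split => //; have := hdistD C P A0; lra.
apply: (@dyadic_arc _ T P P' (fun C D => m (C, D))) => //.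
- rewrite TE; apply: compact_closedI; first exact: compact_hdist_le.
  apply: closedI; last exact: closed_hlel.
  apply: closedI; last exact: closed_hle.
  apply: closed_comp; first by move=> x _; exact: cf.
  apply: compact_closed; first exact: norm_hausdorff.
  exact: compact_set1.
- by move=> C D tC tD; apply: level_dist; [exact: TA|exact: TA|exact: TfE].
- by move=> C [].
- by move=> C D; exact: (mP (C, D)).
Qed.

Lemma hdist_hmul A p t : hdist A (hmul A (p, t)) = hrho (p, t).
Proof. by rewrite hdistC hdist_mulr. Qed.

Lemma htileE A s B : htile A s B <->
  [/\ 0 <= (B.1 - A.1).1 < s, 0 <= (B.1 - A.1).2 < s & 0 <= hzeta A B < s ^+ 2].
Proof.
rewrite /htile/hcell/= !in_itv/= /hzeta/= [- A.1.1 + _]addrC [- A.1.2 + _]addrC.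
by split=> [[[]]|[]].
Qed.

(** The model point [X] has the wanted horizontal part and height, and [f X] misses [b] by 2 eta s.
    [newton] moves it by at most 4 eta s, which changes the height by 16 eta s^2 through the cocycle
    and 4 eta s^2 directly. *)
Lemma level_point A b s t : 0 < s -> hdist A A0 + 10 * s < r ->
    enorm2 (b - f A) <= 2 * s -> `|t| <= 4 * s ^+ 2 ->
  exists P, [/\ f P = b, enorm2 (P.1 - A.1 - (b - f A)) <= 4 * (eta * s),
    `|hzeta A P - t| <= 20 * (eta * s ^+ 2) & hdist A P <= 3 * s].
Proof.
move=> s0 Ar qs ts; set q := b - f A in qs *.
pose X := hmul A (q, t).
have s0' := ltW s0; have es := etaM s0'.
have AX : hdist A X <= 2 * s.
  by rewrite hdist_hmul hrho_le ?mulr_ge0// qs/= (le_trans ts)//; lra.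
have XA : X.1 - A.1 = q.
  by rewrite /X; case: (A) q {qs X AX} => [[? ?] ?] [? ?]; congr (_, _) => /=; ring.
have AA0 : hdist A A0 < r by lra.
have XA0 : hdist X A0 < r by have := hdistD X A A0; rewrite (hdistC X A); lra.
have fX : enorm2 (f X - b) <= 2 * (eta * s).
  have := fpi AA0 XA0; rewrite XA /q opprB addrA subrK => /le_trans; apply.
  by rewrite mulrCA ler_pM2l.
have [|P fP XP] := @newton X b.
  by have := hdistD X A A0; rewrite (hdistC X A); lra.
have XP' : hdist X P <= 4 * (eta * s) by lra.
have PX : enorm2 (P.1 - X.1) <= 4 * (eta * s) := le_trans (enorm2_hdist _ _) XP'.
have hc := hzeta_cocycle A X P.
have zX : hzeta A X = t by rewrite /hzeta hmulKh.
rewrite XA zX in hc.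
have h1 : enorm2 q * enorm2 (P.1 - X.1) <= (2 * s) * (4 * (eta * s)).
  by rewrite ler_pM ?enorm2_ge0.
have h2 : `|hzeta X P| <= s * (4 * (eta * s)).
  apply: le_trans (hzeta_hdist _ _) _; rewrite expr2 ler_pM ?hdist_ge0//; lra.
exists P; split => //.
- by rewrite -XA opprB addrA subrK.
- rewrite -[hzeta A P - t](subrK (hzeta X P)); apply: le_trans (ler_normD _ _) _; lra.
- by have := hdistD A X P; lra.
Qed.

(** 88 = 20 + 20 + 48: the two height errors and the cocycle defect 2 * 3s * 8 eta s. The room 200s
    covers 3s + 32 * 6s for [level_arc]. *)
Lemma level_pair A b s t t' : 0 < s -> hdist A A0 + 200 * s < r ->
    enorm2 (b - f A) <= 2 * s -> `|t| <= 4 * s ^+ 2 -> `|t'| <= 4 * s ^+ 2 ->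
    s ^+ 2 / 2 <= t' - t ->
  exists P P', [/\ f P = b /\ f P' = b,
    enorm2 (P.1 - A.1 - (b - f A)) <= 4 * (eta * s) /\
    enorm2 (P'.1 - A.1 - (b - f A)) <= 4 * (eta * s),
    `|hzeta A P - t| <= 20 * (eta * s ^+ 2) /\ `|hzeta A P' - t'| <= 20 * (eta * s ^+ 2),
    [/\ hdist A P <= 3 * s, hdist A P' <= 3 * s & hdist P A0 + 32 * hdist P P' < r] &
    0 < hzeta P P' /\ `|hdist P P' ^+ 2 - (t' - t)| <= 88 * (eta * s ^+ 2)].
Proof.
move=> s0 Ar qs ts ts' tt.
have s0' := ltW s0; have es := etaM s0'.
have Ar' : hdist A A0 + 10 * s < r by lra.
have [P [fP P1 P2 AP]] := level_point s0 Ar' qs ts.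
have [P' [fP' P1' P2' AP']] := level_point s0 Ar' qs ts'.
have PA0 : hdist P A0 <= hdist A A0 + 3 * s.
  by have := hdistD P A A0; rewrite (hdistC P A); clear - AP cf eta0 eta1 fpi; lra.
have P'A0 : hdist P' A0 <= hdist A A0 + 3 * s.
  by have := hdistD P' A A0; rewrite (hdistC P' A); clear - AP' cf eta0 eta1 fpi; lra.
have PP' : hdist P P' <= 6 * s.
  by have := hdistD P A P'; rewrite (hdistC P A); clear - AP AP' cf eta0 eta1 fpi; lra.
have n1 : enorm2 (P'.1 - P.1) <= 8 * (eta * s).
  rewrite (_ : P'.1 - P.1 = (P'.1 - A.1 - (b - f A)) - (P.1 - A.1 - (b - f A))).
    by apply: le_trans (enorm2D _ _) _; rewrite enorm2N; clear - P1 P1' cf eta0 eta1 fpi; lra.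
  exact: subr_shift.
have n2 : enorm2 (P.1 - A.1) <= 3 * s := le_trans (enorm2_hdist _ _) AP.
have h1 : enorm2 (P.1 - A.1) * enorm2 (P'.1 - P.1) <= (3 * s) * (8 * (eta * s)).
  by rewrite ler_pM ?enorm2_ge0.
have := hzeta_cocycle A P P'; move: (P2) (P2').
rewrite !ler_norml => /andP[a1 a2] /andP[b1 b2] /andP[c1 c2].
have es2 := etaM (sqr_ge0 s).
have s2 : 0 < s ^+ 2 by rewrite exprn_gt0.
have w0 : 0 <= eta * s ^+ 2 by rewrite mulr_ge0 ?sqr_ge0// ltW.
have z0 : 0 < hzeta P P' by clear - a1 a2 b1 b2 c1 c2 h1 tt s2 es2 cf eta0 eta1 fpi; lra.
have PA : hdist P A0 + 32 * hdist P P' < r by clear - PA0 PP' Ar s0 cf eta0 eta1 fpi; lra.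
have PA' : hdist P A0 < r by clear - PA0 Ar s0 cf eta0 eta1 fpi; lra.
have P'A' : hdist P' A0 < r by clear - P'A0 Ar s0 cf eta0 eta1 fpi; lra.
exists P, P'; do !split => //; rewrite (level_dist PA' P'A' (etrans fP (esym fP'))).
rewrite (ger0_norm (ltW z0)) ler_norml; apply/andP.
by clear - a1 a2 b1 b2 c1 c2 h1 w0 cf eta0 eta1 fpi; split; lra.
Qed.

Lemma tile_level_near A b s C : 0 < s -> hdist A A0 + 200 * s < r ->
  htile A s C -> f C = b -> enorm2 (C.1 - A.1 - (b - f A)) <= 2 * (eta * s).
Proof.
move=> s0 Ar AC fC; have CA := htile_near s0 AC.
have AA0 : hdist A A0 < r by lra.
have CA0 : hdist C A0 < r by have := hdistD C A A0; lra.
have := fpi AA0 CA0; rewrite fC -enorm2N opprB => /le_trans; apply.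
by rewrite hdistC mulrCA ler_pM2l.
Qed.

Lemma tile_level_value A b s C : 0 < s -> hdist A A0 + 200 * s < r ->
    htile A s C -> f C = b ->
  (- (2 * (eta * s)) <= (b - f A).1 <= s + 2 * (eta * s)) /\
  (- (2 * (eta * s)) <= (b - f A).2 <= s + 2 * (eta * s)).
Proof.
move=> s0 Ar AC fC; have h := tile_level_near s0 Ar AC fC.
have := le_trans (normr_fst_le _) h; have := le_trans (normr_snd_le _) h.
have /htileE[/andP[a1 a2] /andP[b1 b2] _] := AC.
rewrite /= !ler_norml => /andP[x1 x2] /andP[y1 y2]; rewrite /= in a1 a2 b1 b2 x1 x2 y1 y2 *.
have w0 : 0 < eta * s by rewrite mulr_gt0.
by clear - a1 a2 b1 b2 x1 x2 y1 y2 w0 cf eta0 eta1 fpi; split; apply/andP; split; lra.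
Qed.

Lemma tile_level_upper A b s C : 0 < s -> hdist A A0 + 200 * s < r ->
    htile A s C -> f C = b ->
  exists P P', [/\ f P = b, simple_arc P P' (level_itv P P'),
    hdist P P' ^+ 2 <= (1 + 500 * eta) * s ^+ 2 &
    htile A s `&` f @^-1` [set b] `<=` level_itv P P'].
Proof.
move=> s0 Ar AC fC.
have s0' := ltW s0; have es := etaM s0'.
have s2 : 0 < s ^+ 2 by rewrite exprn_gt0.
have es2 := etaM (ltW s2).
have w0 : 0 < eta * s ^+ 2 by rewrite mulr_gt0.
have qs : enorm2 (b - f A) <= 2 * s.
  have := tile_level_near s0 Ar AC fC; rewrite enorm2_dist => h1.
  have h2 : enorm2 (C.1 - A.1) <= 3 / 2 * s.
    have /htileE[/andP[a1 a2] /andP[b1 b2] _] := AC.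
    rewrite enorm2_le; last by clear - s0 cf eta0 eta1 fpi; lra.
    rewrite exprMn; clear - a1 a2 b1 b2 s0 cf eta0 eta1 fpi; nra.
  rewrite -[b - f A](subrK (C.1 - A.1)); apply: le_trans (enorm2D _ _) _; clear - h1 h2 es s0 cf eta0 eta1 fpi; lra.
(* The ends overshoot the tile by 80 eta s^2, more than the errors 20 + 36 in comparing heights, so
   every level point of the tile lies between them. *)
have [|||P [P' [[fP fP'] [P1 P1'] [P2 P2'] [AP AP' PA0] [z0 d2]]]] :=
  @level_pair A b s (- (80 * (eta * s ^+ 2))) (s ^+ 2 + 80 * (eta * s ^+ 2)) s0 Ar qs.
- by rewrite ler_norml; apply/andP; clear - w0 s2 es2 cf eta0 eta1 fpi; split; lra.
- by rewrite ler_norml; apply/andP; clear - w0 s2 es2 cf eta0 eta1 fpi; split; lra.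
- by clear - w0 s2 cf eta0 eta1 fpi; lra.
have PA : hdist P A0 < r by have := hdist_ge0 P P'; clear - PA0 cf eta0 eta1 fpi; lra.
exists P, P'; split => //.
- by apply: level_arc => //; rewrite fP.
- by move: d2; rewrite ler_norml => /andP[_ d2]; clear - d2 w0 cf eta0 eta1 fpi; lra.
move=> C' [AC' /= fC'].
have c1 := tile_level_near s0 Ar AC' fC'.
have CA0 : hdist C' A0 < r.
  by have := hdistD C' A A0; have := htile_near s0 AC'; clear - Ar s0 cf eta0 eta1 fpi; lra.
have nb Q : enorm2 (Q.1 - A.1 - (b - f A)) <= 4 * (eta * s) -> hdist A Q <= 3 * s ->
    `|hzeta A C' - hzeta A Q - hzeta Q C'| <= 36 * (eta * s ^+ 2).
  move=> Q1 AQ; apply: le_trans (hzeta_cocycle _ _ _) _.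
  have n1 : enorm2 (C'.1 - Q.1) <= 6 * (eta * s).
    rewrite (subr_shift _ _ A.1 (b - f A)).
    by apply: le_trans (enorm2D _ _) _; rewrite enorm2N; clear - c1 Q1 cf eta0 eta1 fpi; lra.
  have n2 : enorm2 (Q.1 - A.1) <= 3 * s := le_trans (enorm2_hdist _ _) AQ.
  have : enorm2 (Q.1 - A.1) * enorm2 (C'.1 - Q.1) <= (3 * s) * (6 * (eta * s)).
    by rewrite ler_pM ?enorm2_ge0.
  by clear - cf eta0 eta1 fpi; lra.
have := nb P P1 AP; have := nb P' P1' AP'; move: P2 P2'.
rewrite !ler_norml => /andP[x1 x2] /andP[y1 y2] /andP[z1 z2] /andP[t1 t2].
have /htileE[_ _ /andP[u1 u2]] := AC'.
split => //; first by rewrite fP.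
  by rewrite /hle; clear - x1 x2 y1 y2 z1 z2 t1 t2 u1 u2 w0 cf eta0 eta1 fpi; lra.
by rewrite /hle hzetaC; clear - x1 x2 y1 y2 z1 z2 t1 t2 u1 u2 w0 cf eta0 eta1 fpi; lra.
Qed.

Lemma tile_level_lower A b s : 0 < s -> hdist A A0 + 200 * s < r ->
    20 * (eta * s) <= (b - f A).1 <= s - 20 * (eta * s) ->
    20 * (eta * s) <= (b - f A).2 <= s - 20 * (eta * s) ->
  exists P P', [/\ f P = b, simple_arc P P' (level_itv P P'),
    (1 - 500 * eta) * s ^+ 2 <= hdist P P' ^+ 2 &
    level_itv P P' `<=` htile A s `&` f @^-1` [set b]].
Proof.
move=> s0 Ar /andP[q1 q2] /andP[q3 q4].
have s0' := ltW s0; have es := etaM s0'.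
have s2 : 0 < s ^+ 2 by rewrite exprn_gt0.
have es2 := etaM (ltW s2).
have w0 : 0 < eta * s ^+ 2 by rewrite mulr_gt0.
have w1 : 0 < eta * s by rewrite mulr_gt0.
have qs : enorm2 (b - f A) <= 2 * s.
  by apply: le_trans (enorm2_le_sum _) _; rewrite !ger0_norm; clear - q1 q2 q3 q4 w1 cf eta0 eta1 fpi; lra.
(* The ends stop short of the tile's height by 200 eta s^2, more than the errors 20 + 114.
   Horizontally the arc deviates from [b - f A] by at most 15 eta s, within the assumed margin of 20
   eta s. *)
have [|||P [P' [[fP fP'] [P1 P1'] [P2 P2'] [AP AP' PA0] [z0 d2]]]] :=
  @level_pair A b s (200 * (eta * s ^+ 2)) (s ^+ 2 - 200 * (eta * s ^+ 2)) s0 Ar qs.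
- by rewrite ler_norml; apply/andP; clear - w0 s2 es2 cf eta0 eta1 fpi; split; lra.
- by rewrite ler_norml; apply/andP; clear - w0 s2 es2 cf eta0 eta1 fpi; split; lra.
- by clear - s2 es2 cf eta0 eta1 fpi; lra.
have PA : hdist P A0 < r by have := hdist_ge0 P P'; clear - PA0 cf eta0 eta1 fpi; lra.
have P'A : hdist P' A0 < r.
  by have := hdist_ge0 P P'; have := hdistD P' P A0; rewrite (hdistC P' P); clear - PA0 cf eta0 eta1 fpi; lra.
exists P, P'; split => //.
- by apply: level_arc => //; rewrite fP.
- by move: d2; rewrite ler_norml => /andP[d2 _]; clear - d2 w0 cf eta0 eta1 fpi; lra.
move=> C PC; have fPP' : f P = f P' by rewrite fP.
have PCd := level_itv_dist PA P'A fPP' PC.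
have [CA0 fC lPC lCP'] := PC.
have PP6 : hdist P P' <= 6 * s by have := hdistD P A P'; rewrite (hdistC P A); clear - AP AP' cf eta0 eta1 fpi; lra.
have AC : hdist A C <= 15 * s by have := hdistD A P C; clear - AP PP6 PCd cf eta0 eta1 fpi; lra.
have AA0 : hdist A A0 < r by clear - Ar s0 cf eta0 eta1 fpi; lra.
have c1 : enorm2 (C.1 - A.1 - (b - f A)) <= 15 * (eta * s).
  have := fpi AA0 CA0; rewrite fC fP -enorm2N opprB => /le_trans; apply.
  by rewrite mulrCA ler_pM2l.
have nb Q : enorm2 (Q.1 - A.1 - (b - f A)) <= 4 * (eta * s) -> hdist A Q <= 3 * s ->
    `|hzeta A C - hzeta A Q - hzeta Q C| <= 114 * (eta * s ^+ 2).
  move=> Q1 AQ; apply: le_trans (hzeta_cocycle _ _ _) _.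
  have n1 : enorm2 (C.1 - Q.1) <= 19 * (eta * s).
    rewrite (subr_shift _ _ A.1 (b - f A)).
    by apply: le_trans (enorm2D _ _) _; rewrite enorm2N; clear - c1 Q1 cf eta0 eta1 fpi; lra.
  have n2 : enorm2 (Q.1 - A.1) <= 3 * s := le_trans (enorm2_hdist _ _) AQ.
  have : enorm2 (Q.1 - A.1) * enorm2 (C.1 - Q.1) <= (3 * s) * (19 * (eta * s)).
    by rewrite ler_pM ?enorm2_ge0.
  by clear - cf eta0 eta1 fpi; lra.
split; last by rewrite /= fC.
apply/htileE; split.
- have := le_trans (normr_fst_le _) c1; rewrite ler_norml /= => /andP[x1 x2].
  by rewrite /= in q1 q2 x1 x2 *; apply/andP; clear - q1 q2 x1 x2 w1 cf eta0 eta1 fpi; split; lra.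
- have := le_trans (normr_snd_le _) c1; rewrite ler_norml /= => /andP[x1 x2].
  by rewrite /= in q3 q4 x1 x2 *; apply/andP; clear - q3 q4 x1 x2 w1 cf eta0 eta1 fpi; split; lra.
- have := nb P P1 AP; have := nb P' P1' AP'; move: P2 P2'.
  rewrite !ler_norml => /andP[x1 x2] /andP[y1 y2] /andP[z1 z2] /andP[t1 t2].
  rewrite /hle (hzetaC P' C) in lPC lCP'; apply/andP.
  by clear - x1 x2 y1 y2 z1 z2 t1 t2 lPC lCP' w0 cf eta0 eta1 fpi; split; lra.
Qed.

End AlmostProjection.

(** * Measurability of the level integrand *)

Section LevelMeasurability.
Context {R : realType}.
Local Notation H2 := (hausdorff (@hdist R) 2).
Local Open Scope ereal_scope.

Lemma ediam_open_enlarge (C : set (heis R)) (e e' del : R) :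
    ediam hdist C <= e%:E -> (e < e')%R -> (0 < del)%R ->
  exists U, [/\ open U, C `<=` U, ediam hdist U <= e'%:E &
    ediam hdist U ^+ 2 <= ediam hdist C ^+ 2 + del%:E].
Proof.
move=> Ce ee' del0.
have Cfin : ediam hdist C \is a fin_num.
  by rewrite ge0_fin_numE ?ediam_ge0// (le_lt_trans Ce)// ltry.
have [x xE] : exists x, ediam hdist C = x%:E by exists (fine (ediam hdist C)); rewrite fineK.
have x0 : (0 <= x)%R by rewrite -lee_fin -xE ediam_ge0.
have xe : (x <= e)%R by rewrite -lee_fin -xE.
(* Enlarging by [rho] adds 4 rho x + 4 rho^2 to the squared diameter, at most rho (4e + 4) as x <= e
   and rho <= 1. *)
pose rho : R := Num.min 1%R (Num.min (del / (4 * e + 4)) ((e' - e) / 2))%R.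
have e4 : (0 < 4 * e + 4)%R by lra.
have rho0 : (0 < rho)%R.
  by rewrite !lt_min ltr01/= !divr_gt0// subr_gt0.
have [rho1 rho2 rho3] : [/\ rho <= 1, rho * (4 * e + 4) <= del & 2 * rho <= e' - e]%R.
  split; first by rewrite ge_min lexx.
    by rewrite -ler_pdivlMr// !ge_min lexx orbT.
  rewrite mulrC -ler_pdivlMr// !ge_min lexx; by rewrite !orbT.
have Ud : ediam hdist (\bigcup_(c in C) hball c rho) <= (x + 2 * rho)%:E.
  apply: ediam_le; first by rewrite addr_ge0// mulr_ge0// ltW.
  move=> u v [c Cc uc] [c' Cc' vc']; rewrite /hball/= in uc vc'.
  have := @dist_le_ediam _ _ hdist _ _ _ Cc Cc'; rewrite xE lee_fin.
  have := hdistD u c v; have := hdistD c c' v; rewrite (hdistC c' v); lra.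
exists (\bigcup_(c in C) hball c rho); split.
- by apply: bigcup_open => c _; exact: open_hball.
- by move=> c Cc; exists c => //; rewrite /hball/= hdistxx.
- by apply: le_trans Ud _; rewrite lee_fin; lra.
- rewrite xE; apply: (@le_trans _ _ ((x + 2 * rho)%:E ^+ 2)).
    by apply: lee_expe => //; exact: ediam_ge0.
  by rewrite -!EFin_expe -EFinD lee_fin; nra.
Qed.

(* Enlarging an almost optimal cover to an open one catches the nearby level sets. *)
Lemma hausdorff_pre_level_near (F : heis R -> R * R) (K : set (heis R)) (a : R * R)
    (e e' t : R) : continuous F -> compact K -> (e < e')%R ->
    hausdorff_pre hdist 2 e (F @^-1` [set a] `&` K) < t%:E ->
  \forall b \near a, hausdorff_pre hdist 2 e' (F @^-1` [set b] `&` K) < t%:E.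
Proof.
move=> cF cK ee' /ereal_inf_lt[_ [C [FC Ce] <-]] Ct.
set s := \sum_(_ <= _ <oo) _ in Ct.
have s0 : 0 <= s by apply: nneseries_ge0 => n _ _; rewrite expe_ge0// ediam_ge0.
have [x xE] : exists x, s = x%:E.
  by exists (fine s); rewrite fineK// ge0_fin_numE// (lt_trans Ct)// ltry.
have xt : (x < t)%R by rewrite -lte_fin -xE.
pose del : R := ((t - x) / 2)%R.
have del0 : (0 < del)%R by rewrite divr_gt0// subr_gt0.
have /choice[U UP] : forall i, exists U, [/\ open U, C i `<=` U, ediam hdist U <= e'%:E &
    ediam hdist U ^+ 2 <= ediam hdist (C i) ^+ 2 + (del / (2 ^ i.+1)%:R)%:E].
  move=> i; apply: ediam_open_enlarge (Ce i) ee' _.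
  by rewrite divr_gt0// ltr0n expn_gt0.
have oU : open (\bigcup_i U i) by apply: bigcup_open => i _; have [] := UP i.
(* The values of [F] on the part of [K] outside the open cover form a compact set missing [a];
   levels off this set meet [K] only inside the cover. *)
have cI : compact (F @` (K `&` ~` \bigcup_i U i)).
  apply: continuous_compact; first exact: continuous_subspaceT.
  by apply: compact_closedI => //; exact: open_closedC.
have clI : closed (F @` (K `&` ~` \bigcup_i U i)).
  by apply: compact_closed => //; exact: norm_hausdorff.
have : nbhs a (~` (F @` (K `&` ~` \bigcup_i U i))).
  apply: open_nbhs_nbhs; split; first exact: closed_openC.
  move=> [B [KB nUB] FB]; apply: nUB.
  have [|i _ CiB] := FC B; first by split.
  by exists i => //; have [_ + _ _] := UP i; apply.
apply: filterS => b nb.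
apply: (@le_lt_trans _ _ (s + del%:E)); last first.
  by rewrite xE -EFinD lte_fin /del; lra.
apply: (@le_trans _ _ (\sum_(0 <= i <oo) ediam hdist (U i) ^+ 2)).
  apply: ereal_inf_lbound; exists U => //; split; last by move=> i; have [] := UP i.
  move=> B [/= FB KB]; apply: contrapT => nUB; apply: nb; exists B => //.
apply: le_trans (epsilon_trick xpredT _ (ltW del0)).
  by apply: lee_nneseries => i _ *; [rewrite expe_ge0// ediam_ge0|have [] := UP i].
by move=> i; rewrite expe_ge0// ediam_ge0.
Qed.

(** Section at height 0 of the open cylinder over [U]. *)
Lemma open_measurable2 (U : set (R * R)) : open U -> measurable U.
Proof.
move=> oU.
rewrite (_ : U = ysection (fst @^-1` U : set (heis R)) 0%R); last first.
  by apply/seteqP; split => p; rewrite /ysection /= inE.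
apply: measurable_ysection; apply: heis_open_measurable.
by apply: open_comp => // x _; exact: cvg_fst.
Qed.

(** Up to a small change of mesh the pre-measures are upper semicontinuous in the level, so each
    sublevel set of H^2 is a countable intersection of open sets. *)
Lemma measurable_hausdorff_level_compact (F : heis R -> R * R) (K : set (heis R)) :
    continuous F -> compact K ->
  measurable_fun setT (fun a : R * R => H2 (F @^-1` [set a] `&` K)).
Proof.
move=> cF cK.
pose h (a : R * R) := H2 (F @^-1` [set a] `&` K); rewrite -/h.
pose V (r : R) (n m : nat) : set (R * R) :=
  interior [set a | hausdorff_pre hdist 2 n.+1%:R^-1 (F @^-1` [set a] `&` K) < (r + m.+1%:R^-1)%:E].
have hV r : [set a | h a <= r%:E] = \bigcap_n \bigcap_m V r n m.
  apply/seteqP; split => [a /= ha n _ m _|a aV /=].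
    apply: (@hausdorff_pre_level_near F K a n.+2%:R^-1) => //.
      by rewrite ltf_pV2 ?posrE// ltr_nat.
    apply: le_lt_trans (hausdorff_pre_le _ _ _ _) _ => //.
    by apply: le_lt_trans ha _; rewrite lte_fin ltrDl.
  apply: hausdorff_le => e e0.
  have [n] := ltr_add_invr e0; rewrite add0r => /ltW ne.
  apply: le_trans (hausdorff_pre_antitone _ _ _ ne) _.
  apply/lee_addgt0Pr => d d0.
  have [m] := ltr_add_invr d0; rewrite add0r => md.
  have /interior_subset/= := aV n I m I => /ltW/le_trans; apply.
  by rewrite -EFinD lee_fin lerD2l ltW.
apply: (measurability _ (ErealGenOInfty.measurableE R)) => _ [_ [r ->] <-].
rewrite setTI (_ : h @^-1` _ = ~` [set a | h a <= r%:E]).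
  apply: measurableC; rewrite hV; apply: bigcapT_measurable => n; apply: bigcapT_measurable => m.
  by apply: open_measurable2; exact: open_interior.
by apply/seteqP; split => a /=; rewrite in_itv/= andbT ltNge => /negP.
Qed.

Lemma hausdorff_level_compact_fin (F : heis R -> R * R) (K : set (heis R)) (a : R * R) :
    compact K ->
    (forall A : heis R, exists2 r : R, (0 < r)%R & H2 (F @^-1` [set a] `&` hball A r) < +oo) ->
  H2 (F @^-1` [set a] `&` K) < +oo.
Proof.
move=> cK Kfin.
have /choice[r rP] : forall A, exists r : R, (0 < r)%R /\ H2 (F @^-1` [set a] `&` hball A r) < +oo.
  by move=> A; have [r r0 rA] := Kfin A; exists r.
(* The filter of finite lists directed by inclusion: compactness as a near covering along it yields
   a finite subcover. *)
pose G := [set U : set (seq (heis R)) | exists s0 : seq (heis R), forall s : seq (heis R), {subset s0 <= s} -> U s].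
have fG : Filter (G : set_system (seq (heis R))).
  split => [|U V [s UP] [s' VP]|U V UV [s UP]]; first by exists [::].
  - exists (s ++ s') => t st; split; [apply: UP => x xs|apply: VP => x xs];
      by apply: st; rewrite mem_cat xs ?orbT.
  - by exists s => t /UP; exact: UV.
have [|s0 /(_ s0 (fun=> id)) KD] := (compact_near_coveringP K).1 cK _ G
    (fun s B => exists2 A, A \in s & hball A (r A) B) fG.
  move=> A KA; exists (hball A (r A), [set s : seq (heis R) | (A : heis R) \in s]).
    split; first by apply: nbhs_hball; have [] := rP A.
    by exists [:: (A : heis R)] => s; apply; rewrite mem_head.
  by move=> [B s] [/= AB As]; exists A.
have fin (s : seq (heis R)) :
    H2 (F @^-1` [set a] `&` [set B | exists2 A, A \in s & hball A (r A) B]) < +oo.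
  elim: s => [|A s IH].
    rewrite (_ : _ `&` _ = set0) ?hausdorff0//.
    by apply/seteqP; split => // B [_ [A]]; rewrite in_nil.
  apply: (@le_lt_trans _ _ (H2 ((F @^-1` [set a] `&` hball A (r A)) `|`
      (F @^-1` [set a] `&` [set B | exists2 A, A \in s & hball A (r A) B])))).
    apply: le_hausdorff => B [FB [A']]; rewrite in_cons => /orP[/eqP-> A'B|A's A'B].
      by left.
    by right; split => //; exists A'.
  apply: le_lt_trans (outer_measureU2 _ _ _) _.
  by apply: lte_add_pinfty => //; have [] := rP A.
by apply: le_lt_trans (fin s0); apply: le_hausdorff; exact: setIS.
Qed.

Lemma closed_level (F : heis R -> R * R) (a : R * R) : continuous F ->
  closed (F @^-1` [set a]).
Proof.
move=> cF; apply: closed_comp; first by move=> x _; exact: cF.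
apply: compact_closed; first exact: norm_hausdorff.
exact: compact_set1.
Qed.

Lemma heis_closed_measurable (C : set (heis R)) : closed C -> measurable C.
Proof.
by move=> cC; rewrite -[C]setCK; apply: measurableC; apply: heis_open_measurable; exact: closed_openC.
Qed.

(** Dynkin's theorem, starting from closed sets. Finiteness on [K] lets the measure of a difference
    be a difference of measures. *)
Lemma measurable_hausdorff_level_fin (F : heis R -> R * R) (K E : set (heis R)) :
    continuous F -> compact K -> (forall a, H2 (F @^-1` [set a] `&` K) < +oo) -> measurable E ->
  measurable_fun setT (fun a : R * R => H2 (F @^-1` [set a] `&` (K `&` E))).
Proof.
move=> cF cK Kfin mE.
have clK : closed K.
  apply: compact_closed => //; exact: norm_hausdorff.
have mK := heis_closed_measurable clK.
have mL a := heis_closed_measurable (@closed_level F a cF).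
pose M := [set E : set (heis R) | measurable E /\
  measurable_fun setT (fun a : R * R => H2 (F @^-1` [set a] `&` (K `&` E)))].
suff : <<s @closed (heis R) >> `<=` M.
  move=> cM; apply: (cM _ _).2.
  have : <<s @open (heis R) >> E by rewrite -heis_measurableE.
  apply: smallest_sub; first exact: smallest_sigma_algebra.
  move=> U oU; rewrite -[U]setCK -setTD; apply: sigma_algebraCD.
  by apply: sub_sigma_algebra; exact: open_closedC.
apply: lambda_system_subset => //.
- by move=> A B; exact: closedI.
- split.
  + by [].
  + split => //; rewrite setIT; exact: measurable_hausdorff_level_compact.
  + move=> A B BA [mA mfA] [mB mfB]; split; first exact: measurableD.
    rewrite (_ : (fun a => _) = (fun a => H2 (F @^-1` [set a] `&` (K `&` A)) -
        H2 (F @^-1` [set a] `&` (K `&` B)))).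
      exact: emeasurable_funB.
    apply/funext => a.
    rewrite (_ : _ `&` (_ `&` (_ `\` _)) =
       (F @^-1` [set a] `&` (K `&` A)) `\` (F @^-1` [set a] `&` (K `&` B))); last first.
      apply/seteqP; split => [x [Fx [Kx [Ax nBx]]]|x [[Fx [Kx Ax]] nBx]].
        by split => // -[_ []].
      by split => //; split => //; split => // Bx; apply: nBx.
    rewrite measureD//=; last 3 first.
    * by apply: measurableI => //; exact: measurableI.
    * by apply: measurableI => //; exact: measurableI.
    * apply: le_lt_trans (Kfin a); apply: le_hausdorff => x [Fx [Kx _]] //.
    by congr (_ - H2 _); apply/seteqP; split => [x []//|x [Fx [Kx Bx]]]; split => //; split => //; split => //; exact: BA.
  + move=> A ndA mA; split; first by apply: bigcupT_measurable => i; have [] := mA i.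
    apply: (emeasurable_fun_cvg (fun i a => H2 (F @^-1` [set a] `&` (K `&` A i)))) => [i|a _].
      by have [] := mA i.
    rewrite !setI_bigcupr; apply: nondecreasing_cvg_mu.
    * move=> i; apply: measurableI => //; apply: measurableI => //; by have [] := mA i.
    * apply: bigcupT_measurable => i; apply: measurableI => //; apply: measurableI => //; by have [] := mA i.
    * move=> n m nm; apply/subsetPset; apply: setIS; apply: setIS; apply/subsetPset; exact: ndA.
- move=> C cC; split; first exact: heis_closed_measurable.
  by apply: measurable_hausdorff_level_compact => //; exact: compact_closedI.
Qed.

Lemma measurable_hausdorff_level (F : heis R -> R * R) (E : set (heis R)) :
    continuous F ->
    (forall a (A : heis R), exists2 r : R, (0 < r)%R & H2 (F @^-1` [set a] `&` hball A r) < +oo) ->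
    measurable E ->
  measurable_fun setT (fun a : R * R => H2 (F @^-1` [set a] `&` E)).
Proof.
move=> cF Ffin mE.
pose K (n : nat) := [set B : heis R | (hdist B 0%R <= n%:R)%R].
have cK n : compact (K n) by exact: compact_hdist_le.
have mK n : measurable (K n) by apply: heis_closed_measurable; exact: closed_hdist_le.
have EE : E = \bigcup_n (K n `&` E).
  rewrite -setI_bigcupl (_ : \bigcup_n K n = setT) ?setTI//.
  apply/seteqP; split => // B _; exists (Num.truncn (hdist B 0%R)).+1 => //.
  by rewrite /K/=; apply: ltW; rewrite truncnS_gt.
have mL a := heis_closed_measurable (@closed_level F a cF).
apply: (emeasurable_fun_cvg (fun i a => H2 (F @^-1` [set a] `&` (K i `&` E)))) => [i|a _].
  apply: measurable_hausdorff_level_fin => // a; exact: hausdorff_level_compact_fin.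
rewrite [in X in _ --> X]EE setI_bigcupr; apply: nondecreasing_cvg_mu.
- by move=> i; apply: measurableI => //; exact: measurableI.
- by apply: bigcupT_measurable => i; apply: measurableI => //; exact: measurableI.
- move=> n m nm; apply/subsetPset; apply: setIS; apply: setSI => B /= /le_trans; apply.
  by rewrite ler_nat.
Qed.

End LevelMeasurability.

(** * The area formula *)

Section TileComparisonLocal.
Context {R : realType}.
Local Open Scope ereal_scope.

(* [200] is the room that the tile estimates below need. *)
Lemma tile_le_local (lam mu : {measure set (heis R) -> \bar R}) :
    (forall (A0 : heis R) (e : R), (0 < e)%R -> exists2 r : R, (0 < r)%R &
      forall A s, (0 < s)%R -> (hdist A A0 + 200 * s < r)%R ->
        lam (htile A s) <= mu (htile A s) + (e * s ^+ 4)%:E) ->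
  tile_le lam mu.
Proof.
move=> loc M e e0.
pose P (s : R) (A : heis R) := (0 < s)%R ->
  lam (htile A s) <= mu (htile A s) + (e * s ^+ 4)%:E.
(* Compactness as a near covering, with the mesh near 0 as parameter, gives one mesh bound for the
   whole ball. *)
have [A0 _|d /= d0 dP] := (compact_near_coveringP _).1 (@compact_hdist_le R 0%R M) R
    (nbhs (0%R : R)) P _.
  have [r r0 rP] := loc A0 e e0.
  exists (hball A0 (r / 2), [set s : R | (`|s| < r / 400)%R]).
    split; first by apply: nbhs_hball; rewrite divr_gt0.
    have r400 : (0 < r / 400)%R by lra.
    by have : \forall t \near (0%R : R), (`|t| < r / 400)%R by exact: nbhs0_lt.
  move=> [A s] [/= AA0 sr] s0; apply: rP => //.
  by rewrite /hball/= in AA0; rewrite gtr0_norm// in sr; lra.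
exists d => // s A /andP[s0 sd] AM; apply: dP => //.
by rewrite /ball_/= sub0r normrN gtr0_norm.
Qed.

Lemma heis_continuous_measurable_real (f : heis R -> R) : continuous f ->
  measurable_fun setT f.
Proof.
move=> /continuousP cf.
apply: (measurability (@RGenOpens.G R)); first exact: RGenOpens.measurableE.
move=> _ [_ [x [y ->]] <-]; rewrite setTI.
by apply: heis_open_measurable; apply: cf; exact: interval_open.
Qed.

End TileComparisonLocal.

(** The factors are the errors from Ahlfors regularity, from the squared chord of the arc, and from
    the side of the square of levels, with margins 20hs and 2hs at each end. *)
Lemma tile_constants (R : realType) (h : R) : 0 <= h -> h <= 1 / 1000 ->
  (1 - 600 * h <= (1 - h) * (1 - 500 * h) * (1 - 40 * h) ^+ 2) /\
  ((1 + h) * (1 + 500 * h) * (1 + 4 * h) ^+ 2 <= 1 + 600 * h).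
Proof.
move=> h0 h1.
have k1 : 1 - 501 * h <= (1 - h) * (1 - 500 * h) by nra.
have k2 : 1 - 80 * h <= (1 - 40 * h) ^+ 2 by nra.
have k3 : (1 + h) * (1 + 500 * h) <= 1 + 502 * h by nra.
have k4 : (1 + 4 * h) ^+ 2 <= 1 + 9 * h by nra.
have p1 : 0 <= 1 - 501 * h by lra.
have p2 : 0 <= 1 - 80 * h by lra.
have p3 : 0 <= 1 + h by lra.
have p4 : 0 <= 1 + 500 * h by lra.
split.
  by apply: (le_trans _ (ler_pM p1 p2 k1 k2)); nra.
by apply: (le_trans (ler_pM (mulr_ge0 p3 p4) (sqr_ge0 _) k3 k4)); nra.
Qed.

(** * Both sides of the area formula on small tiles *)

Section LevelTiles.
Context {R : realType}.
Local Notation H2 := (hausdorff (@hdist R) 2).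
Local Notation H4 := (hausdorff (@hdist R) 4).
Local Open Scope ereal_scope.
Local Notation leb2 := (lebesgue_measure \x lebesgue_measure : set (R * R) -> \bar R).

Variable F : heis R -> R * R.
Hypothesis CF : C1H F.
Hypothesis D0 : forall A : heis R, det2 (dh F A) != 0%R.
Hypothesis EA : equi_strongly_Ahlfors_regular F.

Lemma simple_arc_ends (A B : heis R) S : simple_arc A B S -> S A /\ S B.
Proof.
move=> [g [_ _ <- <- ->]]; split; [exists 0%R|exists 1%R] => //=;
  by rewrite in_itv/= lexx ler01.
Qed.

(** Near [A0] the levels, the arcs and the distances of endpoints are all bounded as the hypothesis
    demands, so one radius serves all arcs. *)
Lemma ahlfors_local (A0 : heis R) (e : R) : (0 < e)%R -> exists2 r : R, (0 < r)%R &
  forall a A B S, simple_arc A B S -> S `<=` hball A0 r `&` F @^-1` [set a] ->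
    ((1 - e) * hdist A B ^+ 2)%:E <= H2 S <= ((1 + e) * hdist A B ^+ 2)%:E.
Proof.
move=> e0.
have [r1 r10 r1P] : exists2 r1 : R, (0 < r1)%R &
    hball A0 r1 `<=` [set B | (enorm2 (F B) < enorm2 (F A0) + 1)%R].
  apply/nbhs_hballP.
  have c : continuous (fun B => enorm2 (F B)).
    move=> B; apply: (@continuous_comp _ _ _ F (@enorm2 R)).
      exact: C1H_continuous.
    exact: enorm2_continuous.
  by have /cvgr_lt/(_ (enorm2 (F A0) + 1)%R) := c A0; apply; rewrite ltrDl.
pose M : R := (enorm2 (F A0) + hdist A0 0%R + 1)%R.
have F0 := enorm2_ge0 (F A0); have d0 := hdist_ge0 A0 0%R.
have M0 : (0 < M)%R by rewrite /M; lra.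
have [dlt dlt0 dltP] := EA M0 e0.
exists (Num.min r1 (Num.min 1 (dlt / 2)))%R; first by rewrite !lt_min r10 ltr01 divr_gt0.
move=> a A B S ABS Sa.
have sub C : S C -> [/\ hdist C A0 < r1, hdist C A0 < 1, hdist C A0 < dlt / 2 & F C = a]%R.
  by move=> /Sa[]; rewrite /hball/= !lt_min => /and3P[? ? ?] ?; split.
have [SA SB] := simple_arc_ends ABS.
have [A1 A2 A3 FA] := sub _ SA; have [B1 B2 B3 FB] := sub _ SB.
have := dltP a A B S _ ABS.
have aM : (enorm2 a <= M)%R by have /ltW := r1P _ A1; rewrite /= FA /M; lra.
have SM : S `<=` hball 0%R M `&` F @^-1` [set a].
  move=> C /sub[_ C2 _ FC]; split => //; rewrite /hball/=.
  have := hdistD C A0 0%R; rewrite /M; lra.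
have AB : (hdist A B < dlt)%R by have := hdistD A A0 B; rewrite (hdistC A0 B); lra.
move=> /(_ aM SM AB); have := hausdorff_ge0 hdist 1 S.
case: (H2 S) => [x|//|] /=; last by rewrite leye_eq.
by rewrite !lee_fin => _; rewrite ler_norml => /andP[? ?]; apply/andP; split; lra.
Qed.

Lemma level_tile (A0 : heis R) (e : R) : (0 < e)%R -> (e <= 1 / 1000)%R ->
  exists2 r : R, (0 < r)%R & forall A s a, (0 < s)%R -> (hdist A A0 + 200 * s < r)%R ->
  let q := (linv (dh F A0) a - linv (dh F A0) (F A))%R in
  let N := H2 (F @^-1` [set a] `&` htile A s) in
  [/\ N <= ((1 + e) * ((1 + 500 * e) * s ^+ 2))%:E,
    N != 0 -> (- (2 * (e * s)) <= q.1 <= s + 2 * (e * s) /\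
       - (2 * (e * s)) <= q.2 <= s + 2 * (e * s))%R &
    (20 * (e * s) <= q.1 <= s - 20 * (e * s))%R ->
    (20 * (e * s) <= q.2 <= s - 20 * (e * s))%R ->
    ((1 - e) * ((1 - 500 * e) * s ^+ 2))%:E <= N].
Proof.
move=> e0 e1.
have [r1 r10 r1P] := ahlfors_local A0 e0.
have [r2 r20 r2P] := C1H_normalized CF (D0 A0) e0.
pose g := dh F A0; pose f := linv g \o F; pose r : R := Num.min r1 r2.
have r12 : (r <= r1)%R /\ (r <= r2)%R by rewrite !ge_min !lexx orbT.
exists r; first by rewrite lt_min r10.
move=> A s a s0 As q N.
have cf : continuous f.
  move=> B; apply: (@continuous_comp _ _ _ F (linv g)); first exact: C1H_continuous.
  exact: linv_continuous.
have fpi B C : (hdist B A0 < r)%R -> (hdist C A0 < r)%R ->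
    (enorm2 (f C - f B - (C.1 - B.1)) <= e * hdist B C)%R.
  by move=> Br Cr; apply: r2P; apply: lt_le_trans r12.2.
(* [linv g] is injective, so [f] has the same level sets as [F], relabelled. *)
have fF B : f B = linv g a <-> F B = a.
  split => [fB|<-//]; rewrite -(linvKV CF (F B) (D0 A0)) -(linvKV CF a (D0 A0)).
  by rewrite -/g -fB.
have arc P P' : f P = linv g a -> simple_arc P P' (level_itv f A0 r P P') ->
    ((1 - e) * hdist P P' ^+ 2)%:E <= H2 (level_itv f A0 r P P') <= ((1 + e) * hdist P P' ^+ 2)%:E.
  move=> fP arcP; apply: (r1P a) => // C [Cr fC _ _]; split.
    by apply: lt_le_trans r12.1.
  by apply/fF; rewrite fC.
have up C : htile A s C -> F C = a -> N <= ((1 + e) * ((1 + 500 * e) * s ^+ 2))%:E.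
  move=> AC /fF fC.
  have [P [P' [fP arcP PP' sub]]] := tile_level_upper cf e0 e1 fpi s0 As AC fC.
  have /andP[_ h] := arc _ _ fP arcP.
  apply: (@le_trans _ _ (H2 (level_itv f A0 r P P'))).
    by apply: le_hausdorff => B [FB AB]; apply: sub; split => //; apply/fF.
  apply: le_trans h _; rewrite lee_fin ler_pM2l//; lra.
have [[C [FC AC]]|nC] := pselect (F @^-1` [set a] `&` htile A s !=set0).
- split; first exact: (up C).
    by move=> _; have /fF fC := FC; exact: (tile_level_value e0 fpi s0 As AC fC).
  move=> q1 q2; have [P [P' [fP arcP PP' sub]]] := tile_level_lower cf e0 e1 fpi s0 As q1 q2.
  have /andP[h _] := arc _ _ fP arcP.
  apply: le_trans (le_trans h _); first by rewrite lee_fin ler_pM2l//; lra.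
  by apply: le_hausdorff => B /sub[AB fB]; split => //; apply/fF.
- have N0 : N = 0.
    rewrite /N (_ : _ `&` _ = set0) ?hausdorff0//.
    by apply/seteqP; split => // B BN; apply: nC; exists B.
  split; [|by rewrite N0 eqxx|].
    rewrite N0 lee_fin; apply: mulr_ge0; first by lra.
    by apply: mulr_ge0; [lra|exact: sqr_ge0].
  move=> q1 q2; have [P [P' [fP arcP PP' sub]]] := tile_level_lower cf e0 e1 fpi s0 As q1 q2.
  exfalso; apply: nC; exists P; have [SP _] := simple_arc_ends arcP.
  by have [AP fP'] := sub _ SP; split => //; apply/fF.
Qed.

(** A tile is no neighbourhood of its corner; moving the corner back by half a tile puts a ball
    around [A] inside, so that bounds on tiles give local finiteness. *)
Lemma htile_center (A : heis R) (s : R) : (0 < s)%R ->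
  exists2 A' : heis R, (hdist A' A <= s)%R & hball A (s / 8) `<=` htile A' s.
Proof.
move=> s0; have s0' := ltW s0.
have s2 : (0 < s ^+ 2)%R by rewrite exprn_gt0.
exists (hmul A (- (s / 2), - (s / 2), - (s ^+ 2 / 2))%R).
  rewrite hdist_mulr hrho_le//= enorm2_le//= !normrN ger0_norm; last by rewrite divr_ge0// ltW.
  by apply/andP; split; lra.
move=> B; rewrite /hball/= -{1}(hmulVKh A B) hdist_mulr.
rewrite hrho_lt ?divr_gt0// => /andP[].
set D := hmul (hinv A) B.
rewrite enorm2_lt ?divr_gt0// => xy; rewrite ltr_norml => /andP[z1 z2].
have [x1 x2] : (- (s / 8) < D.1.1 /\ D.1.1 < s / 8)%R.
  by have := sqr_ge0 D.1.2; split; nra.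
have [y1 y2] : (- (s / 8) < D.1.2 /\ D.1.2 < s / 8)%R.
  by have := sqr_ge0 D.1.1; split; nra.
apply/htileE; rewrite /hzeta.
have -> : B = hmul A D by rewrite /D hmulVKh.
have -> : hmul (hinv (hmul A (- (s / 2), - (s / 2), - (s ^+ 2 / 2))%R)) (hmul A D) =
    hmul (s / 2, s / 2, s ^+ 2 / 2)%R D.
  by apply: heis_eqP => /=; ring.
clear -s0 s2 x1 x2 y1 y2 z1 z2.
move: D x1 x2 y1 y2 z1 z2 => [[x y] z] /= x1 x2 y1 y2 z1 z2.
split; apply/andP; split; try lra; nra.
Qed.

Lemma level_locally_fin a (A : heis R) :
  exists2 r : R, (0 < r)%R & H2 (F @^-1` [set a] `&` hball A r) < +oo.
Proof.
have e0 : (0 < (1 / 1000 : R))%R by lra.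
have [r r0 rP] := level_tile A e0 (lexx _).
have s0 : (0 < r / 400)%R by lra.
have [A' A'A sub] := htile_center A s0.
exists (r / 400 / 8)%R; first by rewrite divr_gt0.
have [|h _ _] := rP A' (r / 400)%R a s0; first by lra.
by apply: le_lt_trans (le_lt_trans h (ltry _)); apply: le_hausdorff; exact: setIS.
Qed.

Lemma measurable_level E : measurable E ->
  measurable_fun setT (fun a : R * R => H2 (F @^-1` [set a] `&` E)).
Proof.
move=> mE; apply: measurable_hausdorff_level => //; first exact: C1H_continuous.
exact: level_locally_fin.
Qed.

Definition level_integral E : \bar R :=
  \int[lebesgue_measure \x lebesgue_measure]_a H2 (F @^-1` [set a] `&` E).

Lemma level_integral_semi_sigma_additive : semi_sigma_additive level_integral.
Proof.
move=> E mE tE mUE.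
have mL a : measurable (F @^-1` [set a]).
  by apply: heis_closed_measurable; apply: closed_level; exact: C1H_continuous.
have -> : level_integral (\bigcup_n E n) = \sum_(0 <= i <oo) level_integral (E i).
  rewrite -(@integral_nneseries _ (measurableTypeR R * measurableTypeR R)%type R
     (lebesgue_measure \x lebesgue_measure) setT measurableT
     (fun i a => H2 (F @^-1` [set a] `&` E i)))//.
  - apply: eq_integral => a _; rewrite setI_bigcupr.
    apply: measure_semi_bigcup.
    + by move=> i; exact: measurableI.
    + exact: trivIset_setIl.
    + by rewrite -setI_bigcupr; exact: measurableI.
  - by move=> n; exact: measurable_level.
apply: is_cvg_nneseries => n _ _; apply: integral_ge0 => a _; exact: hausdorff_ge0.
Qed.

Lemma leb2_box (a b c d : R) : (a <= b)%R -> (c <= d)%R ->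
  leb2 (`[a, b]%classic `*` `[c, d]%classic) = ((b - a) * (d - c))%:E.
Proof.
have itvE (x y : R) : (x <= y)%R -> lebesgue_measure (`[x, y]%classic : set R) = (y - x)%:E.
  rewrite lebesgue_measure_itv/= lte_fin le_eqVlt => /orP[/eqP->|->]; first by rewrite ltxx subrr.
  by rewrite EFinB.
by move=> ab cd; rewrite product_measure1E// EFinM; congr (_ * _); exact: itvE.
Qed.

(** [S] is the image of a square of side v - u under the differential at [A0]. *)
Lemma leb2_linv_box (A0 : heis R) (p : R * R) (u v : R) : (u <= v)%R ->
  let S := [set a | u <= (linv (dh F A0) a - p).1 <= v /\ u <= (linv (dh F A0) a - p).2 <= v]%R in
  measurable S /\ leb2 S = (`|det2 (dh F A0)| * (v - u) ^+ 2)%:E.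
Proof.
move=> uv S.
have SE : S = linv (dh F A0) @^-1`
    (`[p.1 + u, p.1 + v]%classic `*` `[p.2 + u, p.2 + v]%classic)%R.
  apply/seteqP; split => a; rewrite /S /= !in_itv/= !lerBrDl !lerBlDl//.
have mS : measurable S.
  rewrite SE -[X in measurable X]setCK; apply: measurableC; apply: open_measurable2.
  apply: closed_openC; apply: closed_comp; first by move=> x _; exact: linv_continuous.
  apply: closedI; apply: closed_comp; try exact: itv_closed; move=> x _; (exact: cvg_fst || exact: cvg_snd).
split => //.
have dE := det2E (dh F A0).
rewrite (@lebesgue2_linear R (dh F A0 (1, 0)%R).1 (dh F A0 (0, 1)%R).1
  (dh F A0 (1, 0)%R).2 (dh F A0 (0, 1)%R).2)//; last by rewrite -dE.
rewrite -dE EFinM; congr (_ * _).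
have -> : (fun x : R * R => ((dh F A0 (1, 0)).1 * x.1 + (dh F A0 (0, 1)).1 * x.2,
    (dh F A0 (1, 0)).2 * x.1 + (dh F A0 (0, 1)).2 * x.2))%R = dh F A0.
  apply/funext => x; rewrite (dh_lin CF A0 x) [RHS]surjective_pairing.
  by congr (_, _); rewrite /= /GRing.scale/=; ring.
rewrite (_ : _ @^-1` S = `[p.1 + u, p.1 + v]%classic `*` `[p.2 + u, p.2 + v]%classic)%R.
  by rewrite leb2_box ?lerD2l//; congr (_%:E); ring.
by rewrite SE; apply/funext => x; rewrite /preimage /mkset linvK.
Qed.

Lemma level_integral_tile (A0 : heis R) (e : R) : (0 < e)%R ->
  exists2 r : R, (0 < r)%R & forall A s, (0 < s)%R -> (hdist A A0 + 200 * s < r)%R ->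
    ((`|det2 (dh F A0)| - e) * s ^+ 4)%:E <= level_integral (htile A s) <=
    ((`|det2 (dh F A0)| + e) * s ^+ 4)%:E.
Proof.
move=> e0; set D := (`|_|)%R.
have D0' : (0 <= D)%R := normr_ge0 _.
(* [tile_constants] leaves a relative error 600h, to be at most e after multiplication by [D]. *)
pose h : R := (Num.min (1 / 1000) (e / (600 * D + 1)))%R.
have D1 : (0 < 600 * D + 1)%R by lra.
have h0 : (0 < h)%R by rewrite lt_min; apply/andP; split; [lra|exact: divr_gt0].
have h1 : (h <= 1 / 1000)%R by rewrite ge_min lexx.
have hD : (600 * h * D <= e)%R.
  have : (h * (600 * D + 1) <= e)%R by rewrite -ler_pdivlMr// ge_min lexx orbT.
  by lra.
have [k3 k4] := tile_constants (ltW h0) h1.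
have [r r0 rP] := level_tile A0 h0 h1.
exists r => // A s s0 As.
have s2 : (0 < s ^+ 2)%R by rewrite exprn_gt0.
have s4 : (0 < s ^+ 4)%R by rewrite exprn_gt0.
set p := linv (dh F A0) (F A).
set N := fun a : measurableTypeR R * measurableTypeR R => H2 (F @^-1` [set a] `&` htile A s).
have mN : measurable_fun setT N by apply: measurable_level; exact: measurable_htile.
have N0 a : 0 <= N a by exact: hausdorff_ge0.
apply/andP; split.
- have uv : (20 * (h * s) <= s - 20 * (h * s))%R by nra.
  have c0 : (0 <= (1 - h) * ((1 - 500 * h) * s ^+ 2))%R.
    by apply: mulr_ge0; [|apply: mulr_ge0; [|exact: ltW]]; clear - h1; lra.
  have [mS SE] := leb2_linv_box A0 p uv; set S := [set a | _] in mS SE.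
  apply: (@le_trans _ _ (\int[lebesgue_measure \x lebesgue_measure]_(a in S) N a)); last first.
    exact: ge0_subset_integral.
  apply: (@le_trans _ _ (\int[lebesgue_measure \x lebesgue_measure]_(a in S)
     cst ((1 - h) * ((1 - 500 * h) * s ^+ 2))%:E a)).
    rewrite integral_cst//= SE -EFinM lee_fin -/D.
    have -> : ((1 - h) * ((1 - 500 * h) * s ^+ 2) * (D * (s - 20 * (h * s) - 20 * (h * s)) ^+ 2) =
      ((1 - h) * (1 - 500 * h) * (1 - 40 * h) ^+ 2) * D * s ^+ 4)%R by ring.
    rewrite ler_pM2r//.
    have := ler_wpM2r D0' k3; clear - hD; lra.
  apply: ge0_le_integral => //.
  + exact: measurable_funTS.
  + by move=> a [Sa1 Sa2]; have [_ _ ] := rP A s a s0 As; exact.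
- have uv : (- (2 * (h * s)) <= s + 2 * (h * s))%R by nra.
  have [mS SE] := leb2_linv_box A0 p uv; set S := [set a | _] in mS SE.
  have -> : level_integral (htile A s) = \int[lebesgue_measure \x lebesgue_measure]_(a in S) N a.
    rewrite integral_mkcond; apply: eq_integral => a _; rewrite patchE.
    case: ifPn => // /negP nS; have [_ h2 _] := rP A s a s0 As.
    by apply/eqP; apply: contrapT => /negP/h2 Sa; apply: nS; rewrite inE.
  apply: (@le_trans _ _ (\int[lebesgue_measure \x lebesgue_measure]_(a in S)
     cst ((1 + h) * ((1 + 500 * h) * s ^+ 2))%:E a)).
    apply: ge0_le_integral => //; first exact: measurable_funTS.
    by move=> a _; have [] := rP A s a s0 As.
  rewrite integral_cst//= SE -EFinM lee_fin -/D.
  have -> : ((1 + h) * ((1 + 500 * h) * s ^+ 2) * (D * (s + 2 * (h * s) - - (2 * (h * s))) ^+ 2) =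
    ((1 + h) * (1 + 500 * h) * (1 + 4 * h) ^+ 2) * D * s ^+ 4)%R by ring.
  rewrite ler_pM2r//.
  have := ler_wpM2r D0' k4; clear - hD; lra.
Qed.

Definition jacobian_integral E : \bar R := \int[leb3]_(A in E) `|det2 (dh F A)|%:E.

Lemma measurable_jacobian (E : set (heis R)) :
  measurable_fun E (fun A => `|det2 (dh F A)|%:E).
Proof.
apply: measurable_funTS; apply/measurable_EFinP; apply: measurableT_comp => //.
by apply: heis_continuous_measurable_real; exact: det2_dh_continuous.
Qed.

Lemma jacobian_integral_semi_sigma_additive : semi_sigma_additive jacobian_integral.
Proof.
move=> E mE tE mUE.
rewrite [X in _ --> X](_ : _ = \sum_(0 <= i <oo) jacobian_integral (E i)).
  apply: is_cvg_nneseries => n _ _; apply: integral_ge0 => A _; by rewrite lee_fin.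
apply: ge0_integral_bigcup => //.
- exact: measurable_jacobian.
Qed.

Lemma jacobian_integral_tile (A0 : heis R) (e : R) : (0 < e)%R ->
  exists2 r : R, (0 < r)%R & forall A s, (0 < s)%R -> (hdist A A0 + 200 * s < r)%R ->
    ((`|det2 (dh F A0)| - e) * s ^+ 4)%:E <= jacobian_integral (htile A s) <=
    ((`|det2 (dh F A0)| + e) * s ^+ 4)%:E.
Proof.
move=> e0; set D := (`|_|)%R.
have [r r0 rP] : exists2 r : R, (0 < r)%R &
    hball A0 r `<=` [set B | (`|det2 (dh F A0) - det2 (dh F B)| <= e)%R].
  by apply/nbhs_hballP; have /cvgr_dist_le/(_ e e0) := @det2_dh_continuous _ F CF A0.
exists r => // A s s0 As.
have AB B : htile A s B -> (D - e <= `|det2 (dh F B)| <= D + e)%R.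
  move=> /(htile_near s0) BA; have : hball A0 r B.
    by rewrite /hball/=; have := hdistD B A A0; lra.
  move=> /rP/= h; rewrite -ler_distlC; apply: le_trans h; exact: ler_dist_dist.
have mT := measurable_htile A s.
apply/andP; split.
(* For D <= e the lower bound is nonpositive; otherwise D - e is a nonnegative integrand. *)
- have [De|De] := leP D e.
    apply: (@le_trans _ _ 0); last by apply: integral_ge0 => B _; rewrite lee_fin.
    by rewrite lee_fin mulr_le0_ge0 ?subr_le0// exprn_ge0// ltW.
  rewrite EFinM -(leb3_htile A s0) -integral_cst//; apply: ge0_le_integral => //.
  + by move=> B _; rewrite lee_fin subr_ge0 ltW.
  + exact: measurable_jacobian.
  + by move=> B /AB/andP[].
- rewrite EFinM -(leb3_htile A s0) -integral_cst//; apply: ge0_le_integral => //.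
  + exact: measurable_jacobian.
  + by move=> B /AB/andP[].
Qed.

Lemma jacobian_ball_fin (r : R) : jacobian_integral (hball 0%R r) < +oo.
Proof.
have [r0|r0] := ltP r 0%R.
  rewrite (_ : hball 0%R r = set0) ?/jacobian_integral ?integral_set0//.
  apply/seteqP; split => // B /= Br.
  by have := le_lt_trans (hdist_ge0 B 0%R) (lt_trans Br r0); rewrite ltxx.
have [||B _ Bmax] := @compact_EVT_max _ _ (fun A => `|det2 (dh F A)|%R)
    [set B : heis R | (hdist B 0%R <= r)%R] _ (@compact_hdist_le R 0%R r).
- by exists 0%R; rewrite /= hdistxx.
- apply: continuous_subspaceT => A.
  apply: (@continuous_comp _ _ _ (fun A => det2 (dh F A)) (fun x : R => `|x|%R)); last exact: norm_continuous.
  exact: det2_dh_continuous.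
have mb : measurable (hball (0%R : heis R) r) by apply: heis_open_measurable; exact: open_hball.
apply: (@le_lt_trans _ _ (\int[leb3]_(A in hball 0%R r) cst `|det2 (dh F B)|%:E A)).
  apply: ge0_le_integral => //; first exact: measurable_jacobian.
  by move=> A Ar; rewrite lee_fin; apply: Bmax; rewrite inE; exact: ltW.
rewrite integral_cst//; apply: lte_mul_pinfty => //.
by apply: (@leb3_bounded_fin R _ r) => //.
Qed.

Lemma area_formula_lebesgue E : measurable E -> level_integral E = jacobian_integral E.
Proof.
move=> mE.
have nu0 : level_integral set0 = 0.
  by rewrite /level_integral; apply: integral0_eq => a _; rewrite setI0 hausdorff0.
have nu_ge0 X : 0 <= level_integral X by apply: integral_ge0 => a _; exact: hausdorff_ge0.
have mu0 : jacobian_integral set0 = 0 by rewrite /jacobian_integral integral_set0.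
have mu_ge0 X : 0 <= jacobian_integral X by apply: integral_ge0 => a _; rewrite lee_fin.
have [nu nuE] := measure_exists nu0 nu_ge0
  level_integral_semi_sigma_additive.
have [mu muE] := measure_exists mu0 mu_ge0
  jacobian_integral_semi_sigma_additive.
(* The sides are exchanged because finiteness on balls is at hand for the Jacobian integral. *)
rewrite -nuE -muE; apply/esym.
apply: tile_measure_unique => //.
- apply: tile_le_local => A0 e e0.
  have e20 : (0 < e / 2)%R by rewrite divr_gt0.
  have [r r0 rP] := level_integral_tile A0 e20.
  have [r' r'0 r'P] := jacobian_integral_tile A0 e20.
  exists (Num.min r r')%R; first by rewrite lt_min r0.
  move=> A s s0; rewrite lt_min nuE muE => /andP[/(rP _ _ s0)/andP[h _] /(r'P _ _ s0)/andP[_ h']].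
  apply: le_trans h' _; apply: le_trans (leeD2r _ h).
  by rewrite -EFinD lee_fin -mulrDl ler_wpM2r ?exprn_ge0 ?(ltW s0)//; lra.
- apply: tile_le_local => A0 e e0.
  have e20 : (0 < e / 2)%R by rewrite divr_gt0.
  have [r r0 rP] := level_integral_tile A0 e20.
  have [r' r'0 r'P] := jacobian_integral_tile A0 e20.
  exists (Num.min r r')%R; first by rewrite lt_min r0.
  move=> A s s0; rewrite lt_min nuE muE => /andP[/(rP _ _ s0)/andP[_ h] /(r'P _ _ s0)/andP[h' _]].
  apply: le_trans h _; apply: le_trans (leeD2r _ h').
  by rewrite -EFinD lee_fin -mulrDl ler_wpM2r ?exprn_ge0 ?(ltW s0)//; lra.
- by move=> r; rewrite muE; exact: jacobian_ball_fin.
Qed.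

End LevelTiles.

Theorem mainTheorem4 (R : realType) :
  exists2 c : R, 0 < c &
    forall F : heis R -> R * R,
      C1H F ->
      (forall A : heis R, det2 (dh F A) != 0) ->
      equi_strongly_Ahlfors_regular F ->
      forall E : set (heis R), measurable E ->
        measurable_fun setT
          (fun a : R * R => hausdorff hdist 2 (F @^-1` [set a] `&` E)) /\
        (\int[lebesgue_measure \x lebesgue_measure]_a
            hausdorff hdist 2 (F @^-1` [set a] `&` E)
         = c%:E * \int[hausdorff hdist 4]_(A in E) `|det2 (dh F A)|%:E)%E.
Proof.
(* The constant is chosen before [F]; it enters only in passing from Lebesgue measure to H^4. *)
have [c c0 cE] := @leb3_hausdorff4 R.
exists c => // F CF D0 EA E mE; split; first exact: measurable_level.
rewrite [LHS](area_formula_lebesgue CF D0 EA mE) /jacobian_integral.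
have -> : c%:E = (NngNum (ltW c0))%:num%:E by [].
rewrite -ge0_integral_mscale//; last exact: measurable_jacobian.
by apply: eq_measure_integral => A mA _; exact: cE.
Qed.
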